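(* Let $\mu(v)=e^{-|v|^2}$ and $\langle v\rangle=(1+|v|^2)^{1/2}$ for $v\in\mathbb{R}^3$, and let $Q$ be the Coulomb collision operator ($\gamma=-3$). There exist a weight $W$ with $1\lesssim W(v)\lesssim\langle v\rangle^{21/2}$ and an absolute constant $c_*>0$ such that for any radially symmetric function $f$ orthogonal to $1,v_i,|v|^2$, $i=1,2,3$, we have $$\int_{\mathbb{R}^3}\big(Q(f,\mu)+Q(\mu,f)\big)\,f\,W\,dv\le -c_*\int_{\mathbb{R}^3}\langle v\rangle^{-3}\big(f^2+|\nabla f|^2\big)W\,dv .$$
   Context: The Coulomb collision operator is $$Q(f,g)(v)=\partial_{v_i}\int_{\mathbb{R}^3}\phi^{ij}(v-\tilde v)\Big(f(\tilde v)\,\partial_jg(v)-g(v)\,\partial_jf(\tilde v)\Big)d\tilde v,\qquad \phi^{ij}(v)=\frac1{8\pi}\Big(\delta_{ij}-\frac{v_iv_j}{|v|^2}\Big)\frac1{|v|},$$ with summation over repeated indices $i,j\in\{1,2,3\}$. Orthogonality of $f$ to $h$ means $\int_{\mathbb{R}^3}f\,h\,dv=0$. The notation $A\lesssim B$ means $A\le CB$ for some absolute constant $C>0$. *)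

(* Defs.v *)
From HB Require Import structures.
From mathcomp Require Import all_boot all_order all_algebra.
From mathcomp Require Import all_classical all_reals all_analysis.

Set Implicit Arguments.
Unset Strict Implicit.
Unset Printing Implicit Defensive.

Import Order.TTheory GRing.Theory Num.Theory.
Import numFieldNormedType.Exports.

Local Open Scope classical_set_scope.
Local Open Scope ring_scope.

Section LandauCoulomb.
Variable R : realType.

(* The library norm `|v| on row vectors is the sup norm, which induces the
   usual topology; [enorm] is the Euclidean norm. *)
Definition enorm (v : 'rV[R]_3) : R := Num.sqrt (\sum_(i < 3) v 0 i ^+ 2).

Definition bracket (v : 'rV[R]_3) : R := Num.sqrt (1 + enorm v ^+ 2).

Definition partial (i : 'I_3) (f : 'rV[R]_3 -> R) (v : 'rV[R]_3) : R :=
  'D_(delta_mx 0 i) f v.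

Definition grad_sqr (f : 'rV[R]_3 -> R) (v : 'rV[R]_3) : R :=
  \sum_(i < 3) partial i f v ^+ 2.

Definition C1 (f : 'rV[R]_3 -> R) : Prop :=
  continuous f /\
  forall i, (forall v, derivable f v (delta_mx 0 i)) /\ continuous (partial i f).

Definition C2 (f : 'rV[R]_3 -> R) : Prop :=
  C1 f /\ forall i, C1 (partial i f).

Definition radial (f : 'rV[R]_3 -> R) : Prop :=
  forall v w, enorm v = enorm w -> f v = f w.

(* Row vectors carry no sigma-algebra in the library: measurability and
   integration on 'rV[R]_3 are transported from R * R * R along [vec3]. *)
Local Notation mR := (measurableTypeR R).

Definition vec3 (p : mR * mR * mR) : 'rV[R]_3 :=
  \row_(i < 3) [:: p.1.1; p.1.2; p.2]`_i.

Definition leb3 : {measure set (mR * mR * mR)%type -> \bar R} :=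
  ((@lebesgue_measure R \x @lebesgue_measure R) \x @lebesgue_measure R)%E.

Definition measurable3 (f : 'rV[R]_3 -> R) : Prop :=
  measurable_fun setT (f \o vec3).

Definition integrable3 (f : 'rV[R]_3 -> R) : Prop :=
  leb3.-integrable setT (EFin \o (f \o vec3)).

Definition int3 (f : 'rV[R]_3 -> R) : R := \int[leb3]_(p in setT) f (vec3 p).

Definition orthogonal3 (f h : 'rV[R]_3 -> R) : Prop :=
  integrable3 (fun v => f v * h v) /\ int3 (fun v => f v * h v) = 0.

(* The value at v = 0 is irrelevant: the kernel only occurs under an integral. *)
Definition coulomb_kernel (i j : 'I_3) (v : 'rV[R]_3) : R :=
  (8 * pi)^-1 * ((i == j)%:R - v 0 i * v 0 j / enorm v ^+ 2) / enorm v.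

Definition Q_flux (f g : 'rV[R]_3 -> R) (i : 'I_3) (v : 'rV[R]_3) : R :=
  int3 (fun w => \sum_(j < 3) coulomb_kernel i j (v - w) *
                   (f w * partial j g v - g v * partial j f w)).

Definition Q (f g : 'rV[R]_3 -> R) (v : 'rV[R]_3) : R :=
  \sum_(i < 3) partial i (Q_flux f g i) v.

Definition maxwellian (v : 'rV[R]_3) : R := expR (- enorm v ^+ 2).

Definition linearized_Q (f : 'rV[R]_3 -> R) (v : 'rV[R]_3) : R :=
  Q f maxwellian v + Q maxwellian f v.

End LandauCoulomb.

(* Main.v *)
Require Import Defs.
From HB Require Import structures.
From mathcomp Require Import all_boot all_order all_algebra.
From mathcomp Require Import all_classical all_reals all_analysis.
From mathcomp Require Import measurable_realfun ring lra.
Import Order.TTheory GRing.Theory Num.Theory.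
Import numFieldNormedType.Exports.
Set Implicit Arguments.
Unset Strict Implicit.
Unset Printing Implicit Defensive.
Local Open Scope classical_set_scope.
Local Open Scope ring_scope.

(* For a radial f with profile u, integrating the kernel over spherical shells shows
   that the flux of Q(f,mu) + Q(mu,f) is radial and that the operator equals a
   constant times r^-2 S'(r), where S = N (u' + 2 r u) - mu Z, N is a multiple of
   the mass of mu in the ball of radius r divided by r, and Z is built from the
   moments of u in that ball and from the tail of s u(s).
   The weight W is 1 / mu up to a radius b and grows like r^(21/2) beyond it.
   On [0, b] a Jacobi transformation writes the energy as a positive quadratic form
   minus a term at b, which the vanishing of mass and energy controls through an
   integral identity for u(b). Beyond b, integration by parts makes the local part of
   S coercive for W, and Z, which the same two moment conditions express by integrals
   over [r, oo[, enters only with Gaussian weight. The boundary term at infinity is r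
   times an integrable function, hence small along a sequence of radii. *)

(** * Integrals over segments *)

(** The exponent 21/2 comes from the energy moment. Beyond [b] the estimate controls the integral of
    [wt r / r * (u ^ 2 + u1 ^ 2)], and by Cauchy-Schwarz this bounds the tail of [s ^ 4 * |u s|]
    only if [s ^ 9 / wt s] is integrable at infinity, that is, if the exponent exceeds 10. The two
    pieces of the weight meet at a price. Integration by parts beyond [b] loses about [w / 2] with
    [w = gmass b * igau b * u b ^ 2], and the dissipation [D] on [[0, b]] has to pay for it. The
    integral identity for [u b] contains a free constant; its best choice gives [w <= 9 / 8 * D] up
    to small terms, so a fixed share of [D] survives. The remaining errors carry a Gaussian factor
    or a negative power of [b], hence the large fixed [b]. Tails involve [u] on a whole half-line,
    so they are bounded by the supremum [X] of the outer norms and not by the norm up to the current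
    radius. The inequality on a bounded interval therefore keeps an error [X / 100], which is
    absorbed only along radii where the outer norm is close to [X]. *)

Section Calculus.
Context {R : realType}.
Implicit Types (f g F : R -> R) (a b x : R).

Lemma contD f g x : {for x, continuous f} -> {for x, continuous g} ->
  {for x, continuous (fun y => f y + g y)}.
Proof. by move=> cf cg; apply: (continuousD cf cg). Qed.

Lemma contN f x : {for x, continuous f} -> {for x, continuous (fun y => - f y)}.
Proof. by move=> cf; apply: (continuousN cf). Qed.

Lemma contM f g x : {for x, continuous f} -> {for x, continuous g} ->
  {for x, continuous (fun y => f y * g y)}.
Proof. by move=> cf cg; apply: (continuousM cf cg). Qed.

Lemma contV f x : f x != 0 -> {for x, continuous f} ->
  {for x, continuous (fun y => (f y)^-1)}.
Proof. by move=> f0 cf; apply: (continuousV f0 cf). Qed.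

Lemma contX f n x : {for x, continuous f} ->
  {for x, continuous (fun y => f y ^+ n)}.
Proof.
move=> cf; elim: n => [|n IH].
  have -> : (fun y => f y ^+ 0) = cst 1 by apply/funext => y; rewrite expr0.
  exact: cst_continuous.
have -> : (fun y => f y ^+ n.+1) = (fun y => f y * f y ^+ n).
  by apply/funext => y; rewrite exprS.
exact: contM.
Qed.

Lemma cont_cst (k : R) x : {for x, continuous (fun=> k)}.
Proof. exact: cst_continuous. Qed.

Lemma cont_id x : {for x, continuous (fun y : R => y)}.
Proof. exact: cvg_id. Qed.

Lemma cont_expR f x : {for x, continuous f} ->
  {for x, continuous (fun y => expR (f y))}.
Proof. by move=> cf; apply: (continuous_comp cf); exact: continuous_expR. Qed.

Lemma cont_sqrt f x : {for x, continuous f} ->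
  {for x, continuous (fun y => Num.sqrt (f y))}.
Proof. by move=> cf; apply: (continuous_comp cf); exact: sqrt_continuous. Qed.

Lemma cont_norm f x : {for x, continuous f} ->
  {for x, continuous (fun y => `|f y|)}.
Proof. by move=> cf; apply: (continuous_comp cf); exact: norm_continuous. Qed.

Lemma derD f g x (df dg : R) : is_derive x 1 f df -> is_derive x 1 g dg ->
  is_derive x 1 (fun y => f y + g y) (df + dg).
Proof. by move=> ? ?; exact: is_deriveD. Qed.

Lemma derN f x (df : R) : is_derive x 1 f df ->
  is_derive x 1 (fun y => - f y) (- df).
Proof. by move=> ?; exact: is_deriveN. Qed.

Lemma derM f g x (df dg : R) : is_derive x 1 f df -> is_derive x 1 g dg ->
  is_derive x 1 (fun y => f y * g y) (f x * dg + g x * df).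
Proof. by move=> ? ?; exact: is_deriveM. Qed.

Lemma derX f n x (df : R) : is_derive x 1 f df ->
  is_derive x 1 (fun y => f y ^+ n) (n%:R * f x ^+ n.-1 * df).
Proof.
case: n => [|n] dfx.
  have -> : (fun y => f y ^+ 0) = cst 1 by apply/funext => y; rewrite expr0.
  by rewrite !mul0r; exact: is_derive_cst.
have -> : (fun y => f y ^+ n.+1) = (f ^+ n.+1)%R.
  by apply/funext => y; rewrite /= exprfctE.
by apply: is_derive_eq; rewrite /= /GRing.scale /= mulr_natl.
Qed.

Lemma derV f x (df : R) : f x != 0 -> is_derive x 1 f df ->
  is_derive x 1 (fun y => (f y)^-1) (- (f x) ^- 2 * df).
Proof. by move=> f0 dfx; exact: is_deriveV. Qed.

Lemma der_cst (k : R) x : is_derive x 1 (fun=> k) 0.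
Proof. exact: is_derive_cst. Qed.

Lemma der_id x : is_derive x 1 (fun y : R => y) 1.
Proof. exact: is_derive_id. Qed.

Lemma der_expR f x (df : R) : is_derive x 1 f df ->
  is_derive x 1 (fun y => expR (f y)) (expR (f x) * df).
Proof. by move=> ?; apply: is_derive1_comp. Qed.

Lemma der_sqrt f x (df : R) : 0 < f x -> is_derive x 1 f df ->
  is_derive x 1 (fun y => Num.sqrt (f y)) ((2 * Num.sqrt (f x))^-1 * df).
Proof. by move=> f0 ?; apply: is_derive1_comp; exact: is_derive1_sqrt. Qed.

Lemma der_cont f x (df : R) : is_derive x 1 f df -> {for x, continuous f}.
Proof.
by move=> [dfx _]; apply: differentiable_continuous; exact/derivable1_diffP.
Qed.

Lemma derE f x (d d' : R) : is_derive x 1 f d -> d = d' -> is_derive x 1 f d'.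
Proof. by move=> ? <-. Qed.

Lemma der_near f g x (df : R) : (\near x, f x = g x) ->
  is_derive x 1 f df -> is_derive x 1 g df.
Proof. by move=> fg df'; exact: near_eq_is_derive fg df'. Qed.

End Calculus.

(* The tactics dispatch on the syntactic shape of the function: unification
   would unfold the integrals hidden in the definitions. *)
Ltac eta_head f := match f with (fun y => ?h y) => h | _ => f end.

Ltac cont_hyp x f :=
  let h := eta_head f in
  match goal with
  | H : prop_for x (inPhantom (continuous ?k)) |- _ =>
      let k' := eta_head k in constr_eq h k'; exact H
  | H : continuous_at x ?k |- _ =>
      let k' := eta_head k in constr_eq h k'; exact H
  | H : continuous ?k |- _ =>
      let k' := eta_head k in constr_eq h k'; exact (H x)
  end.

Ltac cont :=
  lazymatch goal with
  | |- prop_for ?x (inPhantom (continuous ?f)) =>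
    first [ cont_hyp x f | lazymatch f with
    | (fun _ => ?c) => apply: cont_cst
    | (fun y => y) => apply: cont_id
    | (fun y => (@?g y + @?h y)%R) => refine (contD (f := g) (g := h) _ _); cont
    | (fun y => (- @?g y)%R) => refine (contN (f := g) _); cont
    | (fun y => (@?g y * @?h y)%R) => refine (contM (f := g) (g := h) _ _); cont
    | (fun y => (@?g y ^+ ?n)%R) => refine (contX (n := n) (f := g) _); cont
    | (fun y => expR (@?g y)) => refine (cont_expR (f := g) _); cont
    | (fun y => Num.sqrt (@?g y)) => refine (cont_sqrt (f := g) _); cont
    | (fun y => (`| @?g y |)%R) => refine (cont_norm (f := g) _); cont
    | (fun y => ((@?g y)^-1)%R) => refine (contV (f := g) _ _); [ | cont ]
    | _ => idtac
    end ]
  | |- continuous_at ?x ?f => change (prop_for x (inPhantom (continuous f))); cont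
  | |- _ => idtac
  end.

Ltac der_hyp x f :=
  let h := eta_head f in
  match goal with
  | H : is_derive x _ ?k _ |- _ =>
      let k' := eta_head k in constr_eq h k'; exact H
  end.

Ltac der :=
  lazymatch goal with
  | |- is_derive ?x _ ?f _ =>
    first [ der_hyp x f | lazymatch f with
    | (fun _ => ?c) => notypeclasses refine (der_cst _ _)
    | (fun y => y) => notypeclasses refine (der_id _)
    | (fun y => (@?g y + @?h y)%R) =>
        notypeclasses refine (derD (f := g) (g := h) _ _); der
    | (fun y => (- @?g y)%R) => notypeclasses refine (derN (f := g) _); der
    | (fun y => (@?g y * @?h y)%R) =>
        notypeclasses refine (derM (f := g) (g := h) _ _); der
    | (fun y => (@?g y ^+ ?n)%R) =>
        notypeclasses refine (derX n (f := g) _); der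
    | (fun y => expR (@?g y)) => notypeclasses refine (der_expR (f := g) _); der
    | (fun y => Num.sqrt (@?g y)) =>
        notypeclasses refine (der_sqrt (f := g) _ _); [ | der ]
    | (fun y => ((@?g y)^-1)%R) =>
        notypeclasses refine (derV (f := g) _ _); [ | der ]
    | _ => idtac
    end ]
  | |- _ => idtac
  end.

Ltac dere := notypeclasses refine (derE _ _); [ der | cbv beta ].

Section SegmentIntegral.
Context {R : realType}.
Notation leb := (@lebesgue_measure R).
Implicit Types (f g F : R -> R) (a b c x k : R).

Definition pint a b f : R := \int[leb]_(x in `[a, b]) f x.

Definition cont_on a b f := forall x, a <= x <= b -> {for x, continuous f}.

(* A name for this statement keeps type-class resolution, which can be very
   slow on [is_derive], from being run on it. *)
Definition derives_on a b F f := forall x, a < x < b -> is_derive x 1 F (f x).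

Lemma cont_on_within a b f : cont_on a b f -> {within `[a, b], continuous f}.
Proof.
move=> cf; apply: continuous_in_subspaceT => x.
by rewrite inE/= in_itv/= => /cf.
Qed.

Lemma cont_on_integrable a b f : cont_on a b f ->
  leb.-integrable `[a, b] (EFin \o f).
Proof.
move=> cf; apply: continuous_compact_integrable; first exact: segment_compact.
exact: cont_on_within.
Qed.

Lemma cont_on_sub a b c d f : a <= c -> d <= b -> cont_on a b f -> cont_on c d f.
Proof.
move=> ac db cf x /andP[cx xd]; apply: cf.
by rewrite (le_trans ac cx) (le_trans xd db).
Qed.

Lemma pint_id a f : pint a a f = 0.
Proof. by rewrite /pint set_itv1 Rintegral_set1. Qed.

Lemma pint_gt a b f : b < a -> pint a b f = 0.
Proof.
move=> ba; rewrite /pint set_itv_ge ?Rintegral_set0//.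
by rewrite bnd_simp -ltNge.
Qed.

Lemma eq_pint a b f g : (forall x, a <= x <= b -> f x = g x) ->
  pint a b f = pint a b g.
Proof.
by move=> fg; apply: eq_Rintegral => x; rewrite inE/= in_itv/= => /fg.
Qed.

Lemma pintD a b f g : cont_on a b f -> cont_on a b g ->
  pint a b (fun x => f x + g x) = pint a b f + pint a b g.
Proof.
by move=> cf cg; apply: RintegralD => //; exact: cont_on_integrable.
Qed.

Lemma pintZ a b k f : cont_on a b f ->
  pint a b (fun x => k * f x) = k * pint a b f.
Proof. by move=> cf; apply: RintegralZl => //; exact: cont_on_integrable. Qed.

Lemma pintN a b f : cont_on a b f ->
  pint a b (fun x => - f x) = - pint a b f.
Proof.
move=> cf; rewrite -[RHS]mulN1r -pintZ//.
by apply: eq_pint => x _; rewrite mulN1r.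
Qed.

Lemma pintB a b f g : cont_on a b f -> cont_on a b g ->
  pint a b (fun x => f x - g x) = pint a b f - pint a b g.
Proof.
by move=> cf cg; apply: RintegralB => //; exact: cont_on_integrable.
Qed.

Lemma pint_le a b f g : cont_on a b f -> cont_on a b g ->
  (forall x, a <= x <= b -> f x <= g x) -> pint a b f <= pint a b g.
Proof.
by move=> cf cg fg; apply: le_Rintegral => //; exact: cont_on_integrable.
Qed.

Lemma pint_ge0 a b f : (forall x, a <= x <= b -> 0 <= f x) -> 0 <= pint a b f.
Proof. by move=> f0; apply: Rintegral_ge0 => x; rewrite /= in_itv/= => /f0. Qed.

Lemma pint_abs a b f : cont_on a b f ->
  `|pint a b f| <= pint a b (fun x => `|f x|).
Proof. by move=> cf; apply: le_normr_Rintegral => //; exact: cont_on_integrable. Qed.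

Lemma pint_split a b c f : a <= b -> b <= c -> cont_on a c f ->
  pint a c f = pint a b f + pint b c f.
Proof.
move=> ab bc cf.
have := @Rintegral_itvB R f (BLeft a) (BRight c) b (cont_on_integrable cf).
rewrite !bnd_simp => /(_ ab bc) E.
rewrite /pint -[X in _ = _ + X](@Rintegral_itv_obnd_cbnd R b (BRight c)).
  by rewrite -E addrC subrK.
apply: integrableS (cont_on_integrable (cont_on_sub ab (lexx c) cf)) => //.
by apply: subset_itvr; rewrite bnd_simp.
Qed.

Lemma pint_ftc a b f F : a <= b -> cont_on a b f -> cont_on a b F ->
  derives_on a b F f -> pint a b f = F b - F a.
Proof.
rewrite le_eqVlt => /predU1P[<- _ _ _|ab cf cF dF].
  by rewrite pint_id subrr.
have dFE x : x \in `]a, b[ -> derive1 F x = f x.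
  by rewrite in_itv/= => axb; rewrite derive1E; have [_ ->] := dF x axb.
have E := @continuous_FTC2 R f F a b ab (cont_on_within cf).
have {E} := E _ dFE.
rewrite /pint /Rintegral => ->; first by rewrite -EFinB.
split.
- by move=> x; rewrite in_itv/= => axb; have [] := dF x axb.
- apply: cvg_at_right_filter; apply: cF; rewrite lexx; exact: ltW.
- apply: cvg_at_left_filter; apply: cF; rewrite lexx andbT; exact: ltW.
Qed.

Lemma pint_ftc_eq F v a b f : a <= b -> cont_on a b f -> cont_on a b F ->
  derives_on a b F f -> F b - F a = v ->
  pint a b f = v.
Proof. by move=> ab cf cF dF <-; exact: pint_ftc. Qed.

Lemma pint_derive a f x : a < x -> (forall y, a <= y -> {for y, continuous f}) ->
  is_derive x 1 (fun y => pint a y f) (f x).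
Proof.
move=> ax cf.
have x1 : x < x + 1 by rewrite ltrDl.
have fi : leb.-integrable `[a, x + 1] (EFin \o f).
  by apply: cont_on_integrable => y /andP[ay _]; exact: cf.
have := @continuous_FTC1 R f (BLeft a) x (x + 1) x1 fi.
move=> /(_ ax (cf _ (ltW ax))) [d e].
by rewrite -e derive1E; apply: derivableP.
Qed.

(** Left of [a] the integral is the constant 0. At [a] itself, continuity of [f] bounds it nearby,
    so the integral up to [y] is at most a multiple of [y - a]. *)
Lemma pint_continuous a f : (forall y, a <= y -> {for y, continuous f}) ->
  continuous (fun y => pint a y f).
Proof.
move=> cf x; have [ax|xa|<-] := ltgtP a x.
- exact: der_cont (pint_derive ax cf).
- have E : \forall y \near x, cst 0 y = pint a y f.
    near=> y; rewrite pint_gt//; near: y; exact: lt_nbhsl.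
  rewrite /prop_for /continuous_at pint_gt//.
  by apply: cvg_trans (near_eq_cvg E) _; exact: cvg_cst.
- have [M [M0 Mf]] : exists M, 0 < M /\ \forall y \near a, `|f y| <= M.
    exists (`|f a| + 1); split; first by rewrite ltr_wpDl.
    have /cvgrPdist_lt/(_ 1 ltr01) := cf a (lexx a).
    apply: filterS => y fay; rewrite -(subrK (f a) (f y)) addrC.
    by rewrite (le_trans (ler_normD _ _))// lerD2l distrC ltW.
  have [d /= d0 dM] : exists2 d, 0 < d & forall y, `|a - y| < d -> `|f y| <= M.
    by have /nbhs_ballP[d /= d0 dM] := Mf; exists d => // y yd; exact: dM.
  rewrite /continuous_at pint_id; apply/cvgrPdist_lt => e e0.
  near=> y; rewrite sub0r normrN.
  have [ay|ya] := leP a y; last by rewrite pint_gt// normr0.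
  have cfy : cont_on a y f by move=> t /andP[+ _]; exact: cf.
  have yd : y - a < d.
    rewrite (le_lt_trans (ler_norm _))// distrC; near: y;
    exact: (nbhsx_ballx a d d0).
  rewrite (le_lt_trans (pint_abs cfy))//.
  apply: (@le_lt_trans _ _ (pint a y (cst M))).
    apply: pint_le.
    - by move=> t /cfy ?; cont.
    - by move=> t _; exact: cst_continuous.
    - move=> t /andP[at_ ty]; apply: dM.
      by rewrite distrC ger0_norm ?subr_ge0// (le_lt_trans _ yd)// lerB.
  have -> : pint a y (cst M) = M * y - M * a.
    apply: (@pint_ftc _ _ _ (fun t => M * t)) => //.
    - by move=> t _; exact: cst_continuous.
    - by move=> t _; cont.
    - move=> t _; dere.
      by rewrite /=; ring.
  rewrite -mulrBr mulrC -ltr_pdivlMr// (le_lt_trans (ler_norm _))// distrC.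
  by near: y; apply: (nbhsx_ballx a (e / M)); exact: divr_gt0.
Unshelve. all: by end_near. Qed.

(** The pointwise majorants [A] and [B] keep square roots out of the integrands. By [key], a
    quadratic polynomial with the three integrals as coefficients is nonnegative, and it is
    evaluated at its minimizer. *)
Lemma pint_CS a b (A B C : R -> R) : cont_on a b A -> cont_on a b B ->
  cont_on a b C -> (forall x, a <= x <= b -> 0 <= A x) ->
  (forall x, a <= x <= b -> 0 <= B x) ->
  (forall x, a <= x <= b -> C x ^+ 2 <= A x * B x) ->
  pint a b C ^+ 2 <= pint a b A * pint a b B.
Proof.
move=> cA cB cC A0 B0 CAB.
have IA0 := pint_ge0 A0; have IB0 := pint_ge0 B0.
have key t : 0 <= pint a b A * t ^+ 2 + 2 * t * pint a b C + pint a b B.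
  have -> : pint a b A * t ^+ 2 + 2 * t * pint a b C + pint a b B =
      pint a b (fun x => t ^+ 2 * A x + 2 * t * C x + B x).
    have c1 : cont_on a b (fun x => t ^+ 2 * A x).
      by move=> x /cA ?; cont.
    have c2 : cont_on a b (fun x => 2 * t * C x) by move=> x /cC ?; cont.
    have c3 : cont_on a b (fun x => t ^+ 2 * A x + 2 * t * C x).
      by move=> x xab; apply: contD; [exact: c1|exact: c2].
    by rewrite (pintD c3 cB) (pintD c1 c2) (pintZ _ cA) (pintZ _ cC); ring.
  apply: pint_ge0 => x xab.
  have a0 := A0 _ xab; have b0 := B0 _ xab; have cab := CAB _ xab.
  have n1 : 2 * `|t * C x| <= t ^+ 2 * A x + B x.
    have tA : 0 <= t ^+ 2 * A x by apply: mulr_ge0 => //; exact: sqr_ge0.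
    rewrite -ler_sqr ?nnegrE; [|exact: mulr_ge0|exact: addr_ge0].
    rewrite exprMn real_normK ?num_real// exprMn.
    have := sqr_ge0 (t ^+ 2 * A x - B x).
    have := ler_wpM2l (sqr_ge0 t) cab.
    set p := t ^+ 2 * C x ^+ 2; set q := t ^+ 2 * (A x * B x) => pq.
    have -> : (t ^+ 2 * A x - B x) ^+ 2 = (t ^+ 2 * A x + B x) ^+ 2 - 4 * q by rewrite /q; ring.
    by lra.
  have n2 := ler_norm (- (t * C x)); rewrite normrN in n2.
  rewrite /= -mulrA; move: n1 n2; set n := `|_|; set m := t * C x; set p := _ * A x.
  by lra.
set Ia := pint a b A in IA0 key *; set Ib := pint a b B in IB0 key *.
set Ic := pint a b C in key *.
have [Ia0|Ia0] := eqVneq Ia 0.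
  have [->|Ic0] := eqVneq Ic 0; first by rewrite expr0n/= mulr_ge0.
  (* Without quadratic term the polynomial is affine with nonzero slope; at this point its value is
     -1. *)
  have := key (- (Ib + 1) / (2 * Ic)).
  have -> : 2 * (- (Ib + 1) / (2 * Ic)) * Ic = - (Ib + 1) by field.
  by rewrite Ia0; lra.
have Iap : 0 < Ia by rewrite lt_def Ia0.
have := key (- Ic / Ia).
have -> : Ia * (- Ic / Ia) ^+ 2 + 2 * (- Ic / Ia) * Ic + Ib =
   (Ia * Ib - Ic ^+ 2) / Ia by field.
by rewrite pmulr_lge0 ?invr_gt0// subr_ge0.
Qed.

End SegmentIntegral.

(** * The Gaussian *)

Section Gaussian.
Context {R : realType}.
Implicit Types (x y r b : R).

Definition gau x : R := expR (- x ^+ 2).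
Definition igau x : R := expR (x ^+ 2).

Lemma gauE x : gau x = (igau x)^-1.
Proof. by rewrite /gau expRN. Qed.

Lemma igau_gt0 x : 0 < igau x. Proof. exact: expR_gt0. Qed.
Lemma igau_neq0 x : igau x != 0. Proof. by rewrite gt_eqF ?igau_gt0. Qed.
Lemma gau_gt0 x : 0 < gau x. Proof. exact: expR_gt0. Qed.

Lemma gau_le1 x : gau x <= 1.
Proof. by rewrite /gau -expR0 ler_expR oppr_le0 sqr_ge0. Qed.

Lemma gau_le x y : 0 <= x -> x <= y -> gau y <= gau x.
Proof. by move=> x0 xy; rewrite ler_expR lerN2 ler_pXn2r// nnegrE (le_trans x0). Qed.

Lemma der_gau x : is_derive x 1 gau (- 2 * x * gau x).
Proof. by rewrite /gau; dere; rewrite /=; ring. Qed.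

Lemma der_igau x : is_derive x 1 igau (2 * x * igau x).
Proof. by rewrite /igau; dere; rewrite /=; ring. Qed.

Lemma cont_gau : continuous gau.
Proof. by move=> x; apply: der_cont (der_gau x). Qed.

Lemma cont_igau : continuous igau.
Proof. by move=> x; apply: der_cont (der_igau x). Qed.

Lemma cont_monom_gau n : continuous (fun s : R => s ^+ n * gau s).
Proof. by move=> x; have ? := @cont_gau x; cont. Qed.

Definition gmass r : R := pint 0 r (fun s => s ^+ 2 * gau s).

Lemma der_gmass x : 0 < x -> is_derive x 1 gmass (x ^+ 2 * gau x).
Proof.
by move=> x0; apply: pint_derive => // y _; exact: cont_monom_gau.
Qed.

Lemma cont_gmass : continuous gmass.
Proof. by apply: pint_continuous => y _; exact: cont_monom_gau. Qed.

Lemma gmass0 : gmass 0 = 0. Proof. exact: pint_id. Qed.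

Lemma gmass_le0 x : x <= 0 -> gmass x = 0.
Proof.
rewrite le_eqVlt => /predU1P[->|x0]; first exact: gmass0.
exact: pint_gt.
Qed.

Lemma gmass_ge0 x : 0 <= gmass x.
Proof. by apply: pint_ge0 => y _; rewrite mulr_ge0 ?sqr_ge0// ltW ?gau_gt0. Qed.

Lemma gmass_lb x : 0 <= x -> x ^+ 3 * gau x / 3 <= gmass x.
Proof.
move=> x0; have -> : x ^+ 3 * gau x / 3 = pint 0 x (fun s => gau x * s ^+ 2).
  apply/esym; apply: (@pint_ftc_eq _ (fun s => gau x * s ^+ 3 / 3)) => //.
  - by move=> y _; cont.
  - by move=> y _; cont.
  - by move=> y _; dere; rewrite /=; field.
  - by field.
apply: pint_le.
- by move=> y _; cont.
- by move=> y _; exact: cont_monom_gau.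
- move=> y /andP[y0 yx]; rewrite mulrC ler_wpM2l ?sqr_ge0//; exact: gau_le.
Qed.

Lemma gmass_ub3 x : 0 <= x -> gmass x <= x ^+ 3 / 3.
Proof.
move=> x0; have -> : x ^+ 3 / 3 = pint 0 x (fun s => s ^+ 2).
  apply/esym; apply: (@pint_ftc_eq _ (fun s => s ^+ 3 / 3)) => //.
  - by move=> y _; cont.
  - by move=> y _; cont.
  - by move=> y _; dere; rewrite /=; field.
  - by field.
apply: pint_le.
- by move=> y _; exact: cont_monom_gau.
- by move=> y _; cont.
- by move=> y _; rewrite ler_piMr ?sqr_ge0// gau_le1.
Qed.

(** The bound [s ^ 2 <= (s ^ 3 + s) / 2] leads to an integrand with an elementary primitive, so the
    Gaussian integral need not be evaluated. *)
Lemma gmass_le_half x : 0 <= x -> gmass x <= 1 / 2.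
Proof.
move=> x0.
have cf : continuous (fun s : R => (s ^+ 3 + s) / 2 * gau s).
  by move=> y; have ? := @cont_gau y; cont.
apply: (@le_trans _ _ (pint 0 x (fun s => (s ^+ 3 + s) / 2 * gau s))).
  apply: pint_le.
  - by move=> y _; exact: cont_monom_gau.
  - by move=> y _; exact: cf.
  - move=> y /andP[y0 _]; rewrite ler_wpM2r ?(ltW (gau_gt0 _))//.
    have : 0 <= y * (y - 1) ^+ 2 by rewrite mulr_ge0 ?sqr_ge0.
    lra.
have -> : pint 0 x (fun s => (s ^+ 3 + s) / 2 * gau s) =
    1 / 2 - (x ^+ 2 + 2) * gau x / 4.
  apply: (@pint_ftc_eq _ (fun s => - ((s ^+ 2 + 2) / 4 * gau s))) => //.
  - by move=> y _; exact: cf.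
  - by move=> y _; have ? := @cont_gau y; cont.
  - by move=> y _; have ? := der_gau y; dere; rewrite /=; field.
  - have -> : gau 0 = 1 by rewrite /gau expr0n/= oppr0 expR0.
    by rewrite expr0n/=; field.
have := mulr_ge0 (addr_ge0 (sqr_ge0 x) (ler0n R 2)) (ltW (gau_gt0 x)).
lra.
Qed.

Lemma gmass_mono x y : 0 <= x -> x <= y -> gmass x <= gmass y.
Proof.
move=> x0 xy; rewrite /gmass [leRHS](@pint_split _ _ x)//.
  by rewrite lerDl pint_ge0// => z _; rewrite mulr_ge0 ?sqr_ge0// ltW ?gau_gt0.
by move=> z _; exact: cont_monom_gau.
Qed.

Lemma gmass_lb12 x : 1 <= x -> 1 / 12 <= gmass x.
Proof.
move=> x1; apply: le_trans (gmass_mono ler01 x1).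
apply: le_trans (gmass_lb ler01).
have : 1 / 2 <= expR (- (1 / 2)) :> R.
  by apply: le_trans (expR_ge1Dx _); lra.
have -> : gau 1 = expR (- (1 / 2)) ^+ 2 :> R.
  by rewrite /gau expr1n expr2 -expRD; congr expR; lra.
by rewrite expr1n; nra.
Qed.

(** Removes the apparent singularities of [gdiff] and [gdiff1] at 0, where the value given by
    division by 0 is the limit. *)
Lemma cont_at0 (f : R -> R) (C : R) :
  (forall x, `|f x| <= C * `|x|) -> {for 0, continuous f}.
Proof.
move=> fC.
have f0 : f 0 = 0 by apply/eqP; rewrite -normr_le0 (le_trans (fC 0))// normr0 mulr0.
rewrite /prop_for /continuous_at f0.
apply/cvgrPdist_le => e e0.
near=> y.
rewrite sub0r normrN (le_trans (fC y))//.
apply: (@le_trans _ _ ((`|C| + 1) * `|y|)).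
  by rewrite ler_wpM2r// (le_trans (ler_norm C))// lerDl.
rewrite mulrC -ler_pdivlMr//.
near: y; apply: (@nbhs0_le _ R).
exact: divr_gt0.
Unshelve. all: by end_near. Qed.

Definition gdiff r : R := gmass r / (2 * r).
Definition gdiff1 r : R := r * gau r / 2 - gmass r / (2 * r ^+ 2).

Lemma der_gdiff x : 0 < x -> is_derive x 1 gdiff (gdiff1 x).
Proof.
move=> x0; have dm := der_gmass x0; rewrite /gdiff; dere.
  by rewrite mulf_neq0 ?gt_eqF.
by rewrite /gdiff1; field; rewrite gt_eqF.
Qed.

Lemma gdiff_ge0 x : 0 <= gdiff x.
Proof.
have [x0|x0] := leP 0 x; first by rewrite divr_ge0 ?gmass_ge0// mulr_ge0.
by rewrite /gdiff gmass_le0 ?mul0r// ltW.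
Qed.

Lemma cont_gdiff : continuous gdiff.
Proof.
move=> x; have [x0|x0|->] := ltgtP x 0.
- have dx : is_derive x 1 (fun=> 0) (0 : R) by exact: der_cst.
  apply: (@der_cont _ _ _ 0); apply: der_near dx; near=> y.
  rewrite /gdiff gmass_le0 ?mul0r//; apply: ltW; near: y; exact: lt_nbhsl.
- exact: der_cont (der_gdiff x0).
- apply: (@cont_at0 _ 1) => y; rewrite mul1r.
  have [y0|y0] := leP y 0; first by rewrite /gdiff gmass_le0// mul0r normr0.
  rewrite ger0_norm ?gdiff_ge0// gtr0_norm//.
  rewrite /gdiff ler_pdivrMr ?mulr_gt0//.
  have := gmass_ub3 (ltW y0); have := gmass_le_half (ltW y0).
  have [y1|y1] := leP y 1; last by nra.
  have : y ^+ 3 <= y ^+ 2.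
    by rewrite exprS ler_piMl ?sqr_ge0.
  nra.
Unshelve. all: by end_near. Qed.

Lemma cont_gdiff1_ge0 x : 0 <= x -> {for x, continuous gdiff1}.
Proof.
rewrite le_eqVlt => /predU1P[<-|x0].
- apply: (@cont_at0 _ 1) => y; rewrite mul1r.
  have g1 := gau_le1 y; have g0 := gau_gt0 y.
  rewrite /gdiff1; have [y0|y0] := leP y 0.
    rewrite gmass_le0// mul0r subr0 !normrM normfV (ger0_norm (ltW g0)).
    rewrite (@ger0_norm _ 2)//; have := normr_ge0 y; nra.
  have := gmass_ub3 (ltW y0); have := gmass_ge0 y => m0 m1.
  have : gmass y / (2 * y ^+ 2) <= y / 6.
    rewrite ler_pdivrMr; first by nra.
    by rewrite mulr_gt0// exprn_gt0.
  have : 0 <= gmass y / (2 * y ^+ 2).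
    by rewrite divr_ge0// mulr_ge0// sqr_ge0.
  rewrite (gtr0_norm y0) ler_norml; nra.
- have dm := der_gmass x0; have cm := @cont_gmass x; have cg := @cont_gau x.
  rewrite /gdiff1; cont.
  by rewrite mulf_neq0// ?expf_neq0 ?gt_eqF.
Qed.

End Gaussian.

(** * The inner energy identity *)

Section Profile.
Context {R : realType} (u u1 u2 : R -> R) (H0 : R).
Context (du : forall x : R, is_derive x 1 u (u1 x))
  (du1 : forall x : R, is_derive x 1 u1 (u2 x)) (cu2 : continuous u2).

Lemma cont_u : continuous u. Proof. by move=> x; exact: der_cont (du x). Qed.
Lemma cont_u1 : continuous u1. Proof. by move=> x; exact: der_cont (du1 x). Qed.

(* [u] is the profile of the unknown and [H0] stands for the integral of [s * u s]
   over [0, oo[, so that [tailH] is its tail. Up to a constant, [Sflux r / r ^+ 2] is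
   the radial flux of the linearized operator (see [linearized_QE]). *)
Definition mom n r : R := pint 0 r (fun s => s ^+ n * u s).
Definition tailH r : R := H0 - mom 1 r.
Definition Gam r : R := - u r + 2 * tailH r.
Definition Zf r : R := 2 / 3 * (mom 4 r + r ^+ 3 * tailH r) - mom 2 r.
Definition gfun r : R := u1 r + 2 * r * u r.
Definition Sflux r : R := gdiff r * gfun r - gau r * Zf r.
Definition Sflux1 r : R := gdiff1 r * gfun r
  + gdiff r * (u2 r + 2 * u r + 2 * r * u1 r)
  + 2 * r * gau r * Zf r - gau r * (r ^+ 2 * Gam r).

Lemma cont_monom_u n : continuous (fun s : R => s ^+ n * u s).
Proof. by move=> x; have ? := @cont_u x; cont. Qed.

Lemma cont_mom n : continuous (mom n).
Proof. by apply: pint_continuous => y _; exact: cont_monom_u. Qed.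

Lemma der_mom n (x : R) : 0 < x -> is_derive x 1 (mom n) (x ^+ n * u x).
Proof.
by move=> x0; apply: pint_derive => // y _; exact: cont_monom_u.
Qed.

Lemma mom0 n : mom n 0 = 0. Proof. exact: pint_id. Qed.

Lemma cont_tailH : continuous tailH.
Proof. by move=> x; have ? := @cont_mom 1 x; rewrite /tailH; cont. Qed.

Lemma der_tailH (x : R) : 0 < x -> is_derive x 1 tailH (- (x * u x)).
Proof.
move=> x0; have ? := der_mom 1 x0; rewrite /tailH; dere.
by rewrite expr1 add0r.
Qed.

Lemma cont_Gam : continuous Gam.
Proof. by move=> x; have ? := @cont_tailH x; have ? := @cont_u x; rewrite /Gam; cont. Qed.

Lemma der_Gam (x : R) : 0 < x -> is_derive x 1 Gam (- gfun x).
Proof.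
move=> x0; have ? := der_tailH x0; have ? := du x; rewrite /Gam; dere.
by rewrite /gfun; ring.
Qed.

Lemma cont_Zf : continuous Zf.
Proof.
move=> x; have ? := @cont_tailH x; have ? := @cont_mom 4 x.
by have ? := @cont_mom 2 x; rewrite /Zf; cont.
Qed.

Lemma der_Zf (x : R) : 0 < x -> is_derive x 1 Zf (x ^+ 2 * Gam x).
Proof.
move=> x0; have ? := der_tailH x0; have ? := der_mom 4 x0.
have ? := der_mom 2 x0; rewrite /Zf; dere.
by rewrite /Gam /=; field.
Qed.

Lemma Zf0 : Zf 0 = 0.
Proof. by rewrite /Zf !mom0 expr0n/= mul0r !addr0 mulr0 subr0. Qed.

Lemma cont_gfun : continuous gfun.
Proof. by move=> x; have ? := @cont_u x; have ? := @cont_u1 x; rewrite /gfun; cont. Qed.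

Lemma cont_Sflux : continuous Sflux.
Proof.
move=> x; have ? := @cont_gfun x; have ? := @cont_gdiff R x.
have ? := @cont_Zf x; have ? := @cont_gau R x; rewrite /Sflux; cont.
Qed.

Lemma der_Sflux (x : R) : 0 < x -> is_derive x 1 Sflux (Sflux1 x).
Proof.
move=> x0; have ? := der_gdiff x0; have ? := der_Zf x0; have ? := der_gau x.
have ? := du x; have ? := du1 x; rewrite /Sflux /gfun; dere.
by rewrite /Sflux1 /gfun; ring.
Qed.

Lemma cont_Sflux1 (x : R) : 0 <= x -> {for x, continuous Sflux1}.
Proof.
move=> x0; have ? := @cont_gfun x; have ? := @cont_gdiff R x.
have ? := @cont_Zf x; have ? := @cont_gau R x; have ? := cont_gdiff1_ge0 x0.
have ? := @cu2 x; have ? := @cont_u x; have ? := @cont_u1 x.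
by have ? := @cont_Gam x; rewrite /Sflux1; cont.
Qed.

Lemma Sflux0 : Sflux 0 = 0.
Proof. by rewrite /Sflux Zf0 /gdiff gmass0 !mul0r mulr0 subrr. Qed.

Section Inner.
Context (b : R) (b0 : 0 < b).

Definition qf r : R := 2 * (Gam r - Gam b) * igau r.
Definition hf r : R := u r * igau r.
Definition hf1 r : R := gfun r * igau r.
Definition qf1 r : R := 2 * r * qf r - 2 * hf1 r.
Definition diss : R := pint 0 b (fun r => gdiff r * gau r / 4 * qf1 r ^+ 2).
(** The integral of [r ^ 2 * (Gam r - Gam b)] over [[0, b]]. The tails [tailH b] cancel in it, which
    leaves the moments of order 2 and 4 and the value [u b]. *)
Definition defect : R := Zf b - b ^+ 3 * Gam b / 3.

Lemma cont_qf : continuous qf.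
Proof.
by move=> x; have ? := @cont_Gam x; have ? := @cont_igau R x; rewrite /qf; cont.
Qed.

Lemma cont_hf : continuous hf.
Proof.
by move=> x; have ? := @cont_u x; have ? := @cont_igau R x; rewrite /hf; cont.
Qed.

Lemma cont_hf1 : continuous hf1.
Proof.
by move=> x; have ? := @cont_gfun x; have ? := @cont_igau R x; rewrite /hf1; cont.
Qed.

Lemma cont_qf1 : continuous qf1.
Proof.
by move=> x; have ? := @cont_qf x; have ? := @cont_hf1 x; rewrite /qf1; cont.
Qed.

Lemma der_qf (x : R) : 0 < x -> is_derive x 1 qf (qf1 x).
Proof.
move=> x0; have ? := der_Gam x0; have ? := der_igau x; rewrite /qf; dere.
by rewrite /qf1 /hf1 /qf; ring.
Qed.

Lemma der_hf (x : R) : is_derive x 1 hf (hf1 x).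
Proof.
have ? := du x; have ? := der_igau x; rewrite /hf; dere.
by rewrite /hf1 /gfun; ring.
Qed.

Lemma qf_b : qf b = 0. Proof. by rewrite /qf subrr mulr0 mul0r. Qed.

(* Jacobi's device: writing [Gam - Gam b = gau * qf / 2] turns the quadratic
   form into a perfect square, because [gau / 2] solves its Euler-Lagrange
   equation. *)
Lemma inner_energy :
  pint 0 b (fun r => Sflux r * hf1 r) = diss - Gam b * defect.
Proof.
have c1 : continuous (fun r : R => Sflux r * hf1 r).
  by move=> x; have ? := @cont_Sflux x; have ? := @cont_hf1 x; cont.
have c2 : continuous (fun r : R => gdiff r * gau r / 4 * qf1 r ^+ 2).
  move=> x; have ? := @cont_gdiff R x; have ? := @cont_qf1 x.
  by have ? := @cont_gau R x; cont.
suff : pint 0 b (fun r => Sflux r * hf1 r - gdiff r * gau r / 4 * qf1 r ^+ 2) =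
   - (Gam b * defect).
  rewrite pintB; [rewrite -/diss; lra| |].
  - by move=> x _; exact: c1.
  - by move=> x _; exact: c2.
(* The last two terms trade [- Zf * gfun] for [- r ^ 2 * (Gam - Gam b) ^ 2]; the first one then
   completes the square with [gdiff * igau * gfun ^ 2]. *)
apply: (@pint_ftc_eq _ (fun r => - (gmass r * gau r * qf r ^+ 2 / 4)
  + Zf r * (Gam r - Gam b) - Gam b * (Zf r - r ^+ 3 * Gam b / 3))).
- exact: ltW.
- by move=> x _; apply: contD; [exact: c1|apply: contN; exact: c2].
- move=> x _; have ? := @cont_gmass R x; have ? := @cont_gau R x.
  by have ? := @cont_qf x; have ? := @cont_Zf x; have ? := @cont_Gam x; cont.
- move=> x /andP[x0 _].
  have ? := der_gmass x0; have ? := der_gau x; have ? := der_qf x0.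
  have ? := der_Zf x0; have ? := der_Gam x0; dere.
  rewrite /Sflux /qf1 /hf1 /qf /gdiff /= gauE; field.
  by rewrite igau_neq0 gt_eqF.
- by rewrite qf_b Zf0 gmass0 /defect; ring.
Qed.

(** [Psi - gmass / 2] vanishes at 0 and has derivative [r * gmass r - (b ^ 2 - 3 / 2) / 2 * r ^ 2 *
    gau r]. Replacing [b ^ 2 - 1] by another constant would only change the multiple of the defect
    in [inner_trace]; this value minimizes the leading constant of [inner_trace_CS]. *)
Definition Psi r : R := gmass r * (r ^+ 2 - b ^+ 2 + 1) / 2 + r ^+ 3 * gau r / 4.

Lemma cont_Psi : continuous Psi.
Proof.
by move=> x; have ? := @cont_gmass R x; have ? := @cont_gau R x; rewrite /Psi; cont.
Qed.

(** The derivative of [gmass * hf - mom 2] is [gmass * hf1], and [hf1 = r * qf - qf1 / 2]. The term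
    in [qf] is integrated by parts with [Psi], without boundary term because [qf b = 0]. Mass and
    energy make [mom 2 b] small and leave only [u b] as the main part of the defect, so the trace of
    [hf] at [b] is governed by the dissipation. *)
Lemma inner_trace : gmass b * hf b =
  mom 2 b + (b ^+ 2 - 3 / 2) * defect - pint 0 b (fun r => Psi r * qf1 r).
Proof.
suff : pint 0 b (fun r => - (Psi r * qf1 r)) =
    gmass b * hf b - mom 2 b - (b ^+ 2 - 3 / 2) * defect.
  rewrite pintN; first lra.
  by move=> x _; have ? := @cont_Psi x; have ? := @cont_qf1 x; cont.
apply: (@pint_ftc_eq _ (fun r => gmass r * hf r - mom 2 r
  - (Psi r - gmass r / 2) * qf r
  - (b ^+ 2 - 3 / 2) * (Zf r - r ^+ 3 * Gam b / 3))).
- exact: ltW.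
- by move=> x _; have ? := @cont_Psi x; have ? := @cont_qf1 x; cont.
- move=> x _; have ? := @cont_gmass R x; have ? := @cont_hf x.
  have ? := @cont_qf x; have ? := @cont_Zf x; have ? := @cont_mom 2 x.
  by have ? := @cont_Psi x; cont.
- move=> x /andP[x0 _].
  have ? := der_gmass x0; have ? := der_gau x; have ? := der_qf x0.
  have ? := der_Zf x0; have ? := der_hf x; have ? := der_mom 2 x0.
  rewrite /Psi; dere.
  rewrite /qf1 /hf1 /qf /hf /= gauE; field.
  by rewrite igau_neq0.
- by rewrite qf_b Zf0 gmass0 mom0 /defect /Psi gmass0; ring.
Qed.

(** Cauchy-Schwarz against the weight of [diss]. The coefficient 1 of [gmass b * igau b] matters: it
    lets the dissipation outweigh the boundary loss of the outer region. *)
Lemma inner_trace_CS : pint 0 b (fun r => Psi r * qf1 r) ^+ 2 <=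
  diss * (gmass b * igau b + b ^+ 5).
Proof.
pose z (r : R) : R := r ^+ 2 - b ^+ 2 + 1.
(* This is [4 * Psi ^ 2 / (gdiff * gau)] with its last term [r ^ 7 * gau r / (2 * gmass r)] replaced
   by the upper bound that [gmass_lb] gives. *)
pose B (r : R) : R := 2 * r * gmass r * z r ^+ 2 * igau r + 2 * z r * r ^+ 4
   + 3 / 2 * r ^+ 4.
have cz : continuous z by move=> x; rewrite /z; cont.
have cB : continuous B.
  move=> x; have ? := @cont_gmass R x; have ? := @cont_igau R x.
  by have ? := @cz x; rewrite /B; cont.
have cA : continuous (fun r : R => gdiff r * gau r / 4 * qf1 r ^+ 2).
  move=> x; have ? := @cont_gdiff R x; have ? := @cont_qf1 x.
  by have ? := @cont_gau R x; cont.
have g0 (r : R) : 0 < gau r by exact: gau_gt0.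
have mi (r : R) : 0 <= r -> r ^+ 3 / 3 <= gmass r * igau r.
  move=> r0; have := ler_wpM2r (ltW (igau_gt0 r)) (gmass_lb r0).
  rewrite gauE; apply: le_trans.
  by rewrite le_eqVlt; apply/orP; left; apply/eqP; field; rewrite igau_neq0.
have B0 (r : R) : 0 <= r -> 0 <= B r.
  move=> r0; have -> : B r = 2 * r * z r ^+ 2 * (gmass r * igau r - r ^+ 3 / 3)
      + r ^+ 4 * (2 / 3) * (z r + 3 / 2) ^+ 2 by rewrite /B; field.
  apply: addr_ge0; apply: mulr_ge0.
  - by apply: mulr_ge0; [exact: mulr_ge0|exact: sqr_ge0].
  - by rewrite subr_ge0; exact: mi.
  - by apply: mulr_ge0 => //; exact: exprn_ge0.
  - exact: sqr_ge0.
apply: (@le_trans _ _ (diss * pint 0 b B)).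
  apply: pint_CS.
  - by move=> x _; exact: cA.
  - by move=> x _; exact: cB.
  - by move=> x _; have ? := @cont_Psi x; have ? := @cont_qf1 x; cont.
  - move=> x _; rewrite mulr_ge0 ?sqr_ge0// divr_ge0// mulr_ge0 ?gdiff_ge0//.
    exact: ltW (g0 x).
  - by move=> x /andP[x0 _]; exact: B0.
  - move=> x /andP[]; rewrite le_eqVlt => /predU1P[<- _|x0 _].
      by rewrite /Psi /gdiff /= gmass0 !mul0r expr0n/= !mul0r addr0 !mul0r expr0n.
    rewrite /= exprMn [leRHS]mulrAC; apply: ler_wpM2r; first exact: sqr_ge0.
    rewrite -subr_ge0.
    have -> : gdiff x * gau x / 4 * B x - Psi x ^+ 2 =
       3 * x ^+ 3 * gau x / 16 * (gmass x - x ^+ 3 * gau x / 3).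
      rewrite /B /Psi /gdiff gauE -/(z x); field.
      by rewrite igau_neq0 gt_eqF.
    rewrite mulr_ge0 ?subr_ge0 ?(gmass_lb (ltW x0))//.
    by rewrite divr_ge0// mulr_ge0 ?(ltW (g0 x))// mulr_ge0// exprn_ge0// ltW.
have d0 : 0 <= diss.
  apply: pint_ge0 => x _; rewrite mulr_ge0 ?sqr_ge0// divr_ge0//.
  by rewrite mulr_ge0 ?gdiff_ge0// ltW.
apply: ler_wpM2l => //.
(* With [gmass b] in place of [gmass r], the first term is the derivative of
   [gmass b * (z ^ 2 - 2 * z + 2) * igau], whose value at [b], where [z] is 1, is
   [gmass b * igau b]. The second uses [z <= 1]. *)
pose C (r : R) : R := 2 * r * gmass b * z r ^+ 2 * igau r + 7 / 2 * r ^+ 4.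
apply: (@le_trans _ _ (pint 0 b C)).
  apply: pint_le.
  - by move=> x _; exact: cB.
  - by move=> x _; have ? := @cz x; have ? := @cont_igau R x; rewrite /C; cont.
  - move=> x /andP[x0 xb]; rewrite /B /C -addrA lerD//.
      rewrite ler_wpM2r ?(ltW (igau_gt0 _))// ler_wpM2r ?sqr_ge0//.
      by rewrite ler_wpM2l ?gmass_mono// mulr_ge0.
    have : z x <= 1.
      have : x ^+ 2 <= b ^+ 2 by rewrite ler_pXn2r// nnegrE ?(le_trans x0).
      by rewrite /z; lra.
    by move=> z1; rewrite -mulrDl ler_wpM2r ?exprn_ge0//; lra.
have -> : pint 0 b C = gmass b * igau b + 7 / 10 * b ^+ 5
    - gmass b * (z 0 ^+ 2 - 2 * z 0 + 2).
  apply: (@pint_ftc_eq _ (fun r => gmass b * (z r ^+ 2 - 2 * z r + 2) * igau r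
     + 7 / 10 * r ^+ 5)).
  - exact: ltW.
  - by move=> x _; have ? := @cz x; have ? := @cont_igau R x; rewrite /C; cont.
  - by move=> x _; have ? := @cz x; have ? := @cont_igau R x; cont.
  - move=> x _; have ? := der_igau x; rewrite /z; dere.
    by rewrite /C /z /=; field.
  - by rewrite /igau /z expr0n/= expR0; field.
have : 0 <= gmass b * (z 0 ^+ 2 - 2 * z 0 + 2).
  rewrite mulr_ge0 ?gmass_ge0//.
  have -> : z 0 ^+ 2 - 2 * z 0 + 2 = (z 0 - 1) ^+ 2 + 1 by ring.
  by rewrite addr_ge0 ?sqr_ge0.
have : 0 <= b ^+ 5 by rewrite exprn_ge0// ltW.
lra.
Qed.

Lemma diss_ge0 : 0 <= diss.
Proof.
apply: pint_ge0 => x _; rewrite mulr_ge0 ?sqr_ge0// divr_ge0//.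
by rewrite mulr_ge0 ?gdiff_ge0// ltW// gau_gt0.
Qed.

Definition hardyK : R := (1 + 8 * b ^+ 2) *
  (b ^+ 3 + b ^+ 2 * (b ^+ 4 + 1) * (24 * igau b ^+ 2)) +
  2 * (b ^+ 4 + 1) * (24 * igau b ^+ 2).

(** Hardy's inequality controls [qf], which vanishes at [b], by [qf1]; this controls
    [hf1 = r * qf - qf1 / 2]; Hardy again controls [hf] by [hf1] and its trace at [b]; finally
    [u = gau * hf]. The factor [igau b ^ 2] pays for the Gaussian weight in [diss] and is harmless
    because [b] is fixed. *)
Lemma inner_coercive : pint 0 b (fun r => r ^+ 2 * (u r ^+ 2 + u1 r ^+ 2)) <=
  hardyK * (diss + hf b ^+ 2).
Proof.
have b2 : 0 <= b ^+ 2 by exact: sqr_ge0.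
have xb2 (x : R) : 0 <= x -> x <= b -> x ^+ 2 <= b ^+ 2.
  by move=> x0 xb; rewrite ler_pXn2r// nnegrE ?(le_trans x0).
have cq : continuous (fun r : R => r ^+ 2 * qf r ^+ 2).
  by move=> x; have ? := @cont_qf x; cont.
have cq1 : continuous (fun r : R => r ^+ 2 * qf1 r ^+ 2).
  by move=> x; have ? := @cont_qf1 x; cont.
have ch : continuous (fun r : R => r ^+ 2 * hf r ^+ 2).
  by move=> x; have ? := @cont_hf x; cont.
have ch1 : continuous (fun r : R => r ^+ 2 * hf1 r ^+ 2).
  by move=> x; have ? := @cont_hf1 x; cont.
have on (f : R -> R) : continuous f -> cont_on 0 b f by move=> cf x _; exact: cf.
have onZ (k : R) (f : R -> R) : continuous f -> cont_on 0 b (fun x => k * f x).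
  by move=> cf x _; have ? := cf x; cont.
set Q := pint 0 b (fun r => r ^+ 2 * qf1 r ^+ 2).
set Q0 := pint 0 b (fun r => r ^+ 2 * qf r ^+ 2).
set Hh := pint 0 b (fun r => r ^+ 2 * hf r ^+ 2).
set H1 := pint 0 b (fun r => r ^+ 2 * hf1 r ^+ 2).
(* Integrate the derivative of [r ^ 3 * f ^ 2] and use that [(f + r * f1) ^ 2] is nonnegative. *)
have Hardy (f f1 : R -> R) : continuous f -> continuous f1 ->
    (forall x : R, 0 < x -> is_derive x 1 f (f1 x)) ->
    2 * pint 0 b (fun r => r ^+ 2 * f r ^+ 2) <=
    b ^+ 3 * f b ^+ 2 + b ^+ 2 * pint 0 b (fun r => r ^+ 2 * f1 r ^+ 2).
  move=> cf cf1 df.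
  have c1 : continuous (fun r : R => r ^+ 2 * f r ^+ 2).
    by move=> x; have ? := cf x; cont.
  have c2 : continuous (fun r : R => r ^+ 2 * f1 r ^+ 2).
    by move=> x; have ? := cf1 x; cont.
  have <- : pint 0 b (fun r => 3 * r ^+ 2 * f r ^+ 2 + 2 * r ^+ 3 * f r * f1 r) =
      b ^+ 3 * f b ^+ 2.
    apply: (@pint_ftc_eq _ (fun r => r ^+ 3 * f r ^+ 2)).
    - exact: ltW.
    - by move=> x _; have ? := cf x; have ? := cf1 x; cont.
    - by move=> x _; have ? := cf x; have ? := cf1 x; cont.
    - by move=> x /andP[x0 _]; have ? := df x x0; dere; rewrite /=; ring.
    - by rewrite expr0n/= mul0r subr0.
  rewrite -lerBlDr -!pintZ ?on//; [|exact: on|exact: on].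
  rewrite -pintB ?onZ//; [|exact: onZ|exact: onZ].
  apply: pint_le.
  - by move=> x _; have ? := c1 x; have ? := c2 x; cont.
  - by move=> x _; have ? := cf x; have ? := cf1 x; cont.
  - move=> x /andP[x0 xb]; rewrite /=.
    have : 0 <= x ^+ 2 * (f x + x * f1 x) ^+ 2 by rewrite mulr_ge0 ?sqr_ge0.
    have := ler_wpM2r (mulr_ge0 (sqr_ge0 x) (sqr_ge0 (f1 x))) (xb2 x x0 xb).
    set A := b ^+ 2 * _.
    have -> : x ^+ 2 * (f x + x * f1 x) ^+ 2 = x ^+ 2 * f x ^+ 2 +
      2 * x ^+ 3 * f x * f1 x + x ^+ 2 * (x ^+ 2 * f1 x ^+ 2) by ring.
    lra.
have Q00 : 0 <= Q0.
  by apply: pint_ge0 => x _; rewrite mulr_ge0 ?sqr_ge0.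
have qQ : 2 * Q0 <= b ^+ 2 * Q.
  have := Hardy _ _ cont_qf cont_qf1 der_qf.
  by rewrite qf_b expr0n/= mulr0 add0r.
have hH : 2 * Hh <= b ^+ 3 * hf b ^+ 2 + b ^+ 2 * H1.
  by apply: (Hardy _ _ cont_hf cont_hf1) => x _; exact: der_hf.
have Qd : Q <= 24 * igau b ^+ 2 * diss.
  rewrite /Q /diss -pintZ.
    apply: pint_le.
    - exact: on.
    - move=> x _; have ? := @cont_gdiff R x; have ? := @cont_qf1 x.
      by have ? := @cont_gau R x; cont.
    - move=> x /andP[]; rewrite le_eqVlt => /predU1P[<- _|x0 xb].
        by rewrite /gdiff gmass0 expr0n/= !(mul0r, mulr0).
      rewrite /= [leRHS]mulrA ler_wpM2r ?sqr_ge0//.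
      have := gmass_lb (ltW x0); have := gau_le (ltW x0) xb.
      have ib := igau_gt0 b; have gx := gau_gt0 x.
      move=> gb gm.
      have -> : 24 * igau b ^+ 2 * (gdiff x * gau x / 4) =
        3 * gmass x * gau x * igau b ^+ 2 / x by rewrite /gdiff; field; rewrite gt_eqF.
      rewrite ler_pdivlMr// -exprSr.
      have e1 : 1 <= gau x * igau b.
        by have := ler_wpM2r (ltW ib) gb; rewrite (gauE b) mulVf ?igau_neq0.
      have e2 : 1 <= gau x ^+ 2 * igau b ^+ 2.
        by rewrite -exprMn; exact: exprn_ege1.
      have x3 : 0 <= x ^+ 3 by rewrite exprn_ge0// ltW.
      apply: (@le_trans _ _ (x ^+ 3 * (gau x ^+ 2 * igau b ^+ 2))).
        by rewrite ler_peMr.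
      have -> : x ^+ 3 * (gau x ^+ 2 * igau b ^+ 2) =
        3 * (x ^+ 3 * gau x / 3) * gau x * igau b ^+ 2 by field.
      rewrite ler_wpM2r ?sqr_ge0// ler_wpM2r ?(ltW gx)//.
      by rewrite ler_wpM2l.
  move=> x _; have ? := @cont_gdiff R x; have ? := @cont_qf1 x.
  by have ? := @cont_gau R x; cont.
have H1Q : H1 <= 2 * b ^+ 2 * Q0 + Q.
  rewrite /H1 /Q0 /Q -pintZ; last exact: on.
  rewrite -pintD; [|exact: onZ|exact: on].
  apply: pint_le.
  - exact: on.
  - by move=> x _; have ? := cq x; have ? := cq1 x; cont.
  - move=> x /andP[x0 xb] /=.
    have -> : hf1 x = x * qf x - qf1 x / 2 by rewrite /qf1; field.
    have := ler_wpM2r (mulr_ge0 (sqr_ge0 x) (sqr_ge0 (qf x))) (xb2 x x0 xb).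
    have : 0 <= x ^+ 2 * (x * qf x + qf1 x / 2) ^+ 2 by rewrite mulr_ge0 ?sqr_ge0.
    have : 0 <= x ^+ 2 * (qf1 x) ^+ 2 by rewrite mulr_ge0 ?sqr_ge0.
    set A := x ^+ 2 * (qf1 x) ^+ 2; set B := b ^+ 2 * _.
    set C := x ^+ 2 * (x ^+ 2 * _).
    have -> : x ^+ 2 * (x * qf x - qf1 x / 2) ^+ 2 = C + A / 4 - x ^+ 3 * qf x * qf1 x.
      by rewrite /A /C; field.
    have -> : x ^+ 2 * (x * qf x + qf1 x / 2) ^+ 2 = C + A / 4 + x ^+ 3 * qf x * qf1 x.
      by rewrite /A /C; field.
    have -> : 2 * b ^+ 2 * (x ^+ 2 * qf x ^+ 2) = 2 * B by rewrite /B; ring.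
    lra.
have uH : pint 0 b (fun r => r ^+ 2 * (u r ^+ 2 + u1 r ^+ 2)) <=
    (1 + 8 * b ^+ 2) * Hh + 2 * H1.
  rewrite /Hh /H1 -!pintZ; [|exact: on|exact: on].
  rewrite -pintD; [|exact: onZ|exact: onZ].
  apply: pint_le.
  - by move=> x _; have ? := @cont_u x; have ? := @cont_u1 x; cont.
  - by move=> x _; have ? := ch x; have ? := ch1 x; cont.
  - move=> x /andP[x0 xb] /=.
    have gx0 := gau_gt0 x; have gx1 := gau_le1 x.
    have -> : u x = gau x * hf x.
      by rewrite /hf gauE mulrCA mulVf ?igau_neq0 ?mulr1.
    have -> : u1 x = gau x * (hf1 x - 2 * x * hf x).
      by rewrite /hf1 /hf /gfun gauE; field; rewrite igau_neq0.
    apply: (@le_trans _ _ (x ^+ 2 * (hf x ^+ 2 + (hf1 x - 2 * x * hf x) ^+ 2))).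
      rewrite !exprMn -mulrDr ler_wpM2l ?sqr_ge0// ler_piMl//.
        by apply: addr_ge0; rewrite -?exprMn; exact: sqr_ge0.
      by rewrite exprn_ile1// ltW.
    have := ler_wpM2r (mulr_ge0 (sqr_ge0 x) (sqr_ge0 (hf x))) (xb2 x x0 xb).
    have : 0 <= x ^+ 2 * (hf1 x + 2 * x * hf x) ^+ 2 by rewrite mulr_ge0 ?sqr_ge0.
    set B := b ^+ 2 * _; set C := x ^+ 2 * (x ^+ 2 * _).
    set A := x ^+ 2 * hf1 x ^+ 2; set D := x ^+ 2 * hf x ^+ 2.
    have -> : x ^+ 2 * (hf1 x + 2 * x * hf x) ^+ 2 =
      A + 4 * C + 4 * x ^+ 3 * hf x * hf1 x by rewrite /A /C; ring.
    have -> : x ^+ 2 * (hf x ^+ 2 + (hf1 x - 2 * x * hf x) ^+ 2) =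
      D + A + 4 * C - 4 * x ^+ 3 * hf x * hf1 x by rewrite /A /C /D; ring.
    have -> : (1 + 8 * b ^+ 2) * D = D + 8 * B by rewrite /B /D; ring.
    lra.
have Hh0 : 0 <= Hh by apply: pint_ge0 => x _; rewrite mulr_ge0 ?sqr_ge0.
have d0 := diss_ge0.
set q0 := 24 * igau b ^+ 2 in Qd *.
have q00 : 0 <= q0 by rewrite mulr_ge0// sqr_ge0.
have y0 := sqr_ge0 (hf b).
have b4 : 0 <= b ^+ 4 + 1 by rewrite addr_ge0// exprn_ge0// ltW.
have b3 : 0 <= b ^+ 3 by rewrite exprn_ge0// ltW.
have H1d : H1 <= (b ^+ 4 + 1) * q0 * diss.
  have -> : (b ^+ 4 + 1) * q0 * diss = (b ^+ 4 + 1) * (q0 * diss) by ring.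
  apply: (@le_trans _ _ ((b ^+ 4 + 1) * Q)); last by rewrite ler_wpM2l.
  have := ler_wpM2l b2 qQ; set p := b ^+ 2 * (2 * Q0).
  have -> : b ^+ 2 * (b ^+ 2 * Q) = b ^+ 4 * Q by ring.
  have pE : 2 * b ^+ 2 * Q0 = p by rewrite /p; ring.
  move: H1Q; rewrite pE; lra.
have Hd : Hh <= b ^+ 3 * hf b ^+ 2 + b ^+ 2 * ((b ^+ 4 + 1) * q0 * diss).
  by have := ler_wpM2l b2 H1d; lra.
apply: (le_trans uH).
have k1 : 0 <= 1 + 8 * b ^+ 2 by rewrite addr_ge0// mulr_ge0.
apply: (@le_trans _ _ ((1 + 8 * b ^+ 2) *
  (b ^+ 3 * hf b ^+ 2 + b ^+ 2 * ((b ^+ 4 + 1) * q0 * diss))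
  + 2 * ((b ^+ 4 + 1) * q0 * diss))).
  by rewrite lerD ?ler_wpM2l.
rewrite /hardyK -/q0 -subr_ge0.
set k := 1 + 8 * b ^+ 2 in k1 *; set m := (b ^+ 4 + 1) * q0.
have -> : (k * (b ^+ 3 + b ^+ 2 * (b ^+ 4 + 1) * q0) + 2 * (b ^+ 4 + 1) * q0) *
   (diss + hf b ^+ 2) -
  (k * (b ^+ 3 * hf b ^+ 2 + b ^+ 2 * (m * diss)) + 2 * (m * diss)) =
  k * (b ^+ 3 * diss) + (k * (b ^+ 2 * (m * hf b ^+ 2)) + 2 * (m * hf b ^+ 2)).
  by rewrite /m; ring.
by repeat first [assumption | exact: ler0n | apply: addr_ge0 | apply: mulr_ge0].
Qed.

End Inner.
End Profile.

(** * The outer weight *)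

Section Weight.
Context {R : realType} (b : R) (b64 : 64 <= b).

(** The power 21/2 of [r / b], normalized to match [1 / mu] at [b]; the square root keeps the
    expression within reach of [cont] and [der]. *)
Definition wt r : R := igau b * (r / b) ^+ 10 * Num.sqrt (r / b).
(** Comparable to [r ^ 2 * bracket ^ (-3) * wt], the radial density of the right-hand side of the
    theorem. *)
Definition vt r : R := wt r / r.

Let b0 : 0 < b. Proof. by apply: lt_le_trans b64. Qed.

Lemma wt_gt0 r : 0 < r -> 0 < wt r.
Proof.
move=> r0; rewrite /wt mulr_gt0 ?sqrtr_gt0 ?divr_gt0//.
by rewrite mulr_gt0 ?igau_gt0// exprn_gt0// divr_gt0.
Qed.

Lemma vt_gt0 r : 0 < r -> 0 < vt r.
Proof. by move=> r0; rewrite divr_gt0// wt_gt0. Qed.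

Lemma wt_b : wt b = igau b.
Proof. by rewrite /wt divff ?gt_eqF// sqrtr1 expr1n !mulr1. Qed.

Lemma wtE r : 0 < r -> wt r = r * vt r.
Proof. by move=> r0; rewrite /vt mulrC divfK// gt_eqF. Qed.

Lemma der_wt (r : R) : 0 < r -> is_derive r 1 wt (21 / 2 * vt r).
Proof.
move=> r0; rewrite /wt; dere; first exact: divr_gt0.
have s0 : 0 < Num.sqrt (r / b) by rewrite sqrtr_gt0 divr_gt0.
have sq : Num.sqrt (r / b) ^+ 2 = r / b by rewrite sqr_sqrtr// ltW// divr_gt0.
rewrite /vt /wt; move: s0 sq; set s := Num.sqrt _ => s0 sq.
have rE : r = s ^+ 2 * b by rewrite sq divfK// gt_eqF.
rewrite rE /=; field; rewrite !gt_eqF//.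
Qed.

Lemma der_vt (r : R) : 0 < r -> is_derive r 1 vt (19 / 2 * (vt r / r)).
Proof.
move=> r0; have ? := der_wt r0; rewrite /vt; dere; first by rewrite gt_eqF.
by rewrite /vt; field; rewrite gt_eqF.
Qed.

Lemma cont_wt (r : R) : 0 < r -> {for r, continuous wt}.
Proof. by move=> r0; exact: der_cont (der_wt r0). Qed.

Lemma cont_vt (r : R) : 0 < r -> {for r, continuous vt}.
Proof. by move=> r0; exact: der_cont (der_vt r0). Qed.

(** The product is 1 at [b] and decreases afterwards, because [2 * r] exceeds [21 / 2 / r] there. *)
Lemma wt_gau_le1 r : b <= r -> wt r * gau r <= 1.
Proof.
move=> br.
have pos x : b <= x -> 0 < x by exact: lt_le_trans.
have : 0 <= pint b r (fun x => (2 * x - 21 / 2 / x) * (wt x * gau x)).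
  apply: pint_ge0 => x /andP[bx _]; rewrite mulr_ge0//; last first.
    by rewrite mulr_ge0// ltW ?gau_gt0// wt_gt0// pos.
  have x0 := pos x bx; rewrite subr_ge0 ler_pdivrMr//.
  have : 64 <= x by exact: le_trans bx.
  nra.
have -> : pint b r (fun x => (2 * x - 21 / 2 / x) * (wt x * gau x)) =
    1 - wt r * gau r.
  apply: (@pint_ftc_eq _ (fun x => - (wt x * gau x))).
  - exact: br.
  - move=> x /andP[/pos x0 _]; have ? := cont_wt x0; have ? := @cont_gau R x.
    by cont; rewrite gt_eqF.
  - by move=> x /andP[/pos x0 _]; have ? := cont_wt x0; have ? := @cont_gau R x; cont.
  - move=> x /andP[/ltW/pos x0 _]; have ? := der_wt x0; have ? := der_gau x; dere.
    by rewrite /vt; field; rewrite gt_eqF.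
  - by rewrite wt_b (gauE b) mulfV ?igau_neq0; [ring|].
by rewrite subr_ge0.
Qed.

End Weight.

(** Stated over plain reals so that the arithmetic tactics meet no integrals. Here [e] is [gau b],
    [ie] its inverse, [ms] is [gmass b], [m2] and [m4] are moments over [[0, b]], [h0] is [tailH b],
    [h] is [hf b], [D] the dissipation, [J] the integral of [Psi * qf1], [V] the outer norm up to
    the current radius, [X] its bound over all radii, and [In], [Ou] the inner and outer energies.
    [Ou] loses about [w / 2] with [w = ms * e * h ^ 2], and the trace identity gives
    [w <= 9 / 8 * D] up to small terms. *)
Lemma energy_algebra (R : realType)
  (b e ie ms m2 m4 h0 h D J V X tau K Hd In Ou : R) :
  64 <= b -> 0 < e -> e <= 1 -> 0 < ie -> e * ie = 1 -> e * b ^+ 20 <= 1 / 100 ->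
  1 / 12 <= ms -> ms <= 1 / 2 -> 0 <= X -> 0 <= tau ->
  tau ^+ 2 = 2 * b ^+ 10 * e * X ->
  b ^+ 3 * `|h0| <= tau -> `|m4| <= tau -> `|m2| <= tau -> 0 <= D -> 0 < K ->
  Hd <= K * (D + h ^+ 2) -> J ^+ 2 <= D * (ms * ie + b ^+ 5) ->
  ms * h = m2 + (b ^+ 2 - 3 / 2) * (2 / 3 * m4 - m2 + b ^+ 3 * (e * h) / 3) - J ->
  In = D - (- (e * h) + 2 * h0) * (2 / 3 * m4 - m2 + b ^+ 3 * (e * h) / 3) ->
  - (ms * (ie * (1 + 21 / 4 / b ^+ 2)) * (e * h) ^+ 2 / 2) + 1 / 40 * V
    - 25 * (3 * tau) ^+ 2 * e <= Ou ->
  (30 * 100 * K * ie)^-1 * Hd + 1 / 40 * V - X / 100 <= In + Ou.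
Proof.
move=> b64 e0 e1 ie0 eie be ms1 ms2 X0 t0 t2 Hh0 Hm4 Hm2 D0 K0 HHd HJ Htr -> HOu.
(* The powers of [b] that come with a factor [e] are at most 14; the six further powers in [b ^ 20]
   absorb the numerical constants. *)
pose y := e * h ^+ 2; pose d := e * b ^+ 14; pose p : R := `|e * h|.
have y0 : 0 <= y by rewrite mulr_ge0 ?sqr_ge0// ltW.
have b0 : 0 < b by lra.
have bn n : 1 <= b ^+ n by apply: exprn_ege1; lra.
have b2 : 64 * 64 <= b ^+ 2 by rewrite expr2 ler_pM.
have d0 : 0 <= d by rewrite mulr_ge0 ?exprn_ge0 ?ltW.
have dE k : (k <= 14)%N -> e * b ^+ k <= d.
  by move=> k14; rewrite ler_wpM2l ?(ltW e0)//; apply: ler_weXn2l => //; lra.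
have ds : d * (50 * 80) <= 1 / 100.
  apply: le_trans be.
  have -> : e * b ^+ 20 = d * b ^+ 6 by rewrite /d -mulrA -exprD.
  rewrite ler_wpM2l//.
  have : b ^+ 2 <= b ^+ 6 by apply: ler_weXn2l => //; lra.
  by lra.
have p0 : 0 <= p by exact: normr_ge0.
have p2 : p ^+ 2 = e * y by rewrite real_normK ?num_real// exprMn /y expr2; ring.
set Pi := 2 / 3 * m4 - m2 + b ^+ 3 * (e * h) / 3 in Htr *.
have b3 : 0 <= b ^+ 3 by rewrite exprn_ge0// ltW.
have HPi : `|Pi| <= b ^+ 3 * p / 3 + 2 * tau.
  have : `|b ^+ 3 * (e * h)| <= b ^+ 3 * p by rewrite normrM ger0_norm.
  by move: Hm4 Hm2; rewrite /Pi !ler_norml; lra.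
have HT : `|- (e * h) + 2 * h0| <= p + tau.
  have h2 : 2 * `|h0| <= tau.
    have b23 : b ^+ 2 <= b ^+ 3 by apply: ler_weXn2l => //; lra.
    by apply: le_trans Hh0; rewrite ler_wpM2r//; lra.
  apply: le_trans (ler_normD _ _) _; rewrite normrN -/p.
  have -> : `|2 * h0| = 2 * `|h0| by rewrite normrM ger0_norm.
  by rewrite lerD2l.
have bp k l : (k + k + l <= 14)%N -> (b ^+ k * p) ^+ 2 * b ^+ l <= d * y.
  move=> kl; have -> : (b ^+ k * p) ^+ 2 * b ^+ l = e * b ^+ (k + k + l) * y.
    by rewrite exprMn p2 !exprD; ring.
  by rewrite ler_wpM2r// dE.
have tl : tau ^+ 2 * b ^+ 4 <= 2 * d * X.
  by rewrite t2 /d -[14%N]/(10 + 4)%N exprD le_eqVlt; apply/orP; left; apply/eqP; ring.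
have tl0 : tau ^+ 2 <= 2 * d * X.
  by apply: le_trans tl; rewrite ler_peMr ?sqr_ge0.
have bp3 : (b ^+ 3 * p) ^+ 2 <= d * y by have := bp 3%N 0%N isT; rewrite expr0 mulr1.
have bp5 : (b ^+ 5 * p) ^+ 2 <= d * y by have := bp 5%N 0%N isT; rewrite expr0 mulr1.
have HTP : (- (e * h) + 2 * h0) * Pi <= 2 * (d * y) + 16 * (d * X).
  apply: le_trans (ler_norm _) _; rewrite normrM.
  apply: (@le_trans _ _ ((b ^+ 3 * p + 2 * tau) ^+ 2)).
    rewrite expr2; apply: ler_pM => //.
      apply: (le_trans HT); have : p <= b ^+ 3 * p by rewrite ler_peMl.
      by lra.
    apply: (le_trans HPi); have : 0 <= b ^+ 3 * p by rewrite mulr_ge0.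
    by lra.
  have : 0 <= (b ^+ 3 * p - 2 * tau) ^+ 2 by exact: sqr_ge0.
  have -> : (b ^+ 3 * p - 2 * tau) ^+ 2 =
    2 * (b ^+ 3 * p) ^+ 2 + 8 * tau ^+ 2 - (b ^+ 3 * p + 2 * tau) ^+ 2 by ring.
  lra.
pose Q := m2 + (b ^+ 2 - 3 / 2) * Pi.
have HQ : `|Q| <= b ^+ 5 * p + 3 * (b ^+ 2 * tau).
  apply: le_trans (ler_normD _ _) _; rewrite normrM.
  have -> : `|b ^+ 2 - 3 / 2| = b ^+ 2 - 3 / 2 by rewrite ger0_norm//; move: b2; clear - R; lra.
  have : (b ^+ 2 - 3 / 2) * `|Pi| <= b ^+ 2 * (b ^+ 3 * p / 3 + 2 * tau).
    by apply: ler_pM => //; move: b2; clear - R; lra.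
  have : tau <= b ^+ 2 * tau by rewrite ler_peMl.
  have : 0 <= b ^+ 5 * p by rewrite mulr_ge0// exprn_ge0// ltW.
  have -> : b ^+ 2 * (b ^+ 3 * p / 3 + 2 * tau) =
    b ^+ 5 * p / 3 + 2 * (b ^+ 2 * tau) by field.
  lra.
have Q2 : Q ^+ 2 <= 2 * (d * y) + 36 * (d * X).
  rewrite -[leLHS]real_normK ?num_real//.
  apply: (@le_trans _ _ ((b ^+ 5 * p + 3 * (b ^+ 2 * tau)) ^+ 2)).
    by rewrite ler_pXn2r// nnegrE ?normr_ge0// (le_trans _ HQ).
  have : 0 <= (b ^+ 5 * p - 3 * (b ^+ 2 * tau)) ^+ 2 by exact: sqr_ge0.
  have -> : (b ^+ 5 * p - 3 * (b ^+ 2 * tau)) ^+ 2 =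
    2 * (b ^+ 5 * p) ^+ 2 + 18 * (tau ^+ 2 * b ^+ 4)
    - (b ^+ 5 * p + 3 * (b ^+ 2 * tau)) ^+ 2 by ring.
  lra.
(* Young's inequality, weighted so that the factor of [J ^ 2] stays well below 2, beyond which [D]
   could not pay for [w / 2]. The factor of [Q ^ 2] may be large because [Q] is small. *)
have QJ : (ms * h) ^+ 2 <= 9 / 8 * J ^+ 2 + 9 * Q ^+ 2.
  rewrite Htr -/Q; have := sqr_ge0 (J + 8 * Q).
  have -> : (J + 8 * Q) ^+ 2 = 8 * (9 / 8 * J ^+ 2 + 9 * Q ^+ 2 - (Q - J) ^+ 2) by field.
  lra.
have eJ : e * J ^+ 2 <= D * ms + D * d.
  apply: le_trans (ler_wpM2l (ltW e0) HJ) _.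
  have -> : e * (D * (ms * ie + b ^+ 5)) = D * ms * (e * ie) + D * (e * b ^+ 5) by ring.
  by rewrite eie mulr1 lerD2l ler_wpM2l// dE.
have eQ : e * Q ^+ 2 <= Q ^+ 2 by rewrite ler_piMl ?sqr_ge0.
pose w := ms * y.
have w0 : 0 <= w by rewrite mulr_ge0//; move: ms1; clear - R; lra.
have yw : y <= 12 * w.
  have : 0 <= (ms - 1 / 12) * y by rewrite mulr_ge0// subr_ge0.
  by rewrite /w; clear - R; lra.
have dX0 : 0 <= d * X by rewrite mulr_ge0.
have dD0 : 0 <= D * d by rewrite mulr_ge0.
have dyw : d * y <= 12 * (d * w).
  have := ler_wpM2l d0 yw.
  by have -> : d * (12 * w) = 12 * (d * w) by ring.
have dw0 : 0 <= d * w by rewrite mulr_ge0.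
have main1 : ms * w <= 9 / 8 * (D * ms) + 9 / 8 * (D * d) + 216 * (d * w) + 324 * (d * X).
  have := ler_wpM2l (ltW e0) QJ.
  have -> : e * (ms * h) ^+ 2 = ms * w by rewrite /w /y; ring.
  by move: eJ eQ Q2 dyw dX0; rewrite mulrDr; clear - R; lra.
have wle : w <= 9 / 8 * D + 14 * (D * d) + (50 * 52) * (d * w) + (50 * 80) * (d * X).
  have ms0 : 0 < ms by move: ms1; clear - R; lra.
  rewrite -(ler_pM2l ms0).
  apply: (le_trans main1).
  have h1 : D * d <= 12 * (ms * (D * d)).
    have : 0 <= (ms - 1 / 12) * (D * d) by rewrite mulr_ge0// subr_ge0.
    by clear - R; lra.
  have h2 : d * w <= 12 * (ms * (d * w)).
    have : 0 <= (ms - 1 / 12) * (d * w) by rewrite mulr_ge0// subr_ge0.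
    by clear - R; lra.
  have h3 : d * X <= 12 * (ms * (d * X)).
    have : 0 <= (ms - 1 / 12) * (d * X) by rewrite mulr_ge0// subr_ge0.
    by clear - R; lra.
  have h4 : 0 <= ms * (d * X) by rewrite mulr_ge0// ltW.
  have h5 : 0 <= ms * (d * w) by rewrite mulr_ge0// ltW.
  have h6 : 0 <= ms * (D * d) by rewrite mulr_ge0// ltW.
  by move: h1 h2 h3 h4 h5 h6; rewrite !mulrDr; clear - R; lra.
have small z : 0 <= z -> (50 * 80) * (d * z) <= 1 / 100 * z.
  move=> z0; have := ler_wpM2r z0 ds.
  by have -> : d * (50 * 80) * z = 50 * 80 * (d * z) by ring.
have s1 := small _ w0; have s2 := small _ X0; have s3 := small _ D0.
have wf : w <= 114 / 100 * D + 11 / 10 * (X / 100).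
  by rewrite [D * d]mulrC in wle; move: wle s1 s2 s3 X0 D0 w0; clear - R; lra.
have h2E : h ^+ 2 = ie * y by rewrite /y mulrA [ie * e]mulrC eie mul1r.
have ie1 : 1 <= ie by rewrite -eie ler_piMl// ltW.
have cH : (30 * 100 * K * ie)^-1 * Hd <= D / (30 * 100) + y / (30 * 100).
  rewrite mulrC ler_pdivrMr; last first.
    by apply: mulr_gt0 => //; apply: mulr_gt0 => //; apply: mulr_gt0; exact: ltr0Sn.
  apply: (le_trans HHd); rewrite h2E.
  have -> : (D / (30 * 100) + y / (30 * 100)) * (30 * 100 * K * ie) =
    K * (D * ie + ie * y) by field.
  by rewrite ler_wpM2l ?(ltW K0)// lerD2r ler_peMr.
have Bt : ms * (ie * (1 + 21 / 4 / b ^+ 2)) * (e * h) ^+ 2 / 2 <= 51 / 100 * w.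
  have -> : ms * (ie * (1 + 21 / 4 / b ^+ 2)) * (e * h) ^+ 2 / 2 =
    (e * ie) * (1 + 21 / 4 / b ^+ 2) * w / 2 by rewrite /w /y; ring.
  rewrite eie mul1r.
  have : 21 / 4 / b ^+ 2 <= 1 / 100 by rewrite ler_pdivrMr ?exprn_gt0//; move: b2; clear - R; lra.
  move: (21 / 4 / b ^+ 2) => q q1.
  have : q * w <= 1 / 100 * w by rewrite ler_wpM2r.
  by move: q1 w0; clear - R; lra.
have et : 25 * (3 * tau) ^+ 2 * e <= 450 * (d * X).
  have : tau ^+ 2 * e <= tau ^+ 2 by rewrite ler_piMr ?sqr_ge0.
  by move: tl0; rewrite exprMn; clear - R; lra.
by move: HOu HTP Bt et cH yw wf dyw s1 s2 X0 D0 w0; clear - R; lra.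
Qed.

(** * The one-dimensional flux inequality *)

Section Outer.
Context {R : realType} (u u1 u2 : R -> R) (H0 : R).
Context (du : forall x : R, is_derive x 1 u (u1 x))
  (du1 : forall x : R, is_derive x 1 u1 (u2 x)) (cu2 : continuous u2).
Context (b : R) (b64 : 64 <= b).

Local Notation wt := (wt b).
Local Notation vt := (vt b).
Local Notation Zf := (Zf u H0).
Local Notation Sflux := (Sflux u u1 H0).
Local Notation Sflux1 := (Sflux1 u u1 u2 H0).

Let b0 : 0 < b. Proof. by apply: lt_le_trans b64. Qed.
Let cu : continuous u := cont_u du.
Let cu1 : continuous u1 := cont_u1 du1.
Let cS : continuous Sflux. Proof. by move=> x; apply: cont_Sflux. Qed.
Let cS1 (x : R) : 0 <= x -> {for x, continuous Sflux1}.
Proof. exact: cont_Sflux1. Qed.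
Let pos (x : R) : b <= x -> 0 < x. Proof. exact: lt_le_trans. Qed.

Definition vnorm r : R := vt r * (u r ^+ 2 + u1 r ^+ 2).

Lemma cont_vnorm (r : R) : 0 < r -> {for r, continuous vnorm}.
Proof.
move=> r0; have ? := cont_vt b64 r0; have ? := @cu r; have ? := @cu1 r.
by rewrite /vnorm; cont.
Qed.

Lemma vnorm_ge0 r : 0 < r -> 0 <= vnorm r.
Proof.
move=> r0; rewrite /vnorm mulr_ge0 ?(ltW (vt_gt0 b64 r0))//.
by rewrite addr_ge0 ?sqr_ge0.
Qed.

Lemma cube_gau_small (r : R) : 64 <= r -> r ^+ 3 * gau r <= 1 / 16.
Proof.
move=> r64; have r0 : 0 < r by apply: lt_le_trans r64.
have i0 := igau_gt0 r.
have h : 1 + r ^+ 2 / 2 <= expR (r ^+ 2 / 2) by exact: expR_ge1Dx.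
have : (1 + r ^+ 2 / 2) ^+ 2 <= igau r.
  have -> : igau r = expR (r ^+ 2 / 2) ^+ 2.
    by rewrite expr2 -expRD /igau; congr expR; field.
  by rewrite ler_pXn2r// nnegrE ?expR_ge0// addr_ge0// divr_ge0// sqr_ge0.
move=> h2; rewrite gauE ler_pdivrMr//; apply: le_trans (ler_wpM2l _ h2) => //.
have : 0 <= r ^+ 3 * (r - 64) by rewrite mulr_ge0 ?subr_ge0 ?exprn_ge0// ltW.
have := sqr_ge0 r.
have -> : r ^+ 3 * (r - 64) = r ^+ 4 - 64 * r ^+ 3 by ring.
have -> : 1 / 16 * (1 + r ^+ 2 / 2) ^+ 2 = 1 / 16 + r ^+ 2 / 16 + r ^+ 4 / 64 by field.
lra.
Qed.

(** In the local part the cross term [gmass * (wt + 21 / 4 * vt / r) * u * u1] is integrated by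
    parts through [Bd]. This takes back half of the coefficient [21 / 2 * gmass * vt] of [u ^ 2], up
    to lower-order terms. The boundary value at [rho] has the good sign and is dropped; the one at
    [b] is the loss on the left. *)
Lemma outer_ineq (zeta rho : R) : b <= rho ->
  (forall r, b <= r <= rho -> `|Zf r| <= zeta) ->
  - (gmass b * (wt b + 21 / 4 * (vt b / b)) * u b ^+ 2 / 2)
  + 1 / 40 * pint b rho vnorm - 25 * zeta ^+ 2 * gau b <=
  pint b rho (fun r => Sflux r * (u1 r * wt r + u r * (21 / 2 * vt r))).
Proof.
move=> brho Zz.
pose Bd r := gmass r * (wt r + 21 / 4 * (vt r / r)) * u r ^+ 2 / 2.
pose Bd1 r := (r ^+ 2 * gau r * (wt r + 21 / 4 * (vt r / r)) +
   gmass r * (21 / 2 * vt r + 357 / 8 * (vt r / r ^+ 2))) * u r ^+ 2 / 2 +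
   gmass r * (wt r + 21 / 4 * (vt r / r)) * u r * u1 r.
have cw x : b <= x -> {for x, continuous wt} by move=> /pos; exact: cont_wt.
have cv x : b <= x -> {for x, continuous vt} by move=> /pos; exact: cont_vt.
have nz x : b <= x -> x != 0 by move=> /pos; rewrite lt0r => /andP[].
have cBd : cont_on b rho Bd.
  move=> x /andP[bx _]; have ? := cw x bx; have ? := cv x bx.
  have ? := @cont_gmass R x; have ? := @cu x; rewrite /Bd; cont; exact: nz.
have cBd1 : cont_on b rho Bd1.
  move=> x /andP[bx _]; have ? := cw x bx; have ? := cv x bx.
  have ? := @cont_gmass R x; have ? := @cu x; have ? := @cu1 x.
  have ? := @cont_gau R x; rewrite /Bd1; cont; first exact: nz.
  - by rewrite expf_neq0// nz.
  - exact: nz.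
have cvn : cont_on b rho vnorm by move=> x /andP[/pos x0 _]; exact: cont_vnorm.
have cg : cont_on b rho (fun r => 2 * r * gau r).
  by move=> x _; have ? := @cont_gau R x; cont.
have cR : cont_on b rho (fun r => Sflux r * (u1 r * wt r + u r * (21 / 2 * vt r))).
  move=> x /andP[bx _]; have ? := cw x bx; have ? := cv x bx.
  by have ? := @cS x; have ? := @cu x; have ? := @cu1 x; cont.
have IBd : pint b rho Bd1 = Bd rho - Bd b.
  apply: (@pint_ftc_eq _ Bd); [exact: brho|exact: cBd1|exact: cBd| |by []].
  move=> x /andP[/ltW bx _]; have x0 := pos bx.
  have ? := der_wt b64 x0; have ? := der_vt b64 x0; have ? := der_gmass x0.
  have ? := du x; rewrite /Bd; dere; first exact: nz.
  by rewrite /Bd1 /=; field; exact: nz.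
have Ig : pint b rho (fun r => 2 * r * gau r) = gau b - gau rho.
  apply: (@pint_ftc_eq _ (fun r => - gau r)).
  - exact: brho.
  - exact: cg.
  - by move=> x _; have ? := @cont_gau R x; cont.
  - by move=> x _; have ? := der_gau x; dere; ring.
  - by ring.
have cg2 : cont_on b rho (fun r => 25 * zeta ^+ 2 * (2 * r * gau r)).
  by move=> x /cg ?; cont.
have cv2 : cont_on b rho (fun r => 1 / 40 * vnorm r).
  by move=> x /cvn ?; cont.
have cBv : cont_on b rho (fun r => Bd1 r + 1 / 40 * vnorm r).
  by move=> x xb; have ? := cBd1 x xb; have ? := cv2 x xb; cont.
have Bd0 : 0 <= Bd rho.
  rewrite /Bd divr_ge0// mulr_ge0 ?sqr_ge0// mulr_ge0 ?gmass_ge0//.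
  have r0 := pos brho; rewrite addr_ge0 ?(ltW (wt_gt0 b64 r0))//.
  by rewrite mulr_ge0// divr_ge0// ltW// vt_gt0.
apply: (@le_trans _ _ (pint b rho (fun r => Bd1 r + 1 / 40 * vnorm r
   - 25 * zeta ^+ 2 * (2 * r * gau r)))).
  rewrite (pintB cBv cg2) (pintD cBd1 cv2) (pintZ _ cvn) (pintZ _ cg) IBd Ig.
  have : 0 <= 25 * zeta ^+ 2 * gau rho.
    by rewrite mulr_ge0 ?(ltW (gau_gt0 _))// mulr_ge0// sqr_ge0.
  by rewrite -/(Bd b); lra.
apply: pint_le => //.
  by move=> x xb; have ? := cBv x xb; have ? := cg2 x xb; cont.
move=> x /andP[bx xr]; rewrite -subr_ge0.
have x0 := pos bx; have x64 : 64 <= x by exact: le_trans bx.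
have v0 := vt_gt0 b64 x0; have g0 := gau_gt0 x.
have zx : `|Zf x| <= zeta by apply: Zz; rewrite bx.
have m12 : 1 / 12 <= gmass x by apply: gmass_lb12; lra.
have x3 := cube_gau_small x64.
have wE := wtE b x0.
have wg : wt x * gau x <= 1 by exact: wt_gau_le1.
pose v := vt x.
(* What remains as coefficient of [u x ^ 2] after the integration by parts; [gmass x >= 1 / 12]
   keeps it above [v / 5]. *)
pose c := 21 / 4 * gmass x * v - 357 / 16 * gmass x * v / x ^+ 2
  - x ^+ 2 * gau x * (x * v + 21 / 4 * v / x) / 2.
have -> : Sflux x * (u1 x * wt x + u x * (21 / 2 * vt x)) -
    (Bd1 x + 1 / 40 * vnorm x - 25 * zeta ^+ 2 * (2 * x * gau x)) =
    (gmass x * v / 2 - v / 40) * u1 x ^+ 2 + (c - v / 40) * u x ^+ 2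
    - gau x * Zf x * (x * v * u1 x + 21 / 2 * v * u x)
    + 50 * zeta ^+ 2 * x * gau x.
  rewrite /Sflux /Bd1 /c /gdiff /gfun wE -/v /vnorm -/v; field.
  by rewrite gt_eqF.
have c2 : 2 / 10 * v <= c.
  rewrite /c -/v.
  have x2 : 357 / 16 / x ^+ 2 <= 1 / 100.
    rewrite ler_pdivrMr ?exprn_gt0//.
    have : 0 <= (x - 64) * (x + 64) by rewrite mulr_ge0 ?subr_ge0// addr_ge0// ltW.
    by rewrite expr2; lra.
  have xg : x * gau x <= 1 / 16.
    apply: le_trans x3; rewrite ler_wpM2r ?(ltW g0)//.
    have : 1 <= x ^+ 2 by apply: exprn_ege1; lra.
    by rewrite exprS => ?; rewrite ler_peMr// ltW.
  have -> : 21 / 4 * gmass x * v - 357 / 16 * gmass x * v / x ^+ 2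
   - x ^+ 2 * gau x * (x * v + 21 / 4 * v / x) / 2 =
   v * (gmass x * (21 / 4 - 357 / 16 / x ^+ 2) - x ^+ 3 * gau x / 2
     - 21 / 8 * (x * gau x)) by field; rewrite gt_eqF.
  rewrite mulrC ler_wpM2l ?(ltW v0)//.
  have : 1 / 12 * 5 <= gmass x * (21 / 4 - 357 / 16 / x ^+ 2).
    by rewrite ler_pM//; lra.
  lra.
have zz : Zf x ^+ 2 <= zeta ^+ 2.
  rewrite -[leLHS]real_normK ?num_real// ler_pXn2r// nnegrE//.
  exact: le_trans zx.
(* In the square of the nonlocal term, one factor [gau] compensates the weight through
   [wt * gau <= 1] and the other makes the error integrable. It serves for [y = u1] and for
   [y = 21 / 2 * u / x]. *)
have key y : gau x * Zf x * (x * v * y) <= v * y ^+ 2 / 60 + 15 * zeta ^+ 2 * x * gau x.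
  have : 0 <= v / 60 * (y - 30 * gau x * Zf x * x) ^+ 2.
    by rewrite mulr_ge0 ?sqr_ge0// divr_ge0// ltW.
  have -> : v / 60 * (y - 30 * gau x * Zf x * x) ^+ 2 =
     v * y ^+ 2 / 60 - gau x * Zf x * (x * v * y)
     + 15 * ((wt x * gau x) * ((x * gau x) * Zf x ^+ 2)) by rewrite wE -/v; field.
  have xg : 0 <= x * gau x by rewrite mulr_ge0// ltW.
  have : wt x * gau x * (x * gau x * Zf x ^+ 2) <= x * gau x * zeta ^+ 2.
    apply: (@le_trans _ _ (x * gau x * Zf x ^+ 2)); last by rewrite ler_wpM2l.
    by rewrite ler_piMl// mulr_ge0// sqr_ge0.
  have -> : 15 * zeta ^+ 2 * x * gau x = 15 * (x * gau x * zeta ^+ 2) by ring.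
  lra.
have k1 := key (u1 x); have := key (21 / 2 * u x / x).
have -> : x * v * (21 / 2 * u x / x) = 21 / 2 * v * u x by field; rewrite gt_eqF.
have : v * (21 / 2 * u x / x) ^+ 2 / 60 <= v * u x ^+ 2 / 60.
  rewrite ler_pM2r// ler_pM2l//.
  have -> : (21 / 2 * u x / x) ^+ 2 = u x ^+ 2 * (21 / 2 / x) ^+ 2 by field; rewrite gt_eqF.
  rewrite ler_piMr ?sqr_ge0// exprn_ile1//; first by rewrite divr_ge0// ltW.
  by rewrite ler_pdivrMr//; lra.
have := ler_wpM2r (sqr_ge0 (u x)) c2.
have vm : 0 <= v * (gmass x - 1 / 12) * u1 x ^+ 2.
  by rewrite mulr_ge0 ?sqr_ge0// mulr_ge0 ?subr_ge0// ltW.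
have xg : 0 <= zeta ^+ 2 * x * gau x.
  by rewrite mulr_ge0 ?(ltW g0)// mulr_ge0 ?sqr_ge0// ltW.
have vu : 0 <= v * u x ^+ 2 by rewrite mulr_ge0 ?sqr_ge0// ltW.
lra.
Qed.

(** The integrand is a multiple of [s ^ (- 3 / 2)]: here the exponent of [wt] has to exceed 10. *)
Lemma pint_wt_inv r rho : b <= r -> r <= rho ->
  pint r rho (fun s => s ^+ 9 / wt s) <= 2 * b ^+ 10 * gau b.
Proof.
move=> br rrho.
have nz x : b <= x -> wt x != 0 by move=> /pos x0; rewrite gt_eqF// wt_gt0.
have cf : cont_on b rho (fun s => s ^+ 9 / wt s).
  move=> x /andP[bx _]; have ? := cont_wt b64 (pos bx); cont; exact: nz.
have f0 x : b <= x -> 0 <= x ^+ 9 / wt x.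
  move=> /pos x0; rewrite divr_ge0//; first by rewrite exprn_ge0// ltW.
  by rewrite ltW// wt_gt0.
apply: (@le_trans _ _ (pint b rho (fun s => s ^+ 9 / wt s))).
  rewrite [leRHS](pint_split br rrho cf) lerDr; apply: pint_ge0.
  by move=> x /andP[bx _]; exact: f0.
have brho := le_trans br rrho.
have -> : pint b rho (fun s => s ^+ 9 / wt s) =
    2 * b ^+ 10 * gau b - 2 * rho ^+ 10 / wt rho.
  apply: (@pint_ftc_eq _ (fun s => - (2 * s ^+ 10 / wt s))).
  - exact: brho.
  - exact: cf.
  - by move=> x /andP[bx _]; have ? := cont_wt b64 (pos bx); cont; exact: nz.
  - move=> x /andP[/ltW bx _]; have ? := der_wt b64 (pos bx); dere; first exact: nz.
    rewrite /= /vt; field.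
    by rewrite nz// gt_eqF// pos.
  - by rewrite (wt_b b64) gauE; ring.
rewrite gerBl divr_ge0//; last by rewrite ltW// wt_gt0// pos.
by rewrite mulr_ge0// exprn_ge0// ltW// pos.
Qed.

(** * Tails of the moments and the energy balance *)

Section Tails.
Context (X : R) (XP : forall rho, b <= rho -> pint b rho vnorm <= X).
Context (m20 : mom u 2 @ +oo --> (0 : R)) (m40 : mom u 4 @ +oo --> (0 : R))
  (tH0 : tailH u H0 @ +oo --> (0 : R)).

(** The Cauchy-Schwarz bound for the integral of [s ^ 4 * |u s|] beyond [b]; the factor [gau b]
    makes it small compared with the square root of [X]. *)
Definition tau : R := Num.sqrt (2 * b ^+ 10 * gau b * X).

Lemma X_ge0 : 0 <= X.
Proof. by have := XP (lexx b); rewrite pint_id. Qed.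

Lemma tau_ge0 : 0 <= tau. Proof. exact: sqrtr_ge0. Qed.

Lemma tau_sqr : tau ^+ 2 = 2 * b ^+ 10 * gau b * X.
Proof.
rewrite sqr_sqrtr// mulr_ge0 ?X_ge0// mulr_ge0 ?(ltW (gau_gt0 _))//.
by rewrite mulr_ge0// exprn_ge0// ltW.
Qed.

Lemma pint_tail4 r rho : b <= r -> r <= rho ->
  pint r rho (fun s => s ^+ 4 * `|u s|) <= tau.
Proof.
move=> br rrho.
have pos' x : r <= x <= rho -> 0 < x.
  by move=> /andP[rx _]; apply: pos; exact: le_trans rx.
have c1 : cont_on r rho (fun s => s ^+ 4 * `|u s|).
  by move=> x _; have ? := @cu x; cont.
have p0 : 0 <= pint r rho (fun s => s ^+ 4 * `|u s|).
  by apply: pint_ge0 => x /pos' x0; rewrite mulr_ge0// exprn_ge0// ltW.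
rewrite -(ler_pXn2r (n := 2))// ?nnegrE ?tau_ge0//.
have cv : cont_on r rho vnorm by move=> x /pos'; exact: cont_vnorm.
have cB : cont_on r rho (fun s => s ^+ 9 / wt s).
  move=> x /pos' x0; have ? := cont_wt b64 x0; cont.
  by rewrite gt_eqF// wt_gt0.
apply: (@le_trans _ _ (pint r rho vnorm * pint r rho (fun s => s ^+ 9 / wt s))).
  apply: pint_CS => //.
  - by move=> x /pos'; exact: vnorm_ge0.
  - move=> x /pos' x0; rewrite divr_ge0//; first by rewrite exprn_ge0// ltW.
    by rewrite ltW// wt_gt0.
  - move=> x /pos' x0; rewrite exprMn real_normK ?num_real// -exprM.
    have -> : vnorm x * (x ^+ 9 / wt x) = x ^+ 8 * (u x ^+ 2 + u1 x ^+ 2).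
      rewrite /vnorm /vt; field.
      by rewrite !gt_eqF ?wt_gt0.
    by rewrite ler_wpM2l ?exprn_ge0 ?(ltW x0)// lerDl sqr_ge0.
rewrite tau_sqr mulrC.
have brho := le_trans br rrho.
apply: ler_pM.
- apply: pint_ge0 => x /pos' x0; rewrite divr_ge0//; first by rewrite exprn_ge0// ltW.
  by rewrite ltW// wt_gt0.
- by apply: pint_ge0 => x /pos'; exact: vnorm_ge0.
- exact: pint_wt_inv.
- apply: le_trans (XP brho).
  rewrite [leRHS](pint_split br rrho) ?lerDr; last first.
    by move=> x /andP[/pos x0 _]; exact: cont_vnorm.
  by apply: pint_ge0 => x /andP[/pos x0 _]; exact: vnorm_ge0.
Qed.

Lemma tail_bound (f : R -> R) (K r : R) : f @ +oo --> (0 : R) ->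
  (forall rho, r <= rho -> `|f rho - f r| <= K) -> `|f r| <= K.
Proof.
move=> f0 fK.
rewrite leNgt; apply/negP => Kf.
have /cvgrPdist_lt/(_ (`|f r| - K)) := f0.
rewrite subr_gt0 => /(_ Kf) h.
have [rho /= [fr rr]] := filter_ex (filterI h (nbhs_pinfty_ge (num_real r))).
rewrite sub0r normrN in fr.
have := fK _ rr; have := ler_normB (f rho) (f rho - f r).
by rewrite subKr; lra.
Qed.

Lemma mom_split n r rho : b <= r -> r <= rho ->
  mom u n rho - mom u n r = pint r rho (fun s => s ^+ n * u s).
Proof.
move=> br rrho; rewrite /mom (@pint_split _ 0 r rho)//; first lra.
- by rewrite ltW// pos.
- by move=> x _; have ? := @cu x; cont.
Qed.

(** A moment that vanishes at infinity equals, over [[0, r]], minus its tail beyond [r], where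
    [s ^ n <= s ^ 4]. *)
Lemma mom_tail n r : (n <= 4)%N -> mom u n @ +oo --> (0 : R) -> b <= r ->
  `|mom u n r| <= tau.
Proof.
move=> n4 mn0 br; apply: (tail_bound mn0) => rho rrho.
rewrite (mom_split _ br rrho).
apply: le_trans (pint_tail4 br rrho).
apply: le_trans (pint_abs _) _; first by move=> x _; have ? := @cu x; cont.
apply: pint_le; try by move=> x _; have ? := @cu x; cont.
move=> x /andP[rx _]; have x0 := pos (le_trans br rx).
rewrite normrM ler_wpM2r// ger0_norm ?exprn_ge0 ?(ltW x0)//.
by apply: ler_weXn2l => //; have := le_trans b64 (le_trans br rx); lra.
Qed.

Lemma tailH_tail r : b <= r -> r ^+ 3 * `|tailH u H0 r| <= tau.
Proof.
move=> br; have r0 := pos br; have r3 : 0 < r ^+ 3 by exact: exprn_gt0.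
rewrite mulrC -ler_pdivlMr//; apply: (tail_bound tH0) => rho rrho.
rewrite ler_pdivlMr//.
have -> : tailH u H0 rho - tailH u H0 r = - (mom u 1 rho - mom u 1 r).
  by rewrite /tailH; ring.
rewrite normrN (mom_split _ br rrho).
apply: le_trans (pint_tail4 br rrho).
have c1 : cont_on r rho (fun s => s ^+ 1 * u s).
  by move=> x _; have ? := @cu x; cont.
have c2 : cont_on r rho (fun s => `|s ^+ 1 * u s|).
  by move=> x xr; have ? := c1 x xr; cont.
rewrite mulrC; apply: le_trans (ler_wpM2l (ltW r3) (pint_abs c1)) _.
rewrite -pintZ//; apply: pint_le.
- by move=> x xr; have ? := c2 x xr; cont.
- by move=> x _; have ? := @cu x; cont.
- move=> x /andP[rx _]; have x0 := pos (le_trans br rx).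
  rewrite expr1 normrM (gtr0_norm x0).
  have -> : x ^+ 4 * `|u x| = x ^+ 3 * (x * `|u x|) by ring.
  apply: ler_wpM2r; first by rewrite mulr_ge0// ltW.
  by rewrite ler_pXn2r// nnegrE ltW.
Qed.

Lemma Zf_tail r : b <= r -> `|Zf r| <= 3 * tau.
Proof.
move=> br; have := mom_tail (leqnn 4) m40 br.
have := mom_tail (isT : (2 <= 4)%N) m20 br.
have := tailH_tail br.
have r3 : 0 <= r ^+ 3 by rewrite exprn_ge0// ltW// pos.
rewrite -{1}(ger0_norm r3) -normrM /Zf.
by rewrite !ler_norml; lra.
Qed.

Context (be : gau b * b ^+ 20 <= 1 / 100).

Lemma hardyK_gt0 : 0 < hardyK b.
Proof.
rewrite /hardyK.
have b4 : 0 < b ^+ 4 + 1 by rewrite addr_gt0// exprn_gt0.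
have i2 : 0 < 24 * igau b ^+ 2 by rewrite mulr_gt0// exprn_gt0// igau_gt0.
have b2 : 0 < b ^+ 2 by rewrite exprn_gt0.
have b3 : 0 < b ^+ 3 by rewrite exprn_gt0.
by repeat first [assumption | exact: ltr01 | exact: ltr0Sn | apply: addr_gt0 | apply: mulr_gt0].
Qed.

(* The product of constants is left unevaluated: numerals are unary. *)
Definition inner_rate : R := (30 * 100 * hardyK b * igau b)^-1.

Lemma inner_rate_gt0 : 0 < inner_rate.
Proof.
rewrite invr_gt0; apply: mulr_gt0; last exact: igau_gt0.
by apply: mulr_gt0; [apply: mulr_gt0; exact: ltr0Sn|exact: hardyK_gt0].
Qed.

Lemma energy_lower_bound rho : b <= rho ->
  inner_rate * pint 0 b (fun r => r ^+ 2 * (u r ^+ 2 + u1 r ^+ 2))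
  + 1 / 40 * pint b rho vnorm - X / 100 <=
  pint 0 b (fun r => Sflux r * hf1 u u1 r) +
  pint b rho (fun r => Sflux r * (u1 r * wt r + u r * (21 / 2 * vt r))).
Proof.
move=> brho.
have zt r : b <= r <= rho -> `|Zf r| <= 3 * tau.
  by move=> /andP[br _]; exact: Zf_tail.
have := outer_ineq brho zt.
have := inner_energy H0 du du1 b0.
have := inner_trace H0 du du1 b0.
have := inner_trace_CS H0 du du1 b0.
have := inner_coercive H0 du du1 b0.
have := diss_ge0 u u1 H0 b.
have := mom_tail (isT : (2 <= 4)%N) m20 (lexx b).
have := mom_tail (isT : (4 <= 4)%N) m40 (lexx b).
have := tailH_tail (lexx b).
have t2 := tau_sqr; have t0 := tau_ge0; have X0 := X_ge0.
have ms1 : 1 / 12 <= gmass b by apply: gmass_lb12; have := b64; lra.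
have ms2 : gmass b <= 1 / 2 by apply: gmass_le_half; exact: ltW.
have e0 := gau_gt0 b; have ie0 := igau_gt0 b.
have e1 := gau_le1 b.
have eie : gau b * igau b = 1 by rewrite gauE mulVf ?igau_neq0.
have hE : u b = gau b * hf u b by rewrite /hf mulrCA eie mulr1.
have dE : defect u H0 b = 2 / 3 * mom u 4 b - mom u 2 b + b ^+ 3 * u b / 3.
  by rewrite /defect /Zf /Gam; field.
have TE : Gam u H0 b = - u b + 2 * tailH u H0 b by [].
have w1 : wt b + 21 / 4 * (vt b / b) = igau b * (1 + 21 / 4 / b ^+ 2).
  by rewrite /vt (wt_b b64); field; rewrite gt_eqF.
set D := diss _ _ _ _; set In := pint 0 b (fun r => Sflux r * _).
set Ou := pint b rho (fun r => Sflux r * _).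
set J := pint 0 b (fun r => Psi b r * _).
set V := pint b rho vnorm.
set Hd := pint 0 b (fun r => r ^+ 2 * _).
rewrite dE TE w1 hE => hh h4 h2 D0 Hc HJ Htr HIn HOu.
exact: (energy_algebra b64 e0 e1 ie0 eie be ms1 ms2 X0 t0 t2 hh h4 h2 D0
  hardyK_gt0 Hc HJ Htr HIn HOu).
Qed.

(** Integration by parts on both intervals; the two terms at [b] cancel because the weight is
    continuous there, [wt b = igau b]. *)
Lemma flux_energy rho : b <= rho ->
  pint 0 b (fun r => Sflux1 r * hf u r) +
  pint b rho (fun r => Sflux1 r * (u r * wt r)) <=
  Sflux rho * (u rho * wt rho)
  - inner_rate * pint 0 b (fun r => r ^+ 2 * (u r ^+ 2 + u1 r ^+ 2))
  - 1 / 40 * pint b rho vnorm + X / 100.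
Proof.
move=> brho.
have c1 : cont_on 0 b (fun r => Sflux1 r * hf u r).
  by move=> x /andP[x0 _]; have ? := cS1 x0; have ? := @cont_hf _ _ _ du x; cont.
have c2 : cont_on 0 b (fun r => Sflux r * hf1 u u1 r).
  by move=> x _; have ? := @cS x; have ? := @cont_hf1 _ _ _ _ du du1 x; cont.
have c3 : cont_on b rho (fun r => Sflux1 r * (u r * wt r)).
  move=> x /andP[/pos x0 _]; have ? := cS1 (ltW x0); have ? := cont_wt b64 x0.
  by have ? := @cu x; cont.
have c4 : cont_on b rho (fun r => Sflux r * (u1 r * wt r + u r * (21 / 2 * vt r))).
  move=> x /andP[/pos x0 _]; have ? := @cS x; have ? := cont_wt b64 x0.
  by have ? := @cu x; have ? := @cu1 x; have ? := cont_vt b64 x0; cont.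
have I1 : pint 0 b (fun r => Sflux1 r * hf u r) +
    pint 0 b (fun r => Sflux r * hf1 u u1 r) = Sflux b * hf u b.
  rewrite -(pintD c1 c2).
  apply: (@pint_ftc_eq _ (fun r => Sflux r * hf u r)).
  - exact: ltW.
  - by move=> x xb; have ? := c1 x xb; have ? := c2 x xb; cont.
  - by move=> x _; have ? := @cS x; have ? := @cont_hf _ _ _ du x; cont.
  - move=> x /andP[x0 _]; have ? := der_Sflux H0 du du1 x0.
    by have ? := der_hf du x; dere; ring.
  - by rewrite Sflux0; ring.
have I2 : pint b rho (fun r => Sflux1 r * (u r * wt r)) +
    pint b rho (fun r => Sflux r * (u1 r * wt r + u r * (21 / 2 * vt r))) =
    Sflux rho * (u rho * wt rho) - Sflux b * (u b * wt b).
  rewrite -(pintD c3 c4).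
  apply: (@pint_ftc_eq _ (fun r => Sflux r * (u r * wt r))).
  - exact: brho.
  - by move=> x xb; have ? := c3 x xb; have ? := c4 x xb; cont.
  - move=> x /andP[/pos x0 _]; have ? := @cS x; have ? := cont_wt b64 x0.
    by have ? := @cu x; cont.
  - move=> x /andP[/ltW/pos x0 _]; have ? := der_Sflux H0 du du1 x0.
    by have ? := du x; have ? := der_wt b64 x0; dere; ring.
  - by [].
have := energy_lower_bound brho.
have : Sflux b * hf u b = Sflux b * (u b * wt b) by rewrite (wt_b b64).
lra.
Qed.

End Tails.
End Outer.

(** * Integration in spherical shells *)

Section LebesgueLine.
Context {R : realType}.
Notation mR := (measurableTypeR R).
Notation L := (@lebesgue_measure R).
Local Open Scope ereal_scope.

Lemma leb_ocitv (a b : R) : (a < b)%R -> L `]a, b]%classic = (b - a)%:E.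
Proof. by move=> ab; rewrite lebesgue_measure_itv/= lte_fin ab EFinB. Qed.

(** By uniqueness of Lebesgue measure, the image measure need only be tested on half-open
    intervals. *)
Lemma ge0_integral_leb_preserving (phi : mR -> mR) :
  measurable_fun setT phi ->
  (forall a b : R, (a < b)%R -> L (phi @^-1` `]a, b]%classic) = (b - a)%:E) ->
  forall g : mR -> \bar R, measurable_fun setT g -> (forall x, 0 <= g x) ->
  \int[L]_x g (phi x) = \int[L]_x g x.
Proof.
move=> mphi phiL g mg g0.
rewrite -[LHS](@ge0_integral_pushforward _ _ _ _ R phi mphi L setT)//.
apply: eq_measure_integral => A mA _.
pose m := measure_function_pushforward__canonical__measure_function_Measure L mphi.
apply/esym; apply: (@lebesgue_measure_unique R m) => // X /ocitvP[->|[[a b]/= ab ->]].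
  by rewrite !measure0.
by rewrite leb_ocitv//; exact/esym/phiL.
Qed.

Lemma ge0_integral_leb_shift (c : R) (g : mR -> \bar R) :
  measurable_fun setT g -> (forall x, 0 <= g x) ->
  \int[L]_x g (x + c)%R = \int[L]_x g x.
Proof.
apply: (ge0_integral_leb_preserving (phi := fun x : mR => (x + c)%R)).
  by apply: measurable_funD => //; exact: measurable_cst.
move=> a b ab.
have -> : (fun x => x + c)%R @^-1` `]a, b]%classic = `](a - c)%R, (b - c)%R]%classic.
  by apply/seteqP; split => x /=; rewrite !in_itv/= ltrBlDr lerBrDr.
rewrite leb_ocitv ?ltrD2r//; congr EFin; ring.
Qed.

Lemma ge0_integral_leb_opp (g : mR -> \bar R) :
  measurable_fun setT g -> (forall x, 0 <= g x) ->
  \int[L]_x g (- x)%R = \int[L]_x g x.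
Proof.
apply: (ge0_integral_leb_preserving (phi := fun x : mR => (- x)%R)).
  exact: measurableT_comp.
move=> a b ab.
have -> : (fun x => - x)%R @^-1` `]a, b]%classic = `[(- b)%R, (- a)%R[%classic.
  by apply/seteqP; split => x /=; rewrite !in_itv/= lerNl ltrNr andbC.
rewrite lebesgue_measure_itv/= lte_fin ltrN2 ab -EFinB; congr EFin; ring.
Qed.

(** Nonnegative integrands spare every integrability condition; signed ones are recovered from their
    positive and negative parts. *)
Definition preserves2 (T : mR * mR -> mR * mR) := measurable_fun setT T /\
  forall g : mR * mR -> \bar R, measurable_fun setT g -> (forall x, 0 <= g x) ->
  \int[L \x L]_x g (T x) = \int[L \x L]_x g x.

Lemma preserves2_comp T S : preserves2 T -> preserves2 S ->
  preserves2 (fun x => T (S x)).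
Proof.
move=> [mT hT] [mS hS]; split; first exact: (measurableT_comp mT mS).
move=> g mg g0.
rewrite (hS (fun x => g (T x)))//; first exact: hT.
exact: (measurableT_comp mg mT).
Qed.

Lemma preserves2_shear1 (a : R) :
  preserves2 (fun x : mR * mR => ((x.1 + a * x.2)%R : mR, x.2)).
Proof.
have mT : measurable_fun setT (fun x : mR * mR => ((x.1 + a * x.2)%R : mR, x.2)).
  apply/measurable_fun_pairP; split => /=; last exact: measurable_snd.
  by apply: measurable_funD; [exact: measurable_fst|apply: measurable_funM; [exact: measurable_cst|exact: measurable_snd]].
split=> // g mg g0.
rewrite (fubini_tonelli2 _ (measurableT_comp mg mT) (fun x => g0 _)) (fubini_tonelli2 _ mg g0).
apply: eq_integral => y _; rewrite /fubini_G /=.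
apply: (ge0_integral_leb_shift _ (g := fun x => g (x, y))) => //.
exact: (measurableT_comp mg (measurable_pair2 y)).
Qed.

Lemma preserves2_shear2 (a : R) :
  preserves2 (fun x : mR * mR => (x.1, (x.2 + a * x.1)%R : mR)).
Proof.
have mT : measurable_fun setT (fun x : mR * mR => (x.1, (x.2 + a * x.1)%R : mR)).
  apply/measurable_fun_pairP; split => /=; first exact: measurable_fst.
  by apply: measurable_funD; [exact: measurable_snd|apply: measurable_funM; [exact: measurable_cst|exact: measurable_fst]].
split=> // g mg g0.
rewrite (fubini_tonelli1 _ (measurableT_comp mg mT) (fun x => g0 _)) (fubini_tonelli1 _ mg g0).
apply: eq_integral => y _; rewrite /fubini_F /=.
apply: (ge0_integral_leb_shift _ (g := fun x => g (y, x))) => //.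
exact: (measurableT_comp mg (measurable_pair1 y)).
Qed.

Lemma preserves2_opp1 : preserves2 (fun x : mR * mR => ((- x.1)%R : mR, x.2)).
Proof.
have mT : measurable_fun setT (fun x : mR * mR => ((- x.1)%R : mR, x.2)).
  apply/measurable_fun_pairP; split => /=; last exact: measurable_snd.
  exact: (measurableT_comp (@oppr_measurable R setT) measurable_fst).
split=> // g mg g0.
rewrite (fubini_tonelli2 _ (measurableT_comp mg mT) (fun x => g0 _)) (fubini_tonelli2 _ mg g0).
apply: eq_integral => y _; rewrite /fubini_G /=.
apply: (ge0_integral_leb_opp (g := fun x => g (x, y))) => //.
exact: (measurableT_comp mg (measurable_pair2 y)).
Qed.

Lemma preserves2_opp2 : preserves2 (fun x : mR * mR => (x.1, (- x.2)%R : mR)).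
Proof.
have mT : measurable_fun setT (fun x : mR * mR => (x.1, (- x.2)%R : mR)).
  apply/measurable_fun_pairP; split => /=; first exact: measurable_fst.
  exact: (measurableT_comp (@oppr_measurable R setT) measurable_snd).
split=> // g mg g0.
rewrite (fubini_tonelli1 _ (measurableT_comp mg mT) (fun x => g0 _)) (fubini_tonelli1 _ mg g0).
apply: eq_integral => y _; rewrite /fubini_F /=.
apply: (ge0_integral_leb_opp (g := fun x => g (y, x))) => //.
exact: (measurableT_comp mg (measurable_pair1 y)).
Qed.

(* A rotation is a product of three shears, except the half turn. *)
Lemma preserves2_rot (c s : R) : (c ^+ 2 + s ^+ 2 = 1)%R ->
  preserves2 (fun x : mR * mR =>
    ((c * x.1 - s * x.2)%R : mR, (s * x.1 + c * x.2)%R : mR)).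
Proof.
move=> cs; have [c1|c1] := eqVneq c (-1)%R.
  have s0 : s = 0%R.
    by apply/eqP; rewrite -sqrf_eq0; apply/eqP; move: cs; rewrite c1; lra.
  have := preserves2_comp preserves2_opp1 preserves2_opp2.
  congr preserves2; apply/funext => -[x y] /=.
  by rewrite c1 s0; congr pair; ring.
have c10 : (1 + c)%R != 0%R by apply: contraNneq c1 => ?; apply/eqP; lra.
have := preserves2_comp (preserves2_shear1 (- (s / (1 + c)))%R)
  (preserves2_comp (preserves2_shear2 s) (preserves2_shear1 (- (s / (1 + c)))%R)).
congr preserves2; apply/funext => -[x y] /=.
have s2 : (s ^+ 2 = (1 - c) * (1 + c))%R by lra.
have e1 : (1 - s * (s / (1 + c)) = c)%R.
  have -> : (s * (s / (1 + c)) = s ^+ 2 / (1 + c))%R by field.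
  by rewrite s2 mulfK//; ring.
congr pair.
- transitivity (x * (1 - s * (s / (1 + c)))
     - y * (s / (1 + c)) * (1 + (1 - s * (s / (1 + c)))))%R; first ring.
  rewrite e1; field; exact: c10.
- transitivity (y * (1 - s * (s / (1 + c))) + s * x)%R; first ring.
  by rewrite e1; ring.
Qed.

End LebesgueLine.

(** * The law of the squared norm in the plane *)

Section DiscLaw.
Context {R : realType}.
Notation mR := (measurableTypeR R).
Notation L := (@lebesgue_measure R).

Definition chord (s x : R) : R := 2 * Num.sqrt (s - x ^+ 2).

Lemma cont_chord s : continuous (chord s).
Proof. by move=> x; rewrite /chord; cont. Qed.

(** The area of the unit disc. Its value is never computed; positivity suffices. *)
Definition disc_area : R := pint (-1) 1 (chord 1).

Lemma disc_area_gt0 : 0 < disc_area.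
Proof.
apply: (@lt_le_trans _ _ (pint (-1) 1 (fun x => 2 * (1 - x ^+ 2)))).
  have -> : pint (-1) 1 (fun x : R => 2 * (1 - x ^+ 2)) = 8 / 3.
    apply: (@pint_ftc_eq _ (fun x : R => 2 * (x - x ^+ 3 / 3))).
    - by rewrite (@le_trans _ _ 0)// oppr_le0.
    - by move=> x _; cont.
    - by move=> x _; cont.
    - by move=> x _; dere; rewrite /=; field.
    - by field.
  by rewrite divr_gt0.
apply: pint_le.
- by move=> x _; cont.
- by move=> x _; exact: cont_chord.
- move=> x /andP[x1 x2]; rewrite /chord ler_wpM2l//.
  have h0 : 0 <= 1 - x ^+ 2 by nra.
  have h1 : 1 - x ^+ 2 <= 1 by rewrite gerBl sqr_ge0.

have t1 : (1 - x ^+ 2) ^+ 2 <= 1 - x ^+ 2 by rewrite expr2 ler_piMr.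
have := ler_wsqrtr t1; by rewrite sqrtr_sqr ger0_norm.
Qed.

Lemma chord_scale (s : R) : 0 < s ->
  pint (- Num.sqrt s) (Num.sqrt s) (chord s) = disc_area * s.
Proof.
move=> s0; have q0 : 0 < Num.sqrt s by rewrite sqrtr_gt0.
set q := Num.sqrt s in q0 *.
have qs : q ^+ 2 = s by rewrite sqr_sqrtr// ltW.
have dF (x : R) : is_derive x 1 (fun x : R => q * x) q by dere; ring.
have F1 : derive1 (fun x : R => q * x) = cst q.
  by apply/funext => x; rewrite derive1E; have [_ ->] := dF x.
have cF : continuous (fun x : R => q * x) by move=> x; cont.
have E : (\int[L]_(x in `[(q * (-1))%R, (q * 1)%R]) (chord s x)%:E =
  \int[L]_(x in `[(-1)%R, 1%R])
    (((chord s \o (fun x : R => q * x)) * derive1 (fun x : R => q * x)) x)%:E)%E.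
  apply: (@integration_by_substitution_increasing R (fun x => q * x) (chord s)).
  - by rewrite (@le_trans _ _ 0)// oppr_le0.
  - by move=> x y _ _ xy; rewrite ltr_pM2l.
  - by rewrite F1 => x _; exact: cst_continuous.
  - by rewrite F1; exact: is_cvg_cst.
  - by rewrite F1; exact: is_cvg_cst.
  - split; first by move=> x _; have [] := dF x.
    + by apply: cvg_at_right_filter; exact: cF.
    + by apply: cvg_at_left_filter; exact: cF.
  - apply: cont_on_within => x _; exact: cont_chord.
rewrite /disc_area mulrC -pintZ; last by move=> x _; exact: cont_chord.
rewrite mulrN1 mulr1 in E.
rewrite /pint /Rintegral E; congr fine; apply: eq_integral => x _.
rewrite F1; congr EFin; rewrite -[LHS]/(chord s (q * x) * q) /chord.
have -> : s - (q * x) ^+ 2 = s * (1 - x ^+ 2) by rewrite exprMn qs; ring.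
rewrite sqrtrM ?(ltW s0)// -/q -qs; ring.
Qed.

Definition rho2 (p : mR * mR) : mR := p.1 ^+ 2 + p.2 ^+ 2.

Lemma measurable_rho2 : measurable_fun setT rho2.
Proof.
apply: measurable_funD; apply: measurable_funX.
- exact: measurable_fst.
- exact: measurable_snd.
Qed.

Lemma sqr_le_sqrt (y t : R) : 0 <= t -> (y ^+ 2 <= t) = (- Num.sqrt t <= y <= Num.sqrt t).
Proof.
move=> t0; rewrite -ler_norml -[in LHS](sqr_sqrtr t0) -[in LHS]real_normK ?num_real//.
by rewrite ler_pXn2r// nnegrE sqrtr_ge0.
Qed.

(** The disc is sliced into chords, and [chord_scale] reduces it to the unit disc; the maximum
    covers negative [s], where the disc is empty. *)
Lemma disc_measure (s : R) :
  (L \x L)%E (rho2 @^-1` `]-oo, s]) = (disc_area * Num.max s 0)%:E.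
Proof.
rewrite /product_measure1 /=.
transitivity (\int[L]_x (chord s x)%:E)%E.
  apply: eq_integral => x _ /=.
  have [sx|sx] := leP 0 (s - x ^+ 2).
    have -> : xsection (rho2 @^-1` `]-oo, s]) x =
        `[- Num.sqrt (s - x ^+ 2), Num.sqrt (s - x ^+ 2)]%classic.
      apply/seteqP; split => y; rewrite /xsection/= inE/= /rho2 !in_itv/= => h.
        by rewrite -sqr_le_sqrt//; move: h; lra.
      by move: h; rewrite -sqr_le_sqrt//; lra.
    rewrite lebesgue_measure_itv/= lte_fin /chord.
    case: ltP => [_|h]; first by rewrite -EFinB; congr EFin; ring.
    suff -> : Num.sqrt (s - x ^+ 2) = 0 by rewrite mulr0.
    by apply/eqP; rewrite eq_le sqrtr_ge0 andbT; move: h; lra.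
  have -> : xsection (rho2 @^-1` `]-oo, s]) x = set0.
    apply/seteqP; split => y //; rewrite /xsection/= inE/= /rho2 in_itv/=.
    by have := sqr_ge0 y; lra.
  by rewrite measure0 /chord ltr0_sqrtr// mulr0.
have [s0|s0] := leP s 0.
  rewrite mulr0; apply: integral0_eq => x _; rewrite /chord.
  by rewrite ler0_sqrtr ?mulr0//; have := sqr_ge0 x; lra.
rewrite -(chord_scale s0).
set q := Num.sqrt s.
transitivity (\int[L]_(x in `[(- q)%R, q]) (chord s x)%:E)%E.
  rewrite [RHS]integral_mkcond; apply: eq_integral => x _.
  rewrite patchE; case: ifPn => // xq; rewrite /chord ler0_sqrtr ?mulr0//.
  have : ~~ (x ^+ 2 <= s).
    by rewrite sqr_le_sqrt ?(ltW s0)//; move: xq; rewrite notin_setE/= in_itv/= => /negP.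
  by rewrite -ltNge; lra.
rewrite /pint /Rintegral fineK//.
apply: integrable_fin_num => //.
by apply: cont_on_integrable => x _; exact: cont_chord.
Qed.

Lemma disc_area_inv_ge0 : 0 <= disc_area^-1.
Proof. by rewrite invr_ge0 ltW// disc_area_gt0. Qed.

Let nu : {measure set mR -> \bar R} :=
  measure_function_pushforward__canonical__measure_function_Measure
    (L \x L)%E measurable_rho2.

Let nu_ocitv (a b : R) : a < b ->
  nu `]a, b]%classic = (disc_area * (Num.max b 0 - Num.max a 0))%:E.
Proof.
move=> ab.
have mray (t : R) : measurable (`]-oo, t]%classic : set mR) by exact: measurable_itv.
have nray (t : R) : nu `]-oo, t]%classic = (disc_area * Num.max t 0)%:E.
  exact: disc_measure.
have -> : `]a, b]%classic = `]-oo, b]%classic `\` `]-oo, a]%classic :> set mR.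
  apply/seteqP; split => x /=; rewrite !in_itv/=.
    by move=> /andP[ax ->]; split=> //; apply/negP; rewrite -ltNge.
  by move=> [-> /negP ax]; rewrite andbT ltNge.
rewrite (@measureD _ _ _ nu)//; last by rewrite [ltLHS](nray b) ltry.
have -> : `]-oo, b]%classic `&` `]-oo, a]%classic = `]-oo, a]%classic :> set mR.
  apply/seteqP; split => x /=; rewrite !in_itv/=; first by case.
  by move=> xa; split=> //; rewrite (le_trans xa)// ltW.
by rewrite [X in (X - _)%E](nray b) [X in (_ - X)%E](nray a) -EFinB mulrBr.
Qed.

(** The squared norm is uniformly distributed on the half-line. Uniqueness of Lebesgue measure
    concerns the whole line, so the rescaled law [m1] is completed by Lebesgue measure [m2] on the
    negative half-line. *)
Lemma ge0_integral_rho2 (g : mR -> \bar R) : measurable_fun setT g ->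
  (forall x, (0 <= g x)%E) ->
  (\int[L \x L]_p g (rho2 p) = disc_area%:E * \int[L]_(s in `[0%R, +oo[) g s)%E.
Proof.
move=> mg g0.
have mD : measurable (`]-oo, 0[%classic : set mR) by exact: measurable_itv.
have mI : measurable (`[0, +oo[%classic : set mR) by exact: measurable_itv.
pose k := NngNum disc_area_inv_ge0.
pose m1 : {measure set mR -> \bar R} := mscale k nu.
pose m2 : {measure set mR -> \bar R} := mrestr L mD.
pose m : {measure set mR -> \bar R} := measure_add m1 m2.
have mL (A : set mR) : measurable A -> L A = m A.
  apply: lebesgue_measure_unique => X /ocitvP[->|[[a b]/= ab ->]].
    by rewrite !measure0.
  rewrite [LHS]leb_ocitv// -[RHS]/(measure_add m1 m2 `]a, b]%classic) measure_addE.
  have -> : m1 `]a, b]%classic = (Num.max b 0 - Num.max a 0)%:E.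
    rewrite /m1 /= /mscale /= nu_ocitv// -EFinM mulKf//.
    by rewrite gt_eqF// disc_area_gt0.
  have -> : m2 `]a, b]%classic = (Num.min b 0 - Num.min a 0)%:E.
    rewrite /m2 /= /mrestr.
    have [b0|b0] := ltP b 0.
      have -> : `]a, b]%classic `&` `]-oo, 0[%classic = `]a, b]%classic :> set mR.
        apply/seteqP; split => x /=; rewrite !in_itv/=; first by case.
        by move=> /andP[ax xb]; split; [rewrite ax|exact: le_lt_trans b0].
      by rewrite leb_ocitv// (min_idPl _)// ltW// (lt_trans ab).
    have [a0|a0] := ltP a 0.
      have -> : `]a, b]%classic `&` `]-oo, 0[%classic = `]a, 0[%classic :> set mR.
        apply/seteqP; split => x /=; rewrite !in_itv/=.
          by move=> [/andP[-> _] ->].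
        by move=> /andP[ax xb]; split=> //; rewrite ax (le_trans (ltW xb)).
      by rewrite lebesgue_measure_itv/= lte_fin a0 -EFinB.
    have -> : `]a, b]%classic `&` `]-oo, 0[%classic = set0 :> set mR.
      apply/seteqP; split => x //=; rewrite !in_itv/= => -[/andP[ax _] x0].
      by move: (lt_trans ax x0); rewrite ltNge a0.
    by rewrite measure0 subrr.
  rewrite -EFinD; congr EFin.
  have := addr_max_min b 0; have := addr_max_min a 0.
  lra.
have eqm (A : set mR) : measurable A -> A `<=` `[0, +oo[%classic -> L A = m1 A.
  move=> mA A0; transitivity (measure_add m1 m2 A); first exact: mL.
  rewrite measure_addE.
  have -> : m2 A = 0%E.
    rewrite /m2 /= /mrestr; have -> : A `&` `]-oo, 0[%classic = set0 :> set mR.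
      apply/seteqP; split => x //= -[/A0/=]; rewrite !in_itv/= andbT.
      by move=> x0; rewrite ltNge x0.
    by rewrite measure0.
  by rewrite adde0.
have -> : (\int[L]_(s in `[0%R, +oo[) g s = \int[m1]_(s in `[0%R, +oo[) g s)%E.
  by apply: eq_measure_integral => A mA AD; exact: eqm.
have mg0 : measurable_fun (`[0, +oo[%classic : set mR) g by exact: measurable_funTS.
rewrite /m1 ge0_integral_mscale//.
rewrite muleA -EFinM /= mulfV ?gt_eqF ?disc_area_gt0// mul1e.
rewrite [RHS](@ge0_integral_pushforward _ _ _ _ R rho2 measurable_rho2 (L \x L)%E)//.
have -> : rho2 @^-1` `[0, +oo[%classic = setT.
  apply/seteqP; split => p //= _; rewrite in_itv/= andbT.
  by rewrite addr_ge0 ?sqr_ge0.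
by [].
Qed.

End DiscLaw.

(** * Fubini in three dimensions *)

Section Leb3.
Context {R : realType}.
Notation mR := (measurableTypeR R).
Notation L := (@lebesgue_measure R).
Local Open Scope ereal_scope.
Lemma sigma_finite_leb2 : sigma_finite setT (L \x L).
Proof.
pose I (n : nat) : set mR := `[(- (n%:R : R))%R, (n%:R : R)]%classic.
exists (fun n => I n `*` I n).
  apply/esym/seteqP; split => // -[x y] _.
  exists (Num.trunc (`|x| + `|y|)%R).+1 => //=.
  have h := truncnS_gt (`|x| + `|y| : R)%R.
  have hx := normr_ge0 x; have hy := normr_ge0 y.
  by split; rewrite /I /= in_itv/= -ler_norml; move: h hx hy; rewrite /GRing.natmul; lra.
move=> n; split; first by apply: measurableX; exact: measurable_itv.
have LI : L (I n) < +oo.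
  rewrite /I lebesgue_measure_itv/=; case: ifP => _; last exact: ltry.
  by rewrite -EFinB ltry.
rewrite product_measure1E; [|exact: measurable_itv|exact: measurable_itv].
by apply: lte_mul_pinfty => //; rewrite ge0_fin_numE.
Qed.

(** The plane measure repackaged with its sigma-finiteness, as Fubini between the plane and the
    third axis requires. *)
Definition leb2 : {sigma_finite_measure set (mR * mR)%type -> \bar R} :=
  HB.pack (L \x L) (@Measure_isSigmaFinite.Build _ _ _ (L \x L) sigma_finite_leb2).

Lemma ge0_integral_leb3 (h : mR * mR * mR -> \bar R) : measurable_fun setT h ->
  (forall p, 0 <= h p) ->
  \int[leb3 R]_p h p = \int[L]_z \int[L \x L]_q h (q, z).
Proof.
move=> mh h0.
exact: (fubini_tonelli2 (m1 := leb2) (m2 := L) h mh h0).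
Qed.
Lemma ge0_integral_leb3_assoc (h : mR * mR * mR -> \bar R) : measurable_fun setT h ->
  (forall p, 0 <= h p) ->
  \int[leb3 R]_p h p = \int[L]_x \int[L \x L]_q h ((x, q.1), q.2).
Proof.
move=> mh h0.
have -> : \int[leb3 R]_p h p = \int[L \x L]_q \int[L]_z h (q, z) by exact: (fubini_tonelli1 (m1 := leb2) (m2 := L) h mh h0).
have m1 := measurable_fun_fubini_tonelli_F (m2 := L) h mh h0.
rewrite (fubini_tonelli1 _ m1); last by move=> q; apply: integral_ge0.
apply: eq_integral => x _; rewrite /fubini_F.
have mm : measurable_fun setT (fun q : mR * mR => h ((x, q.1), q.2)).
  apply: (measurableT_comp mh).
  apply/measurable_fun_pairP; split => /=; last exact: measurable_snd.
  apply/measurable_fun_pairP; split => /=; [exact: measurable_cst|exact: measurable_fst].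
by rewrite (fubini_tonelli1 (m1 := L) (m2 := L) _ mm).
Qed.
End Leb3.

(** * The joint law of squared norm and height *)

Section SphericalLaw.
Context {R : realType}.
Notation mR := (measurableTypeR R).
Notation L := (@lebesgue_measure R).

(* Squared norm and last coordinate: the law of this pair under [leb3] is
   [disc_area] times Lebesgue measure on [{z ^+ 2 <= t}] (Archimedes). *)
Definition sph (p : mR * mR * mR) : mR * mR := (rho2 p.1 + p.2 ^+ 2, p.2).

Lemma measurable_sph : measurable_fun setT sph.
Proof.
apply/measurable_fun_pairP; split => /=; last exact: measurable_snd.
apply: measurable_funD.
  exact: (measurableT_comp measurable_rho2 measurable_fst).
by apply: measurable_funX; exact: measurable_snd.
Qed.

Definition under_parabola : set (mR * mR) := [set q | q.2 ^+ 2 <= q.1].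

Lemma measurable_under_parabola : measurable under_parabola.
Proof.
rewrite -[X in measurable X]setTI.
have -> : under_parabola = (fun q : mR * mR => q.1 - q.2 ^+ 2) @^-1` `[0, +oo[.
  by apply/seteqP; split => q; rewrite /under_parabola /= in_itv/= andbT subr_ge0.
have mf : measurable_fun setT (fun q : mR * mR => (q.1 - q.2 ^+ 2 : mR)).
  apply: measurable_funB; first exact: measurable_fst.
  by apply: measurable_funX; exact: measurable_snd.
by apply: mf => //; exact: measurable_itv.
Qed.

Local Open Scope ereal_scope.

(** At height [z] the squared norm is [rho2 + z ^ 2]: the planar law applies on each slice, followed
    by a shift by [z ^ 2]. *)
Lemma ge0_integral_sph (G : mR * mR -> \bar R) : measurable_fun setT G ->
  (forall q, 0 <= G q) ->
  \int[leb3 R]_p G (sph p) =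
  disc_area%:E * \int[L \x L]_(q in under_parabola) G q.
Proof.
move=> mG G0.
have mGs : measurable_fun setT (fun p => G (sph p)).
  exact: (measurableT_comp mG measurable_sph).
rewrite (ge0_integral_leb3 mGs)//.
rewrite [X in _ = _ * X]integral_mkcond.
have mc : measurable_fun setT (G \_ under_parabola).
  apply/(measurable_restrictT _ measurable_under_parabola).
  exact: measurable_funTS.
have c0 q : 0 <= (G \_ under_parabola) q by rewrite patchE; case: ifP.
rewrite (fubini_tonelli2 (m1 := L) (m2 := L) (G \_ under_parabola) mc c0).
have d0 : (0 <= disc_area :> R)%R by exact/ltW/disc_area_gt0.
rewrite -ge0_integralZl//; last 2 first.
- exact: measurable_fun_fubini_tonelli_G.
- by move=> z _; apply: integral_ge0 => t _; exact: c0.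
apply: eq_integral => z _; rewrite /fubini_G /sph /=.
have mz : measurable_fun setT (fun s : mR => (s + z ^+ 2)%R : mR).
  by apply: measurable_funD => //; exact: measurable_cst.
rewrite (ge0_integral_rho2 (g := fun s => G ((s + z ^+ 2)%R, z)))//; last first.
  exact: (measurableT_comp (measurableT_comp mG (measurable_pair2 z)) mz).
congr (_ * _); rewrite integral_mkcond.
rewrite -(ge0_integral_leb_shift (z ^+ 2) (g := fun t => (G \_ under_parabola) (t, z)))//.
- apply: eq_integral => s _; rewrite !patchE.
  have -> : (s \in [set` `[0%R, +oo[]) = ((s + z ^+ 2, z)%R \in under_parabola).
    by apply/idP/idP => /set_mem h; apply/mem_set; move: h;
      rewrite /under_parabola /= in_itv/= andbT lerDr.
  by [].
- exact: (measurableT_comp mc (measurable_pair2 z)).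
Qed.

Lemma integral_sph (G : mR * mR -> R) : measurable_fun setT G ->
  (leb3 R).-integrable setT (fun p => (G (sph p))%:E) ->
  \int[leb3 R]_p (G (sph p))%:E =
  disc_area%:E * \int[L \x L]_(q in under_parabola) (G q)%:E.
Proof.
move=> mG iG.
have mE : measurable_fun setT (EFin \o G) by exact/measurable_EFinP.
have ip := integrable_funepos measurableT iG.
have im := integrable_funeneg measurableT iG.
have fp := integrable_fin_num measurableT ip.
have fm := integrable_fin_num measurableT im.
rewrite integralE [X in _ = _ * X]integralE.
have Ep : \int[leb3 R]_p ((fun p => (G (sph p))%:E)^\+ p) =
   disc_area%:E * \int[L \x L]_(q in under_parabola) ((fun q => (G q)%:E)^\+ q).
  transitivity (\int[leb3 R]_p ((EFin \o G)^\+ (sph p))).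
    by apply: eq_integral => p _; rewrite !funeposE.
  rewrite ge0_integral_sph; first by [].
  - exact: measurable_funepos.
  - by move=> q; exact: funepos_ge0.
have Em : \int[leb3 R]_p ((fun p => (G (sph p))%:E)^\- p) =
   disc_area%:E * \int[L \x L]_(q in under_parabola) ((fun q => (G q)%:E)^\- q).
  transitivity (\int[leb3 R]_p ((EFin \o G)^\- (sph p))).
    by apply: eq_integral => p _; rewrite !funenegE.
  rewrite ge0_integral_sph; first by [].
  - exact: measurable_funeneg.
  - by move=> q; exact: funeneg_ge0.
rewrite Ep Em in fp fm *.
(* Integrability makes both parts finite, so the positive constant factors out of their
   difference. *)
have fin x : disc_area%:E * x \is a fin_num -> (x : \bar R) \is a fin_num.
  have := @disc_area_gt0 R; case: x => [r|/=|/=] // k0.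
  - by rewrite mulry gtr0_sg// mul1e.
  - by rewrite mulrNy gtr0_sg// mul1e.
have mulB (A B : \bar R) : A \is a fin_num -> B \is a fin_num ->
    disc_area%:E * A - disc_area%:E * B = disc_area%:E * (A - B).
  by move: A B => [a| |]// [c| |]// _ _; rewrite -EFinB -!EFinM mulrBr EFinB.
exact: mulB (fin _ fp) (fin _ fm).
Qed.

End SphericalLaw.

(** * From squared radii to radii *)

Section Shell.
Context {R : realType}.
Notation mR := (measurableTypeR R).
Notation L := (@lebesgue_measure R).
Implicit Types (s h : R -> R).

Lemma Rintegral_split_y h y : L.-integrable `[0, +oo[ (EFin \o h) -> 0 <= y ->
  \int[L]_(t in `[0, +oo[) h t = pint 0 y h + \int[L]_(t in `]y, +oo[) h t.
Proof.
move=> ih y0; have := @Rintegral_itvB R h (BLeft 0) +oo%O y ih.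
rewrite !bnd_simp => /(_ y0 isT) <-.
by rewrite /pint addrC subrK.
Qed.

(** Monotone convergence for [|h|] along the integers makes its tails small, and they dominate those
    of [h]. *)
Lemma cvg_pint_integral h : L.-integrable `[0, +oo[ (EFin \o h) ->
  (fun x => pint 0 x h) @ +oo --> \int[L]_(t in `[0, +oo[) h t.
Proof.
move=> ih.
have mI : measurable (`[0, +oo[%classic : set mR) by exact: measurable_itv.
pose k (x : R) : R := `|h x|.
have ik : L.-integrable `[0, +oo[ (EFin \o k) by exact: integrable_abse ih.
have mk : measurable_fun (`[0, +oo[%classic : set mR) (k : mR -> mR).
  by apply/measurable_EFinP; exact: measurable_int ik.
pose kp : R -> R := k \_ `[0, +oo[.
have mkp : measurable_fun setT kp by apply/(measurable_restrictT _ mI).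
have kp0 (x : R) : 0 <= kp x.
  by rewrite /kp patchE; case: ifP => _; [exact: normr_ge0|exact: lexx].
have kpE (y : itv_bound R) : (\int[L]_(t in [set` Interval (BLeft 0%R) y]) (kp t)%:E =
    \int[L]_(t in [set` Interval (BLeft 0%R) y]) (k t)%:E)%E.
  apply: eq_integral => t; rewrite inE/= => ty; rewrite /kp patchE ifT//.
  rewrite inE/= in_itv/= andbT; move: ty; rewrite itv_boundlr => /andP[+ _].
  by rewrite bnd_simp.
have finE := fineK (integrable_fin_num mI ik).
have : (fun n : nat => \int[L]_(t in `[0%R, n%:R%R]) (k t)%:E)%E @ \oo -->
    (\int[L]_(t in `[0, +oo[) k t)%:E.
  have -> : (\int[L]_(t in `[0, +oo[) k t)%:E = (\int[L]_(t in `[0%R, +oo[) (kp t)%:E)%E.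
    by rewrite kpE -finE.
  have -> : (fun n : nat => \int[L]_(t in `[0%R, n%:R%R]) (k t)%:E)%E =
     (fun n : nat => \int[L]_(t in `[0%R, n%:R%R]) (kp t)%:E)%E.
    by apply/funext => n; rewrite kpE.
  exact: ge0_cvgn_integral.
move=> /fine_cvgP[_] /cvgrPdist_lt hlim.
apply/cvgrPdist_lt => e e0.
have [N _ /(_ N (leqnn N)) /= hN] := hlim e e0.
exists N%:R; split; first exact: num_real.
move=> y /ltW Ny; have N0 : 0 <= N%:R :> R by [].
have y0 := le_trans N0 Ny.
rewrite (Rintegral_split_y ih y0) addrAC subrr add0r.
have hN' : `|\int[L]_(t in `[0, +oo[) k t - pint 0 N%:R k| < e by exact: hN.
rewrite (Rintegral_split_y ik N0) addrAC subrr add0r in hN'.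
have iyk : L.-integrable `]y, +oo[ (EFin \o h).
  by apply: integrableS ih => //; apply: subset_itvr; rewrite bnd_simp.
apply: le_lt_trans (le_normr_Rintegral _ iyk) _ => //.
apply: le_lt_trans hN'; apply: le_trans (ler_norm _).
have := Rintegral_split_y ik N0; rewrite (Rintegral_split_y ik y0) => E.
have iNy : L.-integrable `[0, y] (EFin \o k).
  by apply: integrableS ik => //; apply: subset_itvl; rewrite bnd_simp.
have := @Rintegral_itvB R k (BLeft 0) (BRight y) N%:R iNy.
rewrite !bnd_simp => /(_ N0 Ny) E2.
have k0 : 0 <= \int[L]_(t in `]N%:R, y]) k t.
  by apply: Rintegral_ge0 => t _; exact: normr_ge0.
have {}E2 : pint 0 y k - pint 0 N%:R k = \int[L]_(t in `]N%:R, y]) k t by exact: E2.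
rewrite -[leLHS]/(\int[L]_(t in `]y, +oo[) k t).
by move: E E2 k0; clear; lra.
Qed.

(** The image of [s r dr] under [t = r ^ 2], extended by 0 to a function on the whole line. *)
Definition shell_density s t : R := if 0 < t then s (Num.sqrt t) / (2 * Num.sqrt t) else 0.

Lemma cont_shell_density s t : (forall r, 0 < r -> {for r, continuous s}) ->
  0 < t -> {for t, continuous (shell_density s)}.
Proof.
move=> cs t0; have q0 : 0 < Num.sqrt t by rewrite sqrtr_gt0.
have c : {for t, continuous (fun t => s (Num.sqrt t) / (2 * Num.sqrt t))}.
  have c1 : {for t, continuous (fun t => s (Num.sqrt t))}.
    apply: (@continuous_comp _ _ _ Num.sqrt s); first exact: sqrt_continuous.
    exact: cs.
  have c2 : {for t, continuous (fun t : R => (2 * Num.sqrt t)^-1)}.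
    by cont; rewrite mulf_neq0// gt_eqF.
  exact: contM c1 c2.
rewrite /prop_for /continuous_at /shell_density t0.
apply: cvg_trans c; apply: near_eq_cvg.
by near=> x; rewrite ifT//; near: x; exact: lt_nbhsr.
Unshelve. all: by end_near. Qed.

Lemma measurable_shell_density s : (forall r, 0 < r -> {for r, continuous s}) ->
  measurable_fun setT (shell_density s : mR -> mR).
Proof.
move=> cs.
have -> : shell_density s = (shell_density s) \_ `]0, +oo[.
  apply/funext => t; rewrite patchE; case: ifPn => //.
  by rewrite notin_setE/= in_itv/= andbT /shell_density => /negP/negbTE ->.
have mI : measurable (`]0, +oo[%classic : set mR) by exact: measurable_itv.
apply/(measurable_restrictT _ mI).
apply: open_continuous_measurable_fun; first exact: interval_open.
by move=> t; rewrite inE/= in_itv/= andbT; exact: cont_shell_density.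
Qed.

Lemma pint_shell_density s e x : (forall r, 0 < r -> {for r, continuous s}) ->
  0 < e -> e <= x -> pint (e ^+ 2) (x ^+ 2) (shell_density s) = pint e x s.
Proof.
move=> cs e0 ex; have x0 := lt_le_trans e0 ex.
have dF (r : R) : is_derive r 1 (fun r : R => r ^+ 2) (2 * r) by dere; rewrite /=; ring.
have F1 : derive1 (fun r : R => r ^+ 2) = (fun r => 2 * r).
  by apply/funext => r; rewrite derive1E; have [_ ->] := dF r.
have cF : continuous (fun r : R => r ^+ 2) by move=> r; cont.
have cF1 : continuous (fun r : R => 2 * r) by move=> r; cont.
have E : (\int[L]_(t in `[(e ^+ 2)%R, (x ^+ 2)%R]) (shell_density s t)%:E =
  \int[L]_(r in `[e, x]) (((shell_density s \o (fun r : R => r ^+ 2)) *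
     derive1 (fun r : R => r ^+ 2)) r)%:E)%E.
  apply: (@integration_by_substitution_increasing R (fun r => r ^+ 2) (shell_density s)).
  - exact: ex.
  - move=> r r'; rewrite !in_itv/= => /andP[er _] /andP[er' _] rr.
    by rewrite ltr_pXn2r// nnegrE ?(le_trans (ltW e0)).
  - by rewrite F1 => r _; exact: cF1.
  - by rewrite F1; apply/cvg_ex; exists (2 * e); apply: cvg_at_right_filter; exact: cF1.
  - by rewrite F1; apply/cvg_ex; exists (2 * x); apply: cvg_at_left_filter; exact: cF1.
  - split; first by move=> r _; have [] := dF r.
    + by apply: cvg_at_right_filter; exact: cF.
    + by apply: cvg_at_left_filter; exact: cF.
  - apply: cont_on_within => t /andP[et _]; apply: cont_shell_density => //.
    by apply: lt_le_trans et; rewrite exprn_gt0.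
rewrite /pint /Rintegral E; congr fine; apply: eq_integral => r.
rewrite inE/= in_itv/= => /andP[er _].
have r0 := lt_le_trans e0 er.
rewrite F1; congr EFin; rewrite -[LHS]/(shell_density s (r ^+ 2) * (2 * r)).
rewrite /shell_density exprn_gt0// sqrtr_sqr gtr0_norm// divfK//.
by rewrite mulf_neq0// gt_eqF.
Qed.

End Shell.

Section ShellIntegral.
Context {R : realType}.
Notation mR := (measurableTypeR R).
Notation L := (@lebesgue_measure R).
Implicit Types (s h : R -> R) (G : mR * mR -> R).
Local Open Scope ereal_scope.

Lemma integral_under_parabola (G : mR * mR -> \bar R) (t : R) :
  \int[L]_z (G \_ under_parabola) (t, z) =
  if (0 <= t)%R then \int[L]_(z in `[(- Num.sqrt t)%R, Num.sqrt t]) G (t, z) else 0.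
Proof.
case: ifPn => [t0|]; last first.
  rewrite -ltNge => t0; apply: integral0_eq => z _.
  rewrite patchE ifF//; apply/negP; rewrite inE /under_parabola/= leNgt.
  by rewrite (lt_le_trans t0)// sqr_ge0.
rewrite [RHS]integral_mkcond; apply: eq_integral => z _; rewrite !patchE.
have -> : ((t, z) \in under_parabola) = (z \in [set` `[(- Num.sqrt t)%R, Num.sqrt t]]).
  by apply/idP/idP; rewrite !inE /under_parabola/= in_itv/= sqr_le_sqrt.
by [].
Qed.

Lemma ae_off_two (t0 : R) (P : R -> Prop) :
  (forall t : R, t != 0%R -> t != t0 -> P t) -> {ae L, forall t, P t}.
Proof.
move=> h; exists [set 0%R; t0]; split.
- by apply: measurableU; exact: measurable_set1.
- apply: countable_lebesgue_measure0; apply: finite_set_countable.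
  by rewrite finite_setU; split; exact: finite_set1.
- move=> t /= Pt; apply: contrapT => /not_orP[a b]; apply: Pt.
  by apply: h; apply/eqP.
Qed.

Lemma shell_density_le0 s (t : R) : (t <= 0)%R -> shell_density s t = 0%R.
Proof. by rewrite /shell_density ltNge => ->. Qed.

Lemma shell_density_ge0 s (t : R) : (forall r, 0 <= r -> 0 <= s r)%R ->
  (0 <= shell_density s t)%R.
Proof.
move=> s0; rewrite /shell_density; case: ifP => // t0.
by rewrite mulr_ge0 ?s0 ?invr_ge0 ?mulr_ge0 ?sqrtr_ge0.
Qed.

(** Monotone convergence along segments that exhaust the open half-line and avoid 0, where the
    density may be unbounded. *)
Lemma integral_shell_density_le s (C : R) : continuous s ->
  (forall r, 0 <= r -> 0 <= s r)%R -> (forall x, 0 <= x -> pint 0 x s <= C)%R ->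
  \int[L]_t (shell_density s t)%:E <= C%:E.
Proof.
move=> cs s0 sC.
have msd : measurable_fun setT (shell_density s : mR -> mR).
  by apply: measurable_shell_density => r _; exact: cs.
pose F (n : nat) : set mR := `[(n.+1%:R^-1 ^+ 2 : R)%R, (n.+1%:R ^+ 2 : R)%R]%classic.
have UF : \bigcup_n F n = `]0%R, +oo[%classic.
  apply/seteqP; split => t /=.
    case=> n _; rewrite /F /= !in_itv/= andbT => /andP[+ _].
    by apply: lt_le_trans; rewrite exprn_gt0// invr_gt0.
  rewrite in_itv/= andbT => t0.
  have q0 : (0 < Num.sqrt t)%R by rewrite sqrtr_gt0.
  have qt : (Num.sqrt t ^+ 2 = t)%R by rewrite sqr_sqrtr// ltW.
  exists (Num.trunc (Num.sqrt t + (Num.sqrt t)^-1)%R) => //.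
  have h := truncnS_gt (Num.sqrt t + (Num.sqrt t)^-1)%R.
  set n := Num.trunc _ in h *.
  have n0 : (0 <= n.+1%:R :> R)%R by [].
  have q0' := ltW q0.
  rewrite /F/= in_itv/= -qt !ler_pXn2r ?nnegrE ?invr_ge0//.
  have i0 : (0 < (Num.sqrt t)^-1)%R by rewrite invr_gt0.
  apply/andP; split; last by move: h i0; lra.
  rewrite -[leRHS]invrK lef_pV2 ?posrE//.
  by move: h q0; lra.
have -> : \int[L]_t (shell_density s t)%:E = \int[L]_(t in \bigcup_n F n) (shell_density s t)%:E.
  rewrite [RHS]integral_mkcond UF; apply: eq_integral => t _.
  rewrite patchE; case: ifPn => //; rewrite notin_setE/= in_itv/= andbT => /negP.
  by rewrite -leNgt => /(shell_density_le0 s) ->.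
have nd : nondecreasing_seq F.
  move=> m n mn; apply/subsetPset => t; rewrite /F/= !in_itv/= => /andP[h1 h2].
  have mn' : (m.+1%:R <= n.+1%:R :> R)%R by rewrite ler_nat.
  apply/andP; split.
    by apply: le_trans h1; rewrite ler_pXn2r ?nnegrE ?invr_ge0// lef_pV2 ?posrE.
  by apply: (le_trans h2); rewrite ler_pXn2r ?nnegrE.
have mF n : measurable (F n) by exact: measurable_itv.
have mE : measurable_fun setT (EFin \o shell_density s) by exact/measurable_EFinP.
have cv := @ge0_nondecreasing_set_cvg_integral _ _ R F (EFin \o shell_density s) L nd mF.
have {}cv := cv (fun n => measurable_funTS mE) (fun n t _ => shell_density_ge0 t s0).
apply: (cvge_to_le cv); near=> n => /=.
have n0 : (0 < n.+1%:R :> R)%R by [].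
have i1 : (n.+1%:R^-1 <= 1 :> R)%R by rewrite invf_le1// ler1n.
have i2 : (n.+1%:R^-1 <= n.+1%:R :> R)%R by rewrite (le_trans i1)// ler1n.
have csd : cont_on (n.+1%:R^-1 ^+ 2)%R (n.+1%:R ^+ 2)%R (shell_density s).
  move=> t /andP[+ _] => h; apply: cont_shell_density => [r _|]; first exact: cs.
  by apply: lt_le_trans h; rewrite exprn_gt0// invr_gt0.
have E := pint_shell_density (fun r _ => cs r) (_ : 0 < n.+1%:R^-1 :> R)%R i2.
rewrite /F -(fineK (integrable_fin_num _ (cont_on_integrable csd)))// lee_fin.
rewrite -[leLHS]/(pint _ _ (shell_density s)) E ?invr_gt0//.
apply: le_trans (sC n.+1%:R _) => //.
rewrite [leRHS](@pint_split _ _ n.+1%:R^-1)// ?invr_ge0//; last by move=> t _; exact: cs.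
rewrite lerDr pint_ge0// ?invr_ge0// => t /andP[+ _]; exact: s0.
Unshelve. all: by end_near. Qed.

Lemma ae_integral_section G s (t0 : R) : measurable_fun setT G ->
  (forall t : R, (0 < t)%R -> t != t0 ->
     \int[L]_(z in `[(- Num.sqrt t)%R, Num.sqrt t]) (G (t, z))%:E = (shell_density s t)%:E) ->
  {ae L, forall t, \int[L]_z (((EFin \o G) \_ under_parabola) (t, z)) = (shell_density s t)%:E}.
Proof.
move=> mG h; apply: (@ae_off_two t0) => t tn0 tt0.
rewrite (integral_under_parabola (EFin \o G)) (@le_eqVlt _ _ 0%R t) (eq_sym 0%R) (negbTE tn0)/=.
case: ifPn => [t_gt0|]; first exact: h.
by rewrite -leNgt => /(shell_density_le0 s) ->.
Qed.

(* [t0] is the squared radius of the shell on which [G] may be singular. *)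
Lemma shell_bound G s (t0 C : R) : measurable_fun setT G -> (forall q, 0 <= G q)%R ->
  continuous s -> (forall r, 0 <= r -> 0 <= s r)%R -> (forall x, 0 <= x -> pint 0 x s <= C)%R ->
  (forall t : R, (0 < t)%R -> t != t0 ->
     \int[L]_(z in `[(- Num.sqrt t)%R, Num.sqrt t]) (G (t, z))%:E <= (shell_density s t)%:E) ->
  \int[leb3 R]_p (G (sph p))%:E <= (disc_area * C)%:E.
Proof.
move=> mG G0 cs s0 sC h.
have mE : measurable_fun setT (EFin \o G) by exact/measurable_EFinP.
have E0 q : 0 <= (EFin \o G) q by rewrite lee_fin.
rewrite (ge0_integral_sph mE E0) EFinM; apply: lee_wpmul2l.
  by rewrite lee_fin ltW// disc_area_gt0.
rewrite integral_mkcond.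
have mc : measurable_fun setT ((EFin \o G) \_ under_parabola).
  apply/(measurable_restrictT _ measurable_under_parabola).
  exact: measurable_funTS.
have c0 q : 0 <= ((EFin \o G) \_ under_parabola) q by rewrite patchE; case: ifP.
rewrite (fubini_tonelli1 (m1 := L) (m2 := L) _ mc c0).
apply: le_trans (integral_shell_density_le cs s0 sC).
apply: ae_ge0_le_integral => //.
- by move=> t _; apply: integral_ge0.
- exact: measurable_fun_fubini_tonelli_F.
- by move=> t _; rewrite lee_fin; exact: shell_density_ge0.
- apply/measurable_EFinP; apply: measurable_shell_density => r _; exact: cs.
apply: (@ae_off_two t0) => t tn0 tt0 _.
rewrite /fubini_F (integral_under_parabola (EFin \o G)) (@le_eqVlt _ _ 0%R t) (eq_sym 0%R) (negbTE tn0)/=.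
case: ifPn => [t_gt0|]; first exact: h.
by rewrite -leNgt => /(shell_density_le0 s) ->.
Qed.

Lemma cvg_pint_shell_density s : continuous s ->
  L.-integrable `[0%R, +oo[ (EFin \o shell_density s) ->
  (fun x => pint 0 x s) @ +oo%R --> (\int[L]_(t in `[0%R, +oo[) shell_density s t)%R.
Proof.
move=> cs ish.
have E (x : R) : (0 < x)%R -> pint 0 (x ^+ 2)%R (shell_density s) = pint 0 x s.
  move=> x0; have x20 : (0 < x ^+ 2)%R by rewrite exprn_gt0.
  have ix : L.-integrable `[0%R, (x ^+ 2)%R] (EFin \o shell_density s).
    by apply: integrableS ish => //; apply: subset_itvl; rewrite bnd_simp.
  have c1 := parameterized_integral_cvg_left x20 ix.
  have c2 : (fun e => pint 0 (e ^+ 2)%R (shell_density s)) @ (0:R)^'+ --> (0:R)%R.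
    apply: cvg_comp c1; apply: cvg_at_right_filter.
    have : {for (0:R)%R, continuous (fun e : R => e ^+ 2)%R} by cont.
    by rewrite /prop_for /continuous_at expr0n.
  have c3 : (fun e => pint 0 e s) @ (0:R)^'+ --> (0:R)%R.
    apply: cvg_at_right_filter.
    apply: (parameterized_integral_cvg_left x0).
    by apply: cont_on_integrable => t _; exact: cs.
  have c4 : (fun e => pint 0 (x ^+ 2)%R (shell_density s) - pint 0 x s)%R @ (0:R)^'+ --> (0 - 0 : R)%R.
    apply: cvg_trans (cvgB c2 c3); apply: near_eq_cvg; near=> e.
    have e0 : (0 < e)%R by near: e; exact: nbhs_right_gt.
    have ex : (e <= x)%R by near: e; exact: nbhs_right_le.
    have := pint_shell_density (fun r _ => cs r) e0 ex.
    have -> : pint 0 x s = (pint 0 e s + pint e x s)%R.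
      by apply: (pint_split (ltW e0) ex) => t _; exact: cs.
    have -> : pint 0 (x ^+ 2)%R (shell_density s) =
       (pint 0 (e ^+ 2)%R (shell_density s) + pint (e ^+ 2)%R (x ^+ 2)%R (shell_density s))%R.
      have e2 : (0 <= e ^+ 2 :> R)%R by exact: sqr_ge0.
      have ex2 : (e ^+ 2 <= x ^+ 2)%R by rewrite ler_pXn2r// nnegrE ltW.
      have := @Rintegral_itvB R (shell_density s) (BLeft 0%R) (BRight (x ^+ 2)%R) (e ^+ 2)%R ix.
      rewrite !bnd_simp => /(_ e2 ex2).
      rewrite /pint (_ : \int[L]_(t in `](e ^+ 2)%R, (x ^+ 2)%R]) shell_density s t =
        \int[L]_(t in `[(e ^+ 2)%R, (x ^+ 2)%R]) shell_density s t)%R; first by lra.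
      rewrite /Rintegral; congr fine; rewrite integral_itv_obnd_cbnd//.
      by apply: measurable_funTS; apply/measurable_EFinP; apply: measurable_shell_density => r _; exact: cs.
    move=> ->.
    rewrite -[LHS]/(pint 0 (e ^+ 2)%R (shell_density s) - pint 0 e s)%R; ring.
  have E0 : (pint 0 (x ^+ 2) (shell_density s) - pint 0 x s = 0 - 0)%R.
    exact: (cvg_unique (@Rhausdorff R) (@cvg_cst _ _ _ _ _) c4).
  by apply/eqP; rewrite -subr_eq0 E0 subr0.
have c := cvg_pint_integral ish.
have c' : (fun x => pint 0 (x ^+ 2)%R (shell_density s)) @ +oo%R -->
    (\int[L]_(t in `[0%R, +oo[) shell_density s t)%R.
  apply: cvg_comp c; apply/cvgryPge => A; near=> x.
  have x1 : (1 <= x)%R by near: x; exact: nbhs_pinfty_ge.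
  have xA : (A <= x)%R by near: x; apply: nbhs_pinfty_ge; exact: num_real.
  by rewrite (le_trans xA)// expr2 ler_peMr// (le_trans ler01).
apply: cvg_trans c'; apply: near_eq_cvg; near=> x.
by rewrite E//; near: x; exact: nbhs_pinfty_gt.
Unshelve. all: by end_near. Qed.

(** Integrating [G] over the height first gives the density of [s], which inherits integrability
    from [G] by Fubini. A limit of segment integrals is the form in which the one-dimensional
    estimates are available. *)
Lemma shell_cvg G s (t0 : R) : measurable_fun setT G -> continuous s ->
  (leb3 R).-integrable setT (fun p => (G (sph p))%:E) ->
  (forall t : R, (0 < t)%R -> t != t0 ->
     \int[L]_(z in `[(- Num.sqrt t)%R, Num.sqrt t]) (G (t, z))%:E = (shell_density s t)%:E) ->
  (fun x => pint 0 x s) @ +oo%R -->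
    (disc_area^-1 * \int[leb3 R]_(p in setT) G (sph p))%R.
Proof.
move=> mG cs iG h.
have mE : measurable_fun setT (EFin \o G) by exact/measurable_EFinP.
have mc : measurable_fun setT ((EFin \o G) \_ under_parabola).
  apply/(measurable_restrictT _ measurable_under_parabola).
  exact: measurable_funTS.
have k0 := @disc_area_gt0 R.
have ic : (L \x L).-integrable setT ((EFin \o G) \_ under_parabola).
  apply/integrableP; split; first exact: mc.
  move/integrableP: iG => [_].
  rewrite (ge0_integral_sph (G := fun q => `|(G q)%:E|))//; last first.
    exact: measurableT_comp.
  move=> hfin.
  have -> : \int[L \x L]_x `|((EFin \o G) \_ under_parabola) x| =
      \int[L \x L]_(q in under_parabola) `|(G q)%:E|.
    rewrite [RHS]integral_mkcond; apply: eq_integral => q _; rewrite !patchE.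
    by case: ifP => // _; rewrite abse0.
  move: hfin; set I := (X in _ * X < _); have : 0 <= I by apply: integral_ge0.
  move=> I0 hI; change (I < +oo); clearbody I; move: I I0 hI => [r _ _| _|//].
    by rewrite ltry.
  by rewrite mulry gtr0_sg// mul1e.
have msd : measurable_fun setT (EFin \o shell_density s).
  by apply/measurable_EFinP; apply: measurable_shell_density => r _; exact: cs.
have aeF : ae_eq L setT (fubini_F L ((EFin \o G) \_ under_parabola)) (EFin \o shell_density s).
  have := ae_integral_section mG h.
  by apply: filterS => t Et _.
have iF := integrable_fubini_F (m1 := L) (m2 := L) ic.
have isd : L.-integrable setT (EFin \o shell_density s).
  apply/integrableP; split; first exact: msd.
  move/integrableP: iF => [mF].
  rewrite (@ae_eq_integral _ _ _ L setT (fun t => `|(EFin \o shell_density s) t|))//.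
  - exact: measurableT_comp.
  - exact: measurableT_comp.
  - by apply: filterS aeF => t Et _; rewrite Et.
have Eint : (\int[L]_(t in `[0%R, +oo[) shell_density s t =
    disc_area^-1 * \int[leb3 R]_(p in setT) G (sph p))%R.
  have E1 : \int[L \x L]_(q in under_parabola) (G q)%:E =
      \int[L]_t fubini_F L ((EFin \o G) \_ under_parabola) t.
    by rewrite (integral12_prod_meas1 (m1 := L) (m2 := L) ic) [LHS]integral_mkcond.
  have E := integral_sph mG iG.
  have E2 : \int[L]_t fubini_F L ((EFin \o G) \_ under_parabola) t =
      \int[L]_t (shell_density s t)%:E.
    by apply: ae_eq_integral => //; exact: measurable_int iF.
  rewrite E1 E2 in E.
  rewrite {2}/Rintegral E fineM//; last exact: integrable_fin_num.
  rewrite mulrA mulVf ?gt_eqF// mul1r /Rintegral; congr fine.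
  rewrite [LHS]integral_mkcond; apply: eq_integral => t _.
  rewrite patchE; case: ifPn => //; rewrite notin_setE/= in_itv/= andbT => /negP.
  by rewrite -ltNge => /ltW/(shell_density_le0 s) ->.
rewrite -Eint; apply: cvg_pint_shell_density => //.
exact: integrableS isd.
Qed.

End ShellIntegral.

(** * Radial functions and rotations *)

Section Radial.
Context {R : realType}.
Implicit Types (v w : 'rV[R]_3) (f : 'rV[R]_3 -> R) (a b : R -> R).

Definition axis3 : 'rV[R]_3 := delta_mx 0 ord_max.

Lemma sum3 (F : 'I_3 -> R) : \sum_(i < 3) F i = F ord0 + F (lift ord0 ord0) + F ord_max.
Proof.
rewrite !big_ord_recl big_ord0 addr0 addrA; congr (_ + F _).
exact: val_inj.
Qed.

Lemma enorm_ge0 v : 0 <= enorm v. Proof. exact: sqrtr_ge0. Qed.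

Lemma sqr_enorm v : enorm v ^+ 2 = \sum_(i < 3) v 0 i ^+ 2.
Proof. by rewrite sqr_sqrtr// sumr_ge0// => i _; exact: sqr_ge0. Qed.

Lemma enorm_eq0 v : (enorm v == 0) = (v == 0).
Proof.
apply/idP/eqP => [/eqP v0|->]; last first.
  by rewrite /enorm big1 ?sqrtr0// => i _; rewrite mxE expr0n.
have : \sum_(i < 3) v 0 i ^+ 2 = 0 by rewrite -sqr_enorm v0 expr0n.
move=> /psumr_eq0P h; apply/rowP => i; rewrite mxE.
by apply/eqP; rewrite -sqrf_eq0 h// => j _; exact: sqr_ge0.
Qed.

Lemma enorm0 : enorm (0 : 'rV[R]_3) = 0.
Proof. by apply/eqP; rewrite enorm_eq0. Qed.

Lemma enorm_gt0 v : (0 < enorm v) = (v != 0).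
Proof. by rewrite lt_def enorm_ge0 andbT enorm_eq0. Qed.

Lemma enorm_add_delta i v (h : R) :
  enorm (h *: delta_mx 0 i + v) = Num.sqrt (enorm v ^+ 2 + 2 * h * v 0 i + h ^+ 2).
Proof.
rewrite sqr_enorm /enorm; congr Num.sqrt.
rewrite (bigD1 i)//= [in RHS](bigD1 i)//= !mxE !eqxx/=.
rewrite (eq_bigr (fun j => v 0 j ^+ 2)) => [|j ji]; first by ring.
by rewrite !mxE (negbTE ji) andbF mulr0 add0r.
Qed.

Lemma enorm_scale_delta i (h : R) : enorm (h *: delta_mx 0 i : 'rV[R]_3) = `|h|.
Proof.
have := enorm_add_delta i 0 h.
by rewrite addr0 enorm0 expr0n mxE mulr0 !add0r sqrtr_sqr.
Qed.

Lemma enorm_axis3 (r : R) : enorm (r *: axis3) = `|r|.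
Proof. exact: enorm_scale_delta. Qed.

Lemma is_derive_partial i f v (l : R) :
  is_derive (0 : R) 1 (fun h => f (h *: delta_mx 0 i + v)) l ->
  is_derive v (delta_mx 0 i) f l.
Proof.
move=> d.
have E : (fun h : R => h^-1 *: ((f \o shift v) (h *: delta_mx 0 i) - f v)) =
  (fun h : R => h^-1 *: (((fun h => f (h *: delta_mx 0 i + v)) \o shift 0) (h *: 1) -
     (fun h => f (h *: delta_mx 0 i + v)) 0)).
  by apply/funext => h /=; rewrite addr0 scale0r add0r scaler1.
have [dd e] := d; split; first by rewrite /derivable E.
by rewrite -e /derive E.
Qed.

Lemma is_derive_along i f v (x : R) : derivable f (x *: delta_mx 0 i + v) (delta_mx 0 i) ->
  is_derive x 1 (fun h => f (h *: delta_mx 0 i + v)) (partial i f (x *: delta_mx 0 i + v)).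
Proof.
move=> d.
have E : (fun h : R => h^-1 *: (((fun h => f (h *: delta_mx 0 i + v)) \o shift x) (h *: 1) -
     (fun h => f (h *: delta_mx 0 i + v)) x)) =
  (fun h : R => h^-1 *: ((f \o shift (x *: delta_mx 0 i + v)) (h *: delta_mx 0 i) - f (x *: delta_mx 0 i + v))).
  by apply/funext => h /=; rewrite scaler1 scalerDl addrA.
by split; rewrite /partial /derivable /derive E.
Qed.

Lemma der_enorm i v : v != 0 ->
  is_derive (0 : R) 1 (fun h => enorm (h *: delta_mx 0 i + v)) (v 0 i / enorm v).
Proof.
move=> v0; have n0 : 0 < enorm v by rewrite enorm_gt0.
have -> : (fun h => enorm (h *: delta_mx 0 i + v)) =
   (fun h => Num.sqrt (enorm v ^+ 2 + 2 * h * v 0 i + h ^+ 2)).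
  by apply/funext => h; rewrite enorm_add_delta.
set x := v 0 i; set N := enorm v in n0 *.
have d1 : is_derive (0 : R) 1 (fun h : R => N ^+ 2 + 2 * h * x + h ^+ 2) (2 * x).
  by dere; rewrite /=; ring.
have e0 : N ^+ 2 + 2 * 0 * x + 0 ^+ 2 = N ^+ 2 by ring.
have d2 : is_derive (N ^+ 2 + 2 * 0 * x + 0 ^+ 2) 1 Num.sqrt (2 * N)^-1.
  have := @is_derive1_sqrt R (N ^+ 2 + 2 * 0 * x + 0 ^+ 2).
  by rewrite e0 sqrtr_sqr gtr0_norm// exprn_gt0// => /(_ isT).
have -> : x / N = (2 * N)^-1 * (2 * x) by field; rewrite gt_eqF.
exact: (@is_derive1_comp R Num.sqrt (fun h : R => N ^+ 2 + 2 * h * x + h ^+ 2) 0 _ _ d2 d1).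
Qed.

(* [a] is even and differentiable on the whole line, so that it stays regular at the origin. *)
Definition profile f a (a1 : R -> R) :=
  [/\ forall v, f v = a (enorm v), forall x : R, is_derive x 1 a (a1 x) &
      forall x : R, a (- x) = a x].

Lemma even_der0 a a1 : (forall x : R, is_derive x 1 a (a1 x)) ->
  (forall x : R, a (- x) = a x) -> a1 0 = 0.
Proof.
move=> da ea.
have dN : is_derive (0 : R) 1 (fun x : R => - x) (-1) by dere.
have := @is_derive1_comp R a (fun x => - x) 0 (a1 0) (-1).
rewrite oppr0 => /(_ (da 0) dN) d.
have E : a \o (fun x => - x) = a by apply/funext => x /=; rewrite ea.
rewrite E in d; have [_ e1] := d; have [_ e2] := da 0.
by move: e1; rewrite e2 /GRing.scale/=; lra.
Qed.

Lemma profile_partial f a a1 i v : profile f a a1 ->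
  partial i f v = a1 (enorm v) * (v 0 i / enorm v).
Proof.
move=> [fa da ea].
(* At the origin the right-hand side is 0 because division by 0 gives 0, and the partial derivative
   is 0 because [a] is even. *)
have [->|v0] := eqVneq v 0.
  rewrite enorm0 mxE mul0r mulr0.
  have d0 : is_derive (0 : R) 1 (fun h => f (h *: delta_mx 0 i + 0)) 0.
    have -> : (fun h => f (h *: delta_mx 0 i + 0)) = a.
      apply/funext => h; rewrite addr0 fa enorm_scale_delta.
      by have [h0|h0] := leP 0 h; rewrite ?(ger0_norm h0) ?(ltr0_norm h0).
    by have := da 0; rewrite (even_der0 da ea).
  by have [_ e] := is_derive_partial d0; exact: e.
have d := der_enorm i v0.
have e0 : (fun h : R => enorm (h *: delta_mx 0 i + v)) 0 = enorm v by rewrite /= scale0r add0r.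
have d1 := @is_derive1_comp R a (fun h => enorm (h *: delta_mx 0 i + v)) 0 (a1 (enorm v)) _ _ d.
rewrite e0 in d1.
have {}d1 := d1 (da _).
have d2 : is_derive (0 : R) 1 (fun h => f (h *: delta_mx 0 i + v)) ((a1 (enorm v)) * (v 0 i / enorm v)).
  have -> : (fun h => f (h *: delta_mx 0 i + v)) = a \o (fun h => enorm (h *: delta_mx 0 i + v)).
    by apply/funext => h /=; rewrite fa.
  exact: d1.
by have [_ e] := is_derive_partial d2; exact: e.
Qed.

Lemma profile_grad_sqr f a a1 v : profile f a a1 -> grad_sqr f v = a1 (enorm v) ^+ 2.
Proof.
move=> pf; rewrite /grad_sqr.
under eq_bigr => i _ do rewrite (profile_partial i v pf) exprMn exprMn.
rewrite -mulr_sumr -mulr_suml -sqr_enorm.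
have [v0|v0] := eqVneq (enorm v) 0.
  case: pf => fa da ea.
  by rewrite v0 (even_der0 da ea) expr0n mul0r.
by rewrite exprVn mulfV ?mulr1// expf_neq0.
Qed.

Lemma radial_profile f : C1 f -> radial f ->
  profile f (fun t => f (t *: axis3)) (fun t => partial ord_max f (t *: axis3)).
Proof.
move=> [cf df] rf; split.
- by move=> v; apply: rf; rewrite enorm_axis3 ger0_norm ?enorm_ge0.
- move=> x; have := @is_derive_along ord_max f 0 x.
  rewrite addr0 => /(_ ((df ord_max).1 _)).
  by congr (is_derive _ _ _ _); apply/funext => h; rewrite addr0.
- by move=> x; apply: rf; rewrite !enorm_axis3 normrN.
Qed.

(** Derivatives at [v] see only points near [v], so the radial form is needed off the origin
    alone. *)
Lemma divergence_radial (F : 'I_3 -> 'rV[R]_3 -> R) (J : R -> R) (J1 : R) v : v != 0 ->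
  (forall i w, w != 0 -> F i w = J (enorm w) * (w 0 i / enorm w)) ->
  is_derive (enorm v) 1 J J1 ->
  \sum_(i < 3) partial i (F i) v = J1 + 2 * J (enorm v) / enorm v.
Proof.
move=> v0 FE dJ; have n0 : 0 < enorm v by rewrite enorm_gt0.
have dp i : partial i (F i) v =
   (J1 / enorm v - J (enorm v) / enorm v ^+ 2) * (v 0 i / enorm v) * v 0 i + J (enorm v) / enorm v.
  pose n h := enorm (h *: delta_mx 0 i + v).
  have n0E : n 0 = enorm v by rewrite /n scale0r add0r.
  have dn : is_derive (0:R) 1 n (v 0 i / enorm v) by exact: der_enorm.
  have dJn : is_derive (0:R) 1 (J \o n) (J1 * (v 0 i / enorm v)).
    by have := @is_derive1_comp R J n 0 J1 (v 0 i / enorm v); rewrite n0E => /(_ dJ dn).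
  have dG : is_derive (0 : R) 1 (fun h => (J \o n) h * ((h + v 0 i) * (n h)^-1))
     ((J1 / enorm v - J (enorm v) / enorm v ^+ 2) * (v 0 i / enorm v) * v 0 i + J (enorm v) / enorm v).
    have nz : n 0 != 0 by rewrite n0E gt_eqF.
    dere; rewrite /= n0E; first by rewrite gt_eqF.
    by field; rewrite gt_eqF.
  have dF : is_derive (0 : R) 1 (fun h => F i (h *: delta_mx 0 i + v))
     ((J1 / enorm v - J (enorm v) / enorm v ^+ 2) * (v 0 i / enorm v) * v 0 i + J (enorm v) / enorm v).
    apply: der_near dG.
    have cn : {for (0:R), continuous n} by exact: (der_cont dn).
    have : \forall h \near (0:R), 0 < n h.
      have h0 : 0 < n 0 by rewrite n0E.
      exact: (@cvgr_gt R R (nbhs (0:R)) _ n (n 0) cn 0 h0).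
    apply: filterS => h nh; rewrite FE; last by rewrite -enorm_gt0.
    by rewrite !mxE !eqxx/= mulr1.
  by have [_ e] := is_derive_partial dF; exact: e.
rewrite (eq_bigr _ (fun i _ => dp i)) big_split/= sumr_const card_ord.
rewrite (eq_bigr (fun i => (J1 / enorm v - J (enorm v) / enorm v ^+ 2) / enorm v * v 0 i ^+ 2)); last first.
  by move=> i _; rewrite expr2; ring.
rewrite -mulr_sumr -sqr_enorm -mulr_natr.
by field; rewrite gt_eqF.
Qed.

End Radial.

(** * Measure-preserving rotations *)

Section Rotations.
Context {R : realType}.
Notation mR := (measurableTypeR R).
Notation L := (@lebesgue_measure R).
Implicit Types (v w : 'rV[R]_3) (f : 'rV[R]_3 -> R).

Definition preserves3 (T : mR * mR * mR -> mR * mR * mR) := measurable_fun setT T /\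
  forall g : mR * mR * mR -> \bar R, measurable_fun setT g -> (forall x, 0 <= g x)%E ->
  (\int[leb3 R]_x g (T x) = \int[leb3 R]_x g x)%E.

Lemma preserves3_comp T S : preserves3 T -> preserves3 S ->
  preserves3 (fun x => T (S x)).
Proof.
move=> [mT hT] [mS hS]; split; first exact: (measurableT_comp mT mS).
move=> g mg g0.
rewrite (hS (fun x => g (T x)))//; first exact: hT.
exact: (measurableT_comp mg mT).
Qed.

Lemma preserves3_12 T : preserves2 T ->
  preserves3 (fun p : mR * mR * mR => (T p.1, p.2)).
Proof.
move=> [mT hT].
have mS : measurable_fun setT (fun p : mR * mR * mR => (T p.1, p.2)).
  apply/measurable_fun_pairP; split => /=; last exact: measurable_snd.
  exact: (measurableT_comp mT measurable_fst).
split=> // g mg g0.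
rewrite (ge0_integral_leb3 (measurableT_comp mg mS) (fun x => g0 _)) (ge0_integral_leb3 mg g0).
apply: eq_integral => z _ /=.
apply: (hT (fun q => g (q, z))) => //.
exact: (measurableT_comp mg (measurable_pair2 z)).
Qed.

Lemma preserves3_23 T : preserves2 T ->
  preserves3 (fun p : mR * mR * mR => ((p.1.1, (T (p.1.2, p.2)).1), (T (p.1.2, p.2)).2)).
Proof.
move=> [mT hT].
have m0 : measurable_fun setT (fun p : mR * mR * mR => T (p.1.2, p.2)).
  apply: (measurableT_comp mT).
  apply/measurable_fun_pairP; split => /=; last exact: measurable_snd.
  exact: (measurableT_comp measurable_snd measurable_fst).
have mS : measurable_fun setT (fun p : mR * mR * mR => ((p.1.1, (T (p.1.2, p.2)).1), (T (p.1.2, p.2)).2)).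
  apply/measurable_fun_pairP; split => /=; last exact: (measurableT_comp measurable_snd m0).
  apply/measurable_fun_pairP; split => /=; last exact: (measurableT_comp measurable_fst m0).
  exact: (measurableT_comp measurable_fst measurable_fst).
split=> // g mg g0.
rewrite (ge0_integral_leb3_assoc (measurableT_comp mg mS) (fun x => g0 _)) (ge0_integral_leb3_assoc mg g0).
apply: eq_integral => x _ /=.
have E : (\int[L \x L]_q g ((x, (T q).1), (T q).2) = \int[L \x L]_q g ((x, q.1), q.2))%E.
  apply: (hT (fun q => g ((x, q.1), q.2))) => //.
  apply: (measurableT_comp mg); apply/measurable_fun_pairP; split => /=; last exact: measurable_snd.
  by apply/measurable_fun_pairP; split => /=; [exact: measurable_cst|exact: measurable_fst].
by rewrite -E; apply: eq_integral => -[y z] _.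
Qed.

Definition vdot v w : R := \sum_(i < 3) v 0 i * w 0 i.

Lemma vdotvv v : vdot v v = enorm v ^+ 2.
Proof. by rewrite sqr_enorm; apply: eq_bigr => i _; rewrite expr2. Qed.

(** Linearity and invariance of [vdot] make the Coulomb kernel equivariant; [T] carries the
    invariance of the integral, which lives on triples. *)
Definition rigid3 (phi : 'rV[R]_3 -> 'rV[R]_3) :=
  [/\ forall (a : R) v w, phi (a *: v + w) = a *: phi v + phi w,
      forall v w, vdot (phi v) (phi w) = vdot v w &
      exists2 T, preserves3 T & forall p, vec3 (T p) = phi (vec3 p)].

Lemma rigid3_comp phi psi : rigid3 phi -> rigid3 psi -> rigid3 (phi \o psi).
Proof.
move=> [l1 d1 [T1 p1 e1]] [l2 d2 [T2 p2 e2]]; split.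
- by move=> a v w /=; rewrite l2 l1.
- by move=> v w /=; rewrite d1 d2.
- by exists (fun p => T1 (T2 p)); [exact: preserves3_comp|move=> p /=; rewrite e1 e2].
Qed.

Lemma rigid3Z phi (a : R) v : rigid3 phi -> phi (a *: v) = a *: phi v.
Proof.
move=> [l _ _]; have l0 : phi 0 = 0.
  by have := l 1 0 0; rewrite !scale1r add0r => /eqP; rewrite -subr_eq subrr => /eqP.
by have := l a v 0; rewrite !addr0 l0 addr0.
Qed.

Lemma rigid3B phi v w : rigid3 phi -> phi (v - w) = phi v - phi w.
Proof.
move=> rp; have [l _ _] := rp.
have := l 1 v (- w); rewrite !scale1r => ->.
by rewrite -scaleN1r (rigid3Z _ _ rp) scaleN1r.
Qed.

Lemma enorm_rigid3 phi v : rigid3 phi -> enorm (phi v) = enorm v.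
Proof.
move=> [_ d _]; apply/eqP.
by rewrite -(@eqrXn2 _ 2)// ?enorm_ge0// -!vdotvv d.
Qed.

Lemma Rintegral_preserves3 T (F : mR * mR * mR -> R) : preserves3 T -> measurable_fun setT F ->
  \int[leb3 R]_p F (T p) = \int[leb3 R]_p F p.
Proof.
move=> [mT hT] mF; rewrite /Rintegral; congr fine.
have mE : measurable_fun setT (EFin \o F) by exact/measurable_EFinP.
rewrite integralE [RHS]integralE; congr (_ - _)%E.
- rewrite -[RHS](hT _ (measurable_funepos mE) (fun x => funepos_ge0 _ x)).
  by apply: eq_integral => p _; rewrite !funeposE.
- rewrite -[RHS](hT _ (measurable_funeneg mE) (fun x => funeneg_ge0 _ x)).
  by apply: eq_integral => p _; rewrite !funenegE.
Qed.

Lemma int3_rigid f phi : rigid3 phi -> measurable3 f -> int3 (f \o phi) = int3 f.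
Proof.
move=> [_ _ [T pT eT]] mf.
rewrite /int3 -(Rintegral_preserves3 pT mf).
by apply: eq_Rintegral => p _ /=; rewrite eT.
Qed.

Definition givens12 (c s : R) v : 'rV[R]_3 :=
  \row_(i < 3) [:: c * v 0 ord0 - s * v 0 (lift ord0 ord0);
                  s * v 0 ord0 + c * v 0 (lift ord0 ord0); v 0 ord_max]`_i.

Definition givens23 (c s : R) v : 'rV[R]_3 :=
  \row_(i < 3) [:: v 0 ord0; c * v 0 (lift ord0 ord0) - s * v 0 ord_max;
                  s * v 0 (lift ord0 ord0) + c * v 0 ord_max]`_i.

Lemma row3P v w : v 0 ord0 = w 0 ord0 -> v 0 (lift ord0 ord0) = w 0 (lift ord0 ord0) ->
  v 0 ord_max = w 0 ord_max -> v = w.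
Proof.
move=> h0 h1 h2; apply/rowP => -[[|[|[|//]]] i3].
- by rewrite (_ : Ordinal i3 = ord0)//; exact: val_inj.
- by rewrite (_ : Ordinal i3 = lift ord0 ord0)//; exact: val_inj.
- by rewrite (_ : Ordinal i3 = ord_max)//; exact: val_inj.
Qed.

Lemma rigid3_givens12 (c s : R) : c ^+ 2 + s ^+ 2 = 1 -> rigid3 (givens12 c s).
Proof.
move=> cs; split.
- by move=> a v w; apply: row3P; rewrite !mxE/=; ring.
- move=> v w; rewrite /vdot !sum3 !mxE/=.
  transitivity ((c ^+ 2 + s ^+ 2) * (v 0 ord0 * w 0 ord0 +
    v 0 (lift ord0 ord0) * w 0 (lift ord0 ord0)) + v 0 ord_max * w 0 ord_max); first by ring.
  by rewrite cs mul1r.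
- exists (fun p => (((c * p.1.1 - s * p.1.2 : R)%R : mR, (s * p.1.1 + c * p.1.2 : R)%R : mR), p.2)).
    exact: (preserves3_12 (preserves2_rot cs)).
  by move=> p; apply: row3P; rewrite !mxE/= ?mxE.
Qed.

Lemma rigid3_givens23 (c s : R) : c ^+ 2 + s ^+ 2 = 1 -> rigid3 (givens23 c s).
Proof.
move=> cs; split.
- by move=> a v w; apply: row3P; rewrite !mxE/=; ring.
- move=> v w; rewrite /vdot !sum3 !mxE/=.
  transitivity (v 0 ord0 * w 0 ord0 + (c ^+ 2 + s ^+ 2) * (v 0 (lift ord0 ord0) * w 0 (lift ord0 ord0) +
    v 0 ord_max * w 0 ord_max)); first by ring.
  by rewrite cs mul1r; ring.
- exists (fun p => ((p.1.1, (c * p.1.2 - s * p.2 : R)%R : mR), (s * p.1.2 + c * p.2 : R)%R : mR)).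
    exact: (preserves3_23 (preserves2_rot cs)).
  by move=> p; apply: row3P; rewrite !mxE/= ?mxE.
Qed.

(** [givens23] tilts the axis to the latitude of [v] and [givens12] turns it to the longitude; if
    [v] lies on the axis, then [q = 0] and the longitude is arbitrary. *)
Lemma rigid3_axis v : v != 0 -> exists2 phi, rigid3 phi & phi (enorm v *: axis3) = v.
Proof.
move=> v0; have r0 : enorm v != 0 by rewrite enorm_eq0.
set x := v 0 ord0; set y := v 0 (lift ord0 ord0); set z := v 0 ord_max.
have rE : enorm v ^+ 2 = x ^+ 2 + y ^+ 2 + z ^+ 2 by rewrite sqr_enorm sum3.
set r := enorm v in r0 rE *; pose q := Num.sqrt (x ^+ 2 + y ^+ 2).
have qE : q ^+ 2 = x ^+ 2 + y ^+ 2 by rewrite sqr_sqrtr// addr_ge0 ?sqr_ge0.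
have h23 : (z / r) ^+ 2 + (- (q / r)) ^+ 2 = 1.
  have r2 : r ^+ 2 != 0 by rewrite expf_neq0.
  by rewrite sqrrN !exprMn -mulrDl qE addrC exprVn -rE mulfV.
have [c [s [h12 cq sq]]] : exists c s : R, [/\ c ^+ 2 + s ^+ 2 = 1, c * q = y & s * q = - x].
  have [q0|q0] := eqVneq q 0.
    exists 1, 0; rewrite q0 !mulr0 expr1n expr0n addr0.
    have : x ^+ 2 + y ^+ 2 = 0 by rewrite -qE q0 expr0n.
    move/eqP; rewrite paddr_eq0 ?sqr_ge0// !sqrf_eq0 => /andP[/eqP-> /eqP->].
    by rewrite oppr0.
  exists (y / q), (- x / q); split; rewrite ?divfK//.
  have q2 : q ^+ 2 != 0 by rewrite expf_neq0.
  by rewrite !exprMn sqrrN -mulrDl addrC -qE exprVn mulfV.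
exists (givens12 c s \o givens23 (z / r) (- (q / r))).
  exact: rigid3_comp (rigid3_givens12 h12) (rigid3_givens23 h23).
have e01 : (ord0 : 'I_3) == ord_max = false by [].
have e02 : (lift ord0 ord0 : 'I_3) == ord_max = false by [].
apply: row3P; rewrite /givens12 /givens23 /= !mxE/= ?mxE ?eqxx ?e01 ?e02 /=.
- transitivity (- (s * (q / r * r))); first by ring.
  by rewrite divfK// sq opprK.
- transitivity (c * (q / r * r)); first by ring.
  by rewrite divfK.
- transitivity (z / r * r); first by ring.
  by rewrite divfK.
Qed.

End Rotations.

(** * The Coulomb flux of radial functions *)

Section Kernel.
Context {R : realType}.
Notation mR := (measurableTypeR R).
Notation L := (@lebesgue_measure R).
Implicit Types (u v w : 'rV[R]_3).

(** The Coulomb matrix at [u] applied to [v]: the part of [v] orthogonal to [u], divided by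
    [8 * pi * enorm u]. *)
Definition kvec u v : 'rV[R]_3 :=
  ((8 * pi)^-1 / enorm u) *: (v - (vdot u v / enorm u ^+ 2) *: u).

Lemma kvecE u v i : kvec u v 0 i =
  (8 * pi)^-1 / enorm u * (v 0 i - vdot u v / enorm u ^+ 2 * u 0 i).
Proof. by rewrite /kvec !mxE. Qed.

Lemma sum_kernel i u v : \sum_(j < 3) coulomb_kernel i j u * v 0 j = kvec u v 0 i.
Proof.
rewrite kvecE /coulomb_kernel.
rewrite (eq_bigr (fun j => ((8 * pi)^-1 / enorm u) * ((i == j)%:R * v 0 j) -
   ((8 * pi)^-1 / enorm u) * (u 0 i / enorm u ^+ 2) * (u 0 j * v 0 j))); last first.
  by move=> j _; ring.
rewrite big_split/= sumrN -!mulr_sumr -/(vdot u v).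
rewrite (bigD1 i)//= eqxx mul1r big1 ?addr0; first by ring.
by move=> j ji; rewrite eq_sym (negbTE ji) mul0r.
Qed.

Lemma kvec_id u : kvec u u = 0.
Proof.
have [->|u0] := eqVneq u 0; first by rewrite /kvec scaler0 subrr scaler0.
rewrite /kvec vdotvv divff ?scale1r ?subrr ?scaler0//.
by rewrite expf_neq0// enorm_eq0.
Qed.

Lemma vdot_linearr u (x y : R) v w : vdot u (x *: v + y *: w) = x * vdot u v + y * vdot u w.
Proof.
rewrite /vdot !mulr_sumr -big_split/=; apply: eq_bigr => i _.
by rewrite !mxE; ring.
Qed.

(** The kernel at [v - w] annihilates [v - w]. For radial functions the gradients at [v] and [w] are
    multiples of [v] and [w], so the flux only involves the kernel applied to [v]. *)
Lemma kvec_shift (x y : R) v w : kvec (v - w) (x *: v - y *: w) = (x - y) *: kvec (v - w) v.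
Proof.
have -> : x *: v - y *: w = (x - y) *: v + y *: (v - w).
  by rewrite scalerBl scalerBr addrA subrK.
have E := kvec_id (v - w); move: (v - w) E => u E.
rewrite /kvec vdot_linearr.
transitivity ((x - y) *: kvec u v + y *: kvec u u); last by rewrite E scaler0 addr0.
rewrite /kvec; apply/rowP => i; rewrite !mxE; ring.
Qed.

Lemma kvec_rigid phi u v : rigid3 phi -> kvec (phi u) (phi v) = phi (kvec u v).
Proof.
move=> rp; have [_ d _] := rp.
by rewrite /kvec d (enorm_rigid3 _ rp) -!(rigid3Z _ _ rp) -(rigid3B _ _ rp) (rigid3Z _ _ rp).
Qed.

Definition dist (r t z : R) : R := Num.sqrt (t + r ^+ 2 - 2 * r * z).

Lemma enorm_vec3 (p : mR * mR * mR) : enorm (vec3 p) = Num.sqrt (sph p).1.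
Proof. by rewrite /enorm sum3 !mxE. Qed.

Lemma enorm_axis_sub (r : R) (p : mR * mR * mR) :
  enorm (r *: axis3 - vec3 p) = dist r (sph p).1 (sph p).2.
Proof.
rewrite /enorm /dist sum3 !mxE/= ?eqxx /rho2/=; congr Num.sqrt; ring.
Qed.

Lemma vdot_axis_sub (r : R) (p : mR * mR * mR) :
  vdot (r *: axis3 - vec3 p) (r *: axis3) = r * (r - p.2).
Proof.
rewrite /vdot sum3 !mxE/= ?eqxx/=; ring.
Qed.

Lemma kvec_axis01 (r : R) (p : mR * mR * mR) (i : 'I_3) : i != ord_max ->
  kvec (r *: axis3 - vec3 p) (r *: axis3) 0 i =
  (8 * pi)^-1 * r * (vec3 p 0 i * (r - p.2)) / dist r (sph p).1 (sph p).2 ^+ 3.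
Proof.
move=> /negbTE i3; rewrite kvecE vdot_axis_sub enorm_axis_sub.
have e : (r *: axis3) 0 i = 0 by rewrite !mxE i3 andbF mulr0.
have -> : (r *: axis3 - vec3 p) 0 i = - vec3 p 0 i by rewrite mxE e add0r [LHS]mxE.
rewrite e.
move: ((8 * pi)^-1) (vec3 p 0 i : R) (p.2 : R) (dist _ _ _) => k x z D.
have [->|D0] := eqVneq D 0; first by rewrite !expr0n/= !invr0; ring.
by field.
Qed.

Lemma kvec_axis3 (r : R) (p : mR * mR * mR) :
  kvec (r *: axis3 - vec3 p) (r *: axis3) 0 ord_max =
  (8 * pi)^-1 * r * ((sph p).1 - (sph p).2 ^+ 2) / dist r (sph p).1 (sph p).2 ^+ 3.
Proof.
rewrite kvecE vdot_axis_sub enorm_axis_sub.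
have -> : (r *: axis3) 0 ord_max = r by rewrite !mxE /= mulr1.
have -> : (r *: axis3 - vec3 p) 0 ord_max = r - (sph p).2 by rewrite !mxE /= mulr1.
have -> : p.2 = (sph p).2 by [].
have DE : dist r (sph p).1 (sph p).2 ^+ 2 = (sph p).1 + r ^+ 2 - 2 * r * (sph p).2.
  by rewrite -enorm_axis_sub sqr_enorm sum3 !mxE/= /rho2; ring.
have E : (sph p).1 - (sph p).2 ^+ 2 = dist r (sph p).1 (sph p).2 ^+ 2 - (r - (sph p).2) ^+ 2.
  by rewrite DE; ring.
rewrite E; move: (dist _ _ _) => D.
set k := (8 * pi)^-1.
have [->|D0] := eqVneq D 0; first by rewrite !expr0n/= !invr0; ring.
by field.
Qed.

Lemma kvec_axis_le (r : R) (p : mR * mR * mR) (i : 'I_3) : 0 < r ->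
  `|kvec (r *: axis3 - vec3 p) (r *: axis3) 0 i| <=
  2 * (8 * pi)^-1 * r / dist r (sph p).1 (sph p).2.
Proof.
move=> r0; have k0 : 0 <= (8 * pi)^-1 :> R by rewrite invr_ge0 mulr_ge0// pi_ge0.
have d0 := enorm_ge0 (r *: axis3 - vec3 p).
rewrite -enorm_axis_sub; set u := r *: axis3 - vec3 p in d0 *.
have vE : vdot u (r *: axis3) = r * u 0 ord_max.
  by rewrite /vdot sum3 !mxE/= !mulr0 !add0r !mulr1 mulrC.
rewrite kvecE vE normrM normrM (ger0_norm k0) ger0_norm ?invr_ge0//.
have -> : 2 * (8 * pi)^-1 * r / enorm u = (8 * pi)^-1 / enorm u * (r * 2) by ring.
apply: ler_wpM2l; first by rewrite mulr_ge0// invr_ge0.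
have [u0|u0] := eqVneq (enorm u ^+ 2) 0.
  rewrite u0 invr0 mulr0 mul0r subr0 !mxE normrM gtr0_norm//=.
  by case: (i == _) => /=; rewrite ?normr1 ?normr0; move: r0; clear; lra.
have h : `|u 0 i * u 0 ord_max| <= enorm u ^+ 2.
  have hi j : u 0 j ^+ 2 <= enorm u ^+ 2.
    by rewrite sqr_enorm (bigD1 j)//= lerDl sumr_ge0// => k _; exact: sqr_ge0.
  have := hi i; have := hi ord_max; clear; set a := u 0 i; set b := u 0 ord_max.
  by rewrite ler_norml => h1 h2; apply/andP; split; have := sqr_ge0 (a - b); have := sqr_ge0 (a + b); nra.
have p0 : 0 < enorm u ^+ 2 by rewrite lt_def u0 sqr_ge0.
apply: (le_trans (ler_normB _ _)).
have -> : r * 2 = r + r by ring.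
apply: lerD.
  by rewrite !mxE normrM gtr0_norm//; case: (i == _) => /=; rewrite ?normr1 ?normr0; move: r0; clear; lra.
have -> : r * u 0 ord_max / enorm u ^+ 2 * u 0 i = r * ((u 0 i * u 0 ord_max) / enorm u ^+ 2).
  by ring.
rewrite normrM gtr0_norm// ger_pMr// normrM [`|_^-1|]ger0_norm ?invr_ge0 ?(ltW p0)//.
by rewrite ler_pdivrMr ?mul1r.
Qed.

End Kernel.

(** * Averages of the kernel over spheres *)

Section AxisIntegrals.
Context {R : realType}.
Notation mR := (measurableTypeR R).
Notation L := (@lebesgue_measure R).
Variable r : R.
Hypothesis r0 : 0 < r.

(** The minimum of [rho] and [r], in a form whose continuity is immediate. *)
Definition cap (rho : R) : R := (rho + r - `|rho - r|) / 2.

Lemma cap_lt rho : rho <= r -> cap rho = rho.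
Proof. by move=> h; rewrite /cap ler0_norm ?subr_le0//; field. Qed.

Lemma cap_gt rho : r <= rho -> cap rho = r.
Proof. by move=> h; rewrite /cap ger0_norm ?subr_ge0//; field. Qed.

Lemma cap_bound rho : 0 <= rho -> 0 <= cap rho <= r.
Proof.
move=> h; have [hr|hr] := leP rho r; first by rewrite cap_lt ?h.
by rewrite cap_gt ?(ltW hr)// (ltW r0) lexx.
Qed.

Lemma cont_cap : continuous cap.
Proof. by move=> x; rewrite /cap; cont. Qed.

Lemma dist_arg_gt0 (rho z : R) : rho != r -> - rho <= z <= rho ->
  0 < rho ^+ 2 + r ^+ 2 - 2 * r * z.
Proof.
move=> h /andP[_ zr].
have p : 0 < (rho - r) ^+ 2 by rewrite exprn_even_gt0//= subr_eq0.
have := ler_wpM2l (ltW r0) zr; move: p; clear; nra.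
Qed.

Lemma dist_gt0 (rho z : R) : rho != r -> - rho <= z <= rho -> 0 < dist r (rho ^+ 2) z.
Proof. by move=> h hz; rewrite sqrtr_gt0 dist_arg_gt0. Qed.

Lemma der_dist (rho z : R) : rho != r -> - rho <= z <= rho ->
  is_derive z 1 (dist r (rho ^+ 2)) (- r / dist r (rho ^+ 2) z).
Proof.
move=> h hz; have p := dist_arg_gt0 h hz.
have q : 0 < Num.sqrt (rho ^+ 2 + r ^+ 2 - 2 * r * z) by rewrite sqrtr_gt0.
have d1 : is_derive z 1 (fun z : R => rho ^+ 2 + r ^+ 2 - 2 * r * z) (- (2 * r)).
  by dere; rewrite /=; ring.
have -> : - r / dist r (rho ^+ 2) z = (2 * Num.sqrt (rho ^+ 2 + r ^+ 2 - 2 * r * z))^-1 * (- (2 * r)).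
  by rewrite /dist; field; rewrite gt_eqF.
have d2 := is_derive1_sqrt p.
exact: (@is_derive1_comp R Num.sqrt (fun z : R => rho ^+ 2 + r ^+ 2 - 2 * r * z) z _ _ d2 d1).
Qed.

Lemma cont_dist t : continuous (dist r t).
Proof. by move=> z; rewrite /dist; cont. Qed.

Lemma dist_top (rho : R) : dist r (rho ^+ 2) rho = `|rho - r|.
Proof.
rewrite /dist -[RHS]sqrtr_sqr; congr Num.sqrt; ring.
Qed.

Lemma dist_bot (rho : R) : 0 <= rho -> dist r (rho ^+ 2) (- rho) = rho + r.
Proof.
move=> h; rewrite /dist -[RHS]ger0_norm ?addr_ge0 ?(ltW r0)// -[RHS]sqrtr_sqr.
congr Num.sqrt; ring.
Qed.

(** Newton's shell theorem: the mean over the sphere of radius [rho] of the inverse distance to the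
    pole is the inverse of the larger of [rho] and [r]. For [rho = r] the integrand is unbounded. *)
Lemma pint_inv_dist (rho : R) : 0 < rho -> rho != r ->
  pint (- rho) rho (fun z => (dist r (rho ^+ 2) z)^-1) = 2 * cap rho / r.
Proof.
move=> p0 pr.
apply: (@pint_ftc_eq _ (fun z => - (r^-1 * dist r (rho ^+ 2) z))).
- by move: p0; clear; lra.
- move=> z hz; have ? := @cont_dist (rho ^+ 2).
  by have ? := dist_gt0 pr hz; cont; rewrite gt_eqF.
- by move=> z hz; have ? := @cont_dist (rho ^+ 2); cont.
- move=> z /andP[h1 h2]; have hz : - rho <= z <= rho by rewrite !ltW.
  have d := der_dist pr hz; have p := dist_gt0 pr hz.
  dere; rewrite /=. field; rewrite !gt_eqF//.
- rewrite dist_top dist_bot ?ltW// /cap; field.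
  by rewrite gt_eqF.
Qed.

Lemma pint_moment_dist (rho : R) : 0 < rho -> rho != r ->
  pint (- rho) rho (fun z => (rho ^+ 2 - z ^+ 2) / dist r (rho ^+ 2) z ^+ 3) =
  4 / 3 * (cap rho / r) ^+ 3.
Proof.
move=> p0 pr; have r1 : r != 0 by rewrite gt_eqF.
(* Substitute [z = (rho ^+ 2 + r ^+ 2 - D ^+ 2) / (2 * r)] with [D] the distance to the pole. *)
apply: (@pint_ftc_eq _ (fun z => - ((4 * r ^+ 3)^-1 *
   ((rho ^+ 2 - r ^+ 2) ^+ 2 * (dist r (rho ^+ 2) z)^-1 +
    2 * (rho ^+ 2 + r ^+ 2) * dist r (rho ^+ 2) z - dist r (rho ^+ 2) z ^+ 3 / 3)))).
- by move: p0; clear; lra.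
- move=> z hz; have ? := @cont_dist (rho ^+ 2).
  by have ? := dist_gt0 pr hz; cont; rewrite expf_neq0// gt_eqF.
- move=> z hz; have ? := @cont_dist (rho ^+ 2).
  by have ? := dist_gt0 pr hz; cont; rewrite gt_eqF.
- move=> z /andP[h1 h2]; have hz : - rho <= z <= rho by rewrite !ltW.
  have d := der_dist pr hz; have p := dist_gt0 pr hz.
  have e : dist r (rho ^+ 2) z ^+ 2 = rho ^+ 2 + r ^+ 2 - 2 * r * z.
    by rewrite sqr_sqrtr// ltW// dist_arg_gt0.
  have zE : z = (rho ^+ 2 + r ^+ 2 - dist r (rho ^+ 2) z ^+ 2) / (2 * r).
    by rewrite e; field.
  dere; rewrite /=; first by rewrite gt_eqF.
  move: (dist r (rho ^+ 2) z) zE p => D -> p.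
  by field; rewrite r1 gt_eqF.
- rewrite dist_top dist_bot ?ltW//.
  have s0 : rho + r != 0 by rewrite gt_eqF// addr_gt0.
  have q0 : rho - r != 0 by rewrite subr_eq0.
  move: pr; rewrite neq_lt => /orP[h|h].
    rewrite (cap_lt (ltW h)) ltr0_norm ?subr_lt0//.
    by field; do ?[apply/andP; split] => //; rewrite -?opprB oppr_eq0.
  rewrite (cap_gt (ltW h)) gtr0_norm ?subr_gt0//.
  by field; do ?[apply/andP; split].
Qed.

Lemma eint_pint (a b : R) (h : R -> R) : cont_on a b h ->
  (\int[L]_(z in `[a, b]) (h z)%:E = (pint a b h)%:E)%E.
Proof.
move=> ch; rewrite /pint /Rintegral fineK//.
exact: (integrable_fin_num _ (cont_on_integrable ch)).
Qed.

Lemma measurable_inv : measurable_fun setT (fun x : mR => (x^-1 : mR)).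
Proof.
have m0 : measurable [set (0 : mR)] by exact: measurable_set1.
rewrite -(setUv [set (0 : mR)]); apply/measurable_funU => //.
  exact: measurableC.
split; first exact: measurable_fun_set1.
apply: open_continuous_measurable_fun.
  rewrite openC; exact: closed_eq.
by move=> x; rewrite inE/= => /eqP x0; exact: inv_continuous.
Qed.

End AxisIntegrals.

Lemma opp_id_eq0 (R : realType) (x : R) : - x = x -> x = 0.
Proof. by lra. Qed.

(** * The flux integral at a point of the axis *)

Section AxisFlux.
Context {R : realType}.
Notation mR := (measurableTypeR R).
Notation L := (@lebesgue_measure R).
Variable r : R.
Hypothesis r0 : 0 < r.
(** [A] will contain [a1 rho / rho], for which no continuity at 0 is at hand; the continuous [B] is
    [rho * A rho], the combination that the shell formula sees. *)
Variables (A B : R -> R) (C : R).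
Hypothesis mA : measurable_fun setT (A : mR -> mR).
Hypothesis cB : continuous B.
Hypothesis AB : forall rho : R, 0 < rho -> rho * A rho = B rho.
Hypothesis Bb : forall x : R, 0 <= x -> pint 0 x (fun rho => `|B rho|) <= C.

Local Notation k := ((8 * pi)^-1 : R).

Lemma k_ge0 : 0 <= k.
Proof. by rewrite invr_ge0 mulr_ge0// pi_ge0. Qed.

Lemma measurable_sqrt : measurable_fun setT (Num.sqrt : mR -> mR).
Proof. by apply: continuous_measurable_fun; exact: sqrt_continuous. Qed.

Lemma measurable_dist : measurable_fun setT (fun q : mR * mR => dist r q.1 q.2 : mR).
Proof.
apply: (measurableT_comp measurable_sqrt).
apply: measurable_funB.
  by apply: measurable_funD; [exact: measurable_fst|exact: measurable_cst].
by apply: measurable_funM; [exact: measurable_cst|exact: measurable_snd].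
Qed.

Lemma measurable_A1 : measurable_fun setT (fun q : mR * mR => A (Num.sqrt q.1) : mR).
Proof.
exact: (measurableT_comp mA (measurableT_comp measurable_sqrt measurable_fst)).
Qed.

Let Gb (q : mR * mR) : R := `|A (Num.sqrt q.1)| * (2 * k * r / dist r q.1 q.2).

Let mGb : measurable_fun setT Gb.
Proof.
apply: measurable_funM; first exact: (measurableT_comp (@normr_measurable R setT) measurable_A1).
apply: measurable_funM; first exact: measurable_cst.
exact: (measurableT_comp (@measurable_inv R) measurable_dist).
Qed.

Let Gb0 q : 0 <= Gb q.
Proof.
by rewrite mulr_ge0// mulr_ge0 ?invr_ge0 ?sqrtr_ge0// mulr_ge0 ?(ltW r0)// mulr_ge0// k_ge0.
Qed.

(** The kernel costs one inverse distance, whose integral over the height is at most 2 by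
    [pint_inv_dist] and [cap_bound]. *)
Lemma axis_bound : (\int[leb3 R]_p (Gb (sph p))%:E < +oo)%E.
Proof.
apply: (@le_lt_trans _ _ (disc_area * (8 * k * r * C))%:E); last exact: ltry.
apply: (@shell_bound _ Gb (fun rho => 8 * k * r * `|B rho|) (r ^+ 2)).
- exact: mGb.
- exact: Gb0.
- by move=> x; have ? : {for x, continuous B} := @cB x; cont.
- move=> x _; rewrite mulr_ge0// mulr_ge0 ?(ltW r0)// mulr_ge0 ?k_ge0//.
- move=> x x0; rewrite pintZ; last by move=> y _; have ? : {for y, continuous B} := @cB y; cont.
  by apply: ler_wpM2l (Bb x0); rewrite mulr_ge0 ?(ltW r0)// mulr_ge0 ?k_ge0.
move=> t t0 tr; pose rho := Num.sqrt t.
have p0 : 0 < rho by rewrite sqrtr_gt0.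
have tE : t = rho ^+ 2 by rewrite sqr_sqrtr// ltW.
have pr : rho != r by apply: contraNneq tr => <-; rewrite tE.
rewrite -/rho.
have E : (\int[L]_(z in `[(- rho)%R, rho]) (Gb (t, z))%:E =
    (`|A rho| * (2 * k * r) * pint (- rho) rho (fun z => (dist r (rho ^+ 2) z)^-1))%:E)%E.
  have cd : cont_on (- rho) rho (fun z => (dist r (rho ^+ 2) z)^-1).
    move=> z hz; have ? := @cont_dist _ r (rho ^+ 2).
    by have ? := dist_gt0 r0 pr hz; cont; rewrite gt_eqF.
  rewrite -pintZ// -eint_pint.
    by apply: eq_integral => z _; rewrite /Gb /= -/rho tE mulrA.
  by move=> z hz; have ? := cd z hz; cont.
rewrite E lee_fin (pint_inv_dist r0 p0 pr) /shell_density t0 -/rho -(AB p0) normrM (gtr0_norm p0).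
have /andP[_ cr] := cap_bound r0 (ltW p0).
have -> : 8 * k * r * (rho * `|A rho|) / (2 * rho) = `|A rho| * (2 * k * r) * 2.
  by move: k => k'; field; rewrite gt_eqF.
apply: ler_wpM2l.
  by rewrite mulr_ge0// mulr_ge0 ?(ltW r0)// mulr_ge0// k_ge0.
by rewrite ler_pdivrMr// ler_pM2l.
Qed.

Let F i (p : mR * mR * mR) : R :=
  A (enorm (vec3 p)) * kvec (r *: axis3 - vec3 p) (r *: axis3) 0 i.

Lemma measurable_vec3 (i : 'I_3) : measurable_fun setT (fun p : mR * mR * mR => vec3 p 0 i : mR).
Proof.
have E j : (fun p : mR * mR * mR => vec3 p 0 j : mR) =
   (fun p => [:: p.1.1; p.1.2; p.2]`_j) by apply/funext => p; rewrite mxE.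
rewrite E; case: i => -[|[|[|//]]] i3 /=.
- exact: (measurableT_comp measurable_fst measurable_fst).
- exact: (measurableT_comp measurable_snd measurable_fst).
- exact: measurable_snd.
Qed.

Lemma measurable_enorm_vec3 : measurable_fun setT (fun p : mR * mR * mR => enorm (vec3 p) : mR).
Proof.
have -> : (fun p : mR * mR * mR => enorm (vec3 p) : mR) = (fun p => Num.sqrt (sph p).1).
  by apply/funext => p; rewrite enorm_vec3.
exact: (measurableT_comp measurable_sqrt (measurableT_comp measurable_fst measurable_sph)).
Qed.

Let mF i : measurable_fun setT (F i).
Proof.
apply: measurable_funM; first exact: (measurableT_comp mA measurable_enorm_vec3).
have md3 : measurable_fun setT (fun p : mR * mR * mR => (dist r (sph p).1 (sph p).2 ^+ 3)^-1 : mR).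
  apply: (measurableT_comp (@measurable_inv R)); apply: measurable_funX.
  exact: (measurableT_comp measurable_dist measurable_sph).
have [->|i3] := eqVneq i ord_max.
  rewrite (_ : (fun _ => _) = (fun p => k * r * ((sph p).1 - (sph p).2 ^+ 2) / dist r (sph p).1 (sph p).2 ^+ 3)).
    apply: measurable_funM => //; apply: measurable_funM; first exact: measurable_cst.
    apply: measurable_funB; first exact: (measurableT_comp measurable_fst measurable_sph).
    by apply: measurable_funX; exact: (measurableT_comp measurable_snd measurable_sph).
  by apply/funext => p; rewrite kvec_axis3.
rewrite (_ : (fun _ => _) = (fun p => k * r * (vec3 p 0 i * (r - p.2)) / dist r (sph p).1 (sph p).2 ^+ 3)).
  apply: measurable_funM => //; apply: measurable_funM; first exact: measurable_cst.
  apply: measurable_funM; first exact: measurable_vec3.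
  by apply: measurable_funB; [exact: measurable_cst|exact: measurable_snd].
by apply/funext => p; rewrite kvec_axis01.
Qed.

Lemma axis_integrable i : (leb3 R).-integrable setT (fun p => (F i p)%:E).
Proof.
apply/integrableP; split; first exact/measurable_EFinP.
apply: le_lt_trans axis_bound; apply: ge0_le_integral => //.
- by apply: measurableT_comp => //; apply/measurable_EFinP; exact: mF.
- by apply/measurable_EFinP; exact: (measurableT_comp mGb measurable_sph).
move=> p _; rewrite /= lee_fin /F normrM /Gb -enorm_vec3.
by apply: ler_wpM2l => //; exact: kvec_axis_le.
Qed.

(** Reflecting coordinate [i] preserves the measure, fixes [sph] and changes the sign of the
    integrand. *)
Lemma axis_int01 i : i != ord_max -> \int[leb3 R]_p F i p = 0.
Proof.
move=> i3.
have [T pT [e1 e2]] : exists2 T, preserves3 T & (forall p : mR * mR * mR, sph (T p) = sph p) /\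
    (forall p : mR * mR * mR, vec3 (T p) 0 i = - vec3 p 0 i).
  case: i i3 => -[|[|[|//]]] i3 h; last by case/eqP: h; exact: val_inj.
    exists (fun p => ((- p.1.1)%R : mR, p.1.2, p.2)); first exact: (preserves3_12 preserves2_opp1).
    by split => p; [rewrite /sph /rho2/= sqrrN|rewrite !mxE].
  exists (fun p => (p.1.1, (- p.1.2)%R : mR, p.2)); first exact: (preserves3_12 preserves2_opp2).
  by split => p; [rewrite /sph /rho2/= sqrrN|rewrite !mxE].
have E : \int[leb3 R]_p F i (T p) = \int[leb3 R]_p - F i p.
  apply: eq_Rintegral => p _; rewrite /F !enorm_vec3 !kvec_axis01// e1 e2.
  have -> : (T p).2 = p.2 by have := congr1 snd (e1 p).
  by move: (vec3 p 0 i) => x; ring.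
have := Rintegral_preserves3 pT (mF i); rewrite E.
have -> : \int[leb3 R]_p - F i p = - \int[leb3 R]_p F i p.
  rewrite -mulN1r -(RintegralZl (-1) measurableT (axis_integrable i)).
  by apply: eq_Rintegral => p _; rewrite mulN1r.
exact: opp_id_eq0.
Qed.

Lemma axis_int3 : (fun x => pint 0 x (fun rho => 8 / 3 * k * r * (cap r rho / r) ^+ 3 * B rho)) @ +oo -->
   disc_area^-1 * \int[leb3 R]_p F ord_max p.
Proof.
pose G (q : mR * mR) : R := A (Num.sqrt q.1) * (k * r * (q.1 - q.2 ^+ 2) / dist r q.1 q.2 ^+ 3).
have FG : F ord_max = (fun p => G (sph p)).
  by apply/funext => p; rewrite /F /G kvec_axis3 enorm_vec3.
rewrite FG; apply: (@shell_cvg _ G _ (r ^+ 2)).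
- apply: measurable_funM; first exact: measurable_A1.
  apply: measurable_funM.
    apply: measurable_funM; first exact: measurable_cst.
    by apply: measurable_funB; [exact: measurable_fst|apply: measurable_funX; exact: measurable_snd].
  by apply: (measurableT_comp (@measurable_inv R)); apply: measurable_funX; exact: measurable_dist.
- by move=> x; have ? := @cont_cap _ r; have ? : {for x, continuous B} := @cB x; cont.
- by have := axis_integrable ord_max; rewrite FG.
move=> t t0 tr; pose rho := Num.sqrt t.
have p0 : 0 < rho by rewrite sqrtr_gt0.
have tE : t = rho ^+ 2 by rewrite sqr_sqrtr// ltW.
have pr : rho != r by apply: contraNneq tr => <-; rewrite tE.
rewrite -/rho.
have E : (\int[L]_(z in `[(- rho)%R, rho]) (G (t, z))%:E =
    (A rho * (k * r) * pint (- rho) rho (fun z => (rho ^+ 2 - z ^+ 2) / dist r (rho ^+ 2) z ^+ 3))%:E)%E.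
  have cd : cont_on (- rho) rho (fun z => (rho ^+ 2 - z ^+ 2) / dist r (rho ^+ 2) z ^+ 3).
    move=> z hz; have ? := @cont_dist _ r (rho ^+ 2).
    by have ? := dist_gt0 r0 pr hz; cont; rewrite expf_neq0// gt_eqF.
  rewrite -pintZ// -eint_pint.
    by apply: eq_integral => z _; rewrite /G /= -/rho tE !mulrA.
  by move=> z hz; have ? := cd z hz; cont.
rewrite E (pint_moment_dist r0 p0 pr) /shell_density t0 -/rho -(AB p0).
congr EFin; move: k (cap r rho) => k' c; field.
by rewrite !gt_eqF.
Qed.

End AxisFlux.

(** * The flux at an arbitrary point *)

Section Flux.
Context {R : realType}.
Notation mR := (measurableTypeR R).
Implicit Types (v w : 'rV[R]_3).
Local Notation k := ((8 * pi)^-1 : R).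

Lemma rigid3_coord phi (u : 'rV[R]_3) (i : 'I_3) : rigid3 phi ->
  phi u 0 i = u 0 ord0 * phi (delta_mx 0 ord0) 0 i +
    u 0 (lift ord0 ord0) * phi (delta_mx 0 (lift ord0 ord0)) 0 i +
    u 0 ord_max * phi axis3 0 i.
Proof.
move=> rp; have [l _ _] := rp.
have {1}-> : u = u 0 ord0 *: delta_mx 0 ord0 + (u 0 (lift ord0 ord0) *: delta_mx 0 (lift ord0 ord0)
    + u 0 ord_max *: axis3).
  by apply: row3P; rewrite !mxE/=; ring.
by rewrite !l (rigid3Z _ _ rp) !mxE; ring.
Qed.

Lemma measurable_sub_vec3 v (i : 'I_3) :
  measurable_fun setT (fun p : mR * mR * mR => (v - vec3 p) 0 i : mR).
Proof.
have -> : (fun p : mR * mR * mR => (v - vec3 p) 0 i : mR) = (fun p => v 0 i - vec3 p 0 i).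
  by apply/funext => p; rewrite !mxE.
by apply: measurable_funB; [exact: measurable_cst|exact: measurable_vec3].
Qed.

Lemma measurable_kvec v (i : 'I_3) :
  measurable_fun setT (fun p : mR * mR * mR => kvec (v - vec3 p) v 0 i : mR).
Proof.
have mn : measurable_fun setT (fun p : mR * mR * mR => enorm (v - vec3 p) : mR).
  rewrite /enorm; apply: (measurableT_comp (@measurable_sqrt R)).
  under eq_fun do rewrite sum3.
  by apply: measurable_funD; [apply: measurable_funD|];
    apply: measurable_funX; exact: measurable_sub_vec3.
have md : measurable_fun setT (fun p : mR * mR * mR => vdot (v - vec3 p) v : mR).
  rewrite /vdot; under eq_fun do rewrite sum3.
  by apply: measurable_funD; [apply: measurable_funD|];
    apply: measurable_funM; solve [exact: measurable_sub_vec3|exact: measurable_cst].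
have mi := @measurable_inv R.
under eq_fun do rewrite kvecE.
apply: measurable_funM.
  by apply: measurable_funM; [exact: measurable_cst|exact: (measurableT_comp mi mn)].
apply: measurable_funB; first exact: measurable_cst.
apply: measurable_funM; last exact: measurable_sub_vec3.
apply: measurable_funM; first exact: md.
by apply: (measurableT_comp mi); exact: measurable_funX.
Qed.

(** A rotation that takes the axis to [v] turns the integrand into a combination of the three
    components on the axis. Only the last has a nonzero integral, and its coefficient is
    [v 0 i / enorm v]. *)
Lemma int3_kvec (A B : R -> R) (C : R) v (i : 'I_3) : v != 0 ->
  measurable_fun setT (A : mR -> mR) -> continuous B ->
  (forall rho : R, 0 < rho -> rho * A rho = B rho) ->
  (forall x : R, 0 <= x -> pint 0 x (fun rho => `|B rho|) <= C) ->
  int3 (fun w => A (enorm w) * kvec (v - w) v 0 i) =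
  int3 (fun w => A (enorm w) *
    kvec (enorm v *: axis3 - w) (enorm v *: axis3) 0 ord_max) * (v 0 i / enorm v).
Proof.
move=> v0 mA cB AB Bb; have r0 : 0 < enorm v by rewrite enorm_gt0.
have [phi rp pv] := rigid3_axis v0.
have mH : measurable3 (fun w => A (enorm w) * kvec (v - w) v 0 i).
  apply: measurable_funM; last exact: measurable_kvec.
  exact: (measurableT_comp mA (@measurable_enorm_vec3 R)).
rewrite -(int3_rigid rp mH); set r := enorm v in r0 pv *.
pose F j p := A (enorm (vec3 p)) * kvec (r *: axis3 - vec3 p) (r *: axis3) 0 j.
have iF j : (leb3 R).-integrable setT (fun p => (F j p)%:E) := axis_integrable r0 mA cB AB Bb j.
pose c j := phi (delta_mx 0 j) 0 i.
rewrite /int3.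
transitivity (\int[leb3 R]_(p in setT) (c ord0 * F ord0 p +
   c (lift ord0 ord0) * F (lift ord0 ord0) p + c ord_max * F ord_max p)).
  apply: eq_Rintegral => p _ /=; rewrite (enorm_rigid3 _ rp).
  rewrite -{1 2}pv -(rigid3B _ _ rp) (kvec_rigid _ _ rp) (rigid3_coord _ _ rp) /F /c /axis3.
  by ring.
have iZ j : (leb3 R).-integrable setT (EFin \o (fun p => c j * F j p)).
  exact: (integrableZl measurableT (c j) (iF j)).
have iD : (leb3 R).-integrable setT
    (EFin \o (fun p => c ord0 * F ord0 p + c (lift ord0 ord0) * F (lift ord0 ord0) p)).
  exact: (integrableD measurableT (iZ _) (iZ _)).
rewrite (RintegralD measurableT iD (iZ _)) (RintegralD measurableT (iZ _) (iZ _)).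
rewrite !(RintegralZl _ measurableT (iF _)).
have z0 j : j != ord_max -> \int[leb3 R]_x F j x = 0 := @axis_int01 _ _ r0 _ _ _ mA cB AB Bb j.
rewrite (z0 ord0)// (z0 (lift ord0 ord0))// !mulr0 !add0r mulrC.
congr (_ * _); rewrite /c -[in RHS]pv (rigid3Z _ _ rp) !mxE.
by rewrite mulrAC mulfV ?mul1r// gt_eqF.
Qed.

Section Profiles.
Variables (f g : 'rV[R]_3 -> R) (a a1 b b1 : R -> R) (Ha Ca Cb : R).
Hypotheses (pf : profile f a a1) (pg : profile g b b1).
Hypothesis ca1 : continuous a1.
Hypothesis Ba : forall x : R, 0 <= x -> pint 0 x (fun rho => rho * `|a rho|) <= Ca.
Hypothesis Ba1 : forall x : R, 0 <= x -> pint 0 x (fun rho => `|a1 rho|) <= Cb.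
Hypothesis a_oo : a @ +oo --> (0 : R).
Hypothesis Ha_oo : mom a 1 @ +oo --> Ha.

Let da : forall x : R, is_derive x 1 a (a1 x). Proof. by case: pf. Qed.
Let ca : continuous a. Proof. by move=> x; exact: der_cont (da x). Qed.

Definition flux_coef (r : R) : R :=
  8 / 3 * k * (b1 r * (mom a 4 r / r ^+ 3 + tailH a Ha r) + 3 * b r * mom a 2 r / r ^+ 2).

Let A (r rho : R) : R := a rho * (b1 r / r) - b r * (a1 rho / rho).
Let B (r rho : R) : R := b1 r / r * (rho * a rho) - b r * a1 rho.

Let mA r : measurable_fun setT (A r : mR -> mR).
Proof.
apply: measurable_funB.
  by apply: measurable_funM; [exact: continuous_measurable_fun|exact: measurable_cst].
apply: measurable_funM; first exact: measurable_cst.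
by apply: measurable_funM; [exact: continuous_measurable_fun|exact: measurable_inv].
Qed.

Let cB r : continuous (B r).
Proof.
move=> x; have ? : {for x, continuous a} := @ca x.
by have ? : {for x, continuous a1} := @ca1 x; rewrite /B; cont.
Qed.

Let AB (r rho : R) : 0 < rho -> rho * A r rho = B r rho.
Proof. by move=> p0; rewrite /A /B; move: (b1 r / r) => x; field; rewrite gt_eqF. Qed.

Let Bb (r x : R) : 0 <= x ->
  pint 0 x (fun rho => `|B r rho|) <= `|b1 r / r| * Ca + `|b r| * Cb.
Proof.
move=> x0.
have c1 (y : R) : {for y, continuous (fun rho : R => rho * `|a rho|)}.
  by have ? : {for y, continuous a} := @ca y; cont.
have c2 (y : R) : {for y, continuous (fun rho : R => `|a1 rho|)}.
  by have ? : {for y, continuous a1} := @ca1 y; cont.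
have c3 (y : R) : {for y, continuous (fun rho : R => `|b1 r / r| * (rho * `|a rho|))}.
  by have ? := c1 y; cont.
have c4 (y : R) : {for y, continuous (fun rho : R => `|b r| * `|a1 rho|)}.
  by have ? := c2 y; cont.
have c5 (y : R) : {for y, continuous (fun rho : R => `|B r rho|)}.
  by have ? : {for y, continuous (B r)} := @cB r y; cont.
have c6 (y : R) : {for y, continuous (fun rho : R => `|b1 r / r| * (rho * `|a rho|) + `|b r| * `|a1 rho|)}.
  by have ? := c3 y; have ? := c4 y; cont.
apply: (@le_trans _ _ (pint 0 x (fun rho => `|b1 r / r| * (rho * `|a rho|) + `|b r| * `|a1 rho|))).
  apply: pint_le => // y /andP[y0 _]; rewrite /B (le_trans (ler_normB _ _))//.
  by rewrite !normrM [`|y|]ger0_norm.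
by rewrite pintD// !pintZ// lerD// ler_wpM2l// ?Ba ?Ba1.
Qed.

(** Inside radius [r], [cap] is [rho] and produces moments of order 4 and 2; outside it is [r] and
    produces the tail of [rho * a rho]. The terms in [a r], left on both sides by integrating [a1],
    cancel. *)
Lemma pint_cap_limit (r : R) : 0 < r ->
  (fun x => pint 0 x (fun rho => 8 / 3 * k * r * (cap r rho / r) ^+ 3 * B r rho)) @ +oo -->
  flux_coef r.
Proof.
move=> r0; pose c := 8 / 3 * k.
pose h (rho : R) := c * r * (cap r rho / r) ^+ 3 * B r rho.
change ((fun x => pint 0 x h) @ +oo --> flux_coef r).
have ch : continuous h.
  move=> x; have ? := @cont_cap _ r; have ? : {for x, continuous (B r)} := @cB r x.
  by rewrite /h; cont.
have E1 : pint 0 r h = c * (b1 r / r ^+ 3 * mom a 4 r - b r / r ^+ 2 * (r ^+ 3 * a r - 3 * mom a 2 r)).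
  apply: (@pint_ftc_eq _ (fun y => c * (b1 r / r ^+ 3 * mom a 4 y - b r / r ^+ 2 * (y ^+ 3 * a y - 3 * mom a 2 y)))).
  - exact: ltW.
  - by move=> y _; exact: ch.
  - move=> y _; have ? := @cont_mom _ a a1 da 4 y; have ? := @cont_mom _ a a1 da 2 y.
    by have ? : {for y, continuous a} := @ca y; cont.
  - move=> y /andP[y0 yr]; have ? := @der_mom _ a a1 da 4 y y0; have ? := @der_mom _ a a1 da 2 y y0.
    have ? := da y; dere; rewrite /h /B (cap_lt (ltW yr)) /=.
    by field; rewrite gt_eqF.
  - rewrite !mom0 expr0n/=; ring.
have E2 x : r <= x -> pint r x h = c * (b1 r * (mom a 1 x - mom a 1 r) - r * b r * (a x - a r)).
  move=> rx; apply: (@pint_ftc_eq _ (fun y => c * (b1 r * mom a 1 y - r * b r * a y))).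
  - exact: rx.
  - by move=> y _; exact: ch.
  - move=> y _; have ? := @cont_mom _ a a1 da 1 y.
    by have ? : {for y, continuous a} := @ca y; cont.
  - move=> y /andP[ry yx]; have y0 := lt_trans r0 ry; have ? := @der_mom _ a a1 da 1 y y0.
    have ? := da y; dere; rewrite /h /B (cap_gt (ltW ry)) /= expr1 divff ?gt_eqF//.
    by field; rewrite gt_eqF.
  - ring.
have cv : (fun x => pint 0 r h + c * (b1 r * (mom a 1 x - mom a 1 r) - r * b r * (a x - a r))) @ +oo -->
    pint 0 r h + c * (b1 r * (Ha - mom a 1 r) - r * b r * (0 - a r)).
  apply: cvgD; first exact: cvg_cst.
  apply: cvgMr; apply: cvgB; apply: cvgMr; apply: cvgB => //; exact: cvg_cst.
have -> : flux_coef r = pint 0 r h + c * (b1 r * (Ha - mom a 1 r) - r * b r * (0 - a r)).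
  rewrite E1 /flux_coef -/c /tailH; field.
  by rewrite gt_eqF.
apply: cvg_trans cv; apply: near_eq_cvg; near=> x.
have rx : r <= x by near: x; apply: nbhs_pinfty_ge; exact: num_real.
by rewrite -E2// (pint_split (ltW r0) rx)// => y _; exact: ch.
Unshelve. all: by end_near. Qed.

Lemma Q_fluxE v (i : 'I_3) : v != 0 ->
  Q_flux f g i v = disc_area * flux_coef (enorm v) * (v 0 i / enorm v).
Proof.
move=> v0; have r0 : 0 < enorm v by rewrite enorm_gt0.
have -> : Q_flux f g i v = int3 (fun w => A (enorm v) (enorm w) * kvec (v - w) v 0 i).
  congr int3; apply/funext => w.
  pose x := a (enorm w) * (b1 (enorm v) / enorm v).
  pose y := b (enorm v) * (a1 (enorm w) / enorm w).
  have [fa _ _] := pf; have [gb _ _] := pg.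
  rewrite (eq_bigr (fun j => coulomb_kernel i j (v - w) * (x *: v - y *: w) 0 j)); last first.
    move=> j _; rewrite (profile_partial j v pg) (profile_partial j w pf) fa gb !mxE /x /y.
    by congr (_ * _); ring.
  by rewrite sum_kernel kvec_shift mxE.
rewrite (int3_kvec i v0 (mA (enorm v)) (@cB (enorm v)) (@AB (enorm v)) (@Bb (enorm v))); congr (_ * _).
have L1 := axis_int3 r0 (mA (enorm v)) (@cB (enorm v)) (@AB (enorm v)) (@Bb (enorm v)).
have L2 := pint_cap_limit r0.
have := cvg_unique (@Rhausdorff R) L1 L2; rewrite /int3 => <-.
by rewrite mulrA divff ?mul1r// gt_eqF// disc_area_gt0.
Qed.

End Profiles.
End Flux.

(** * The linearized operator in radial form *)

Section Linearized.
Context {R : realType}.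
Implicit Types (v : 'rV[R]_3).
Local Notation k := ((8 * pi)^-1 : R).

Lemma profile_maxwellian : profile (@maxwellian R) gau (fun x => - 2 * x * gau x).
Proof.
by split => [v|x|x]; [|exact: der_gau|rewrite /gau sqrrN].
Qed.

Lemma cvg_sqr_pinfty : (fun x : R => x ^+ 2) @ +oo --> +oo.
Proof.
apply/cvgryPge => A; near=> x.
have x1 : 1 <= x by near: x; apply: nbhs_pinfty_ge; exact: num_real.
have xA : A <= x by near: x; apply: nbhs_pinfty_ge; exact: num_real.
by rewrite (le_trans xA)// expr2 ler_peMr// (le_trans ler01).
Unshelve. all: by end_near. Qed.

Lemma cvg_gau : (@gau R) @ +oo --> (0 : R).
Proof. exact: (cvg_comp _ _ cvg_sqr_pinfty (@cvgr_expR R)). Qed.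

Lemma pint_id_gau (x : R) : 0 <= x -> pint 0 x (fun s => s * gau s) = (1 - gau x) / 2.
Proof.
move=> x0; apply: (@pint_ftc_eq _ (fun s => - gau s / 2)).
- exact: x0.
- by move=> y _; have ? := @cont_gau R y; cont.
- by move=> y _; have ? := @cont_gau R y; cont.
- by move=> y _; have ? := der_gau y; dere; rewrite /=; field.
- by rewrite /gau expr0n/= oppr0 expR0; field.
Qed.

Lemma mom1_gau (x : R) : 0 <= x -> mom gau 1 x = (1 - gau x) / 2.
Proof. by move=> x0; rewrite -pint_id_gau//; apply: eq_pint => s _; rewrite expr1. Qed.

Lemma mom4_gau (x : R) : 0 <= x -> mom gau 4 x = 3 / 2 * gmass x - x ^+ 3 * gau x / 2.
Proof.
move=> x0; apply: (@pint_ftc_eq _ (fun s => 3 / 2 * gmass s - s ^+ 3 * gau s / 2)).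
- exact: x0.
- by move=> y _; exact: cont_monom_gau.
- by move=> y _; have ? := @cont_gau R y; have ? := @cont_gmass R y; cont.
- move=> y /andP[y0 _]; have ? := der_gau y; have ? := der_gmass y0.
  by dere; rewrite /=; field.
- by rewrite gmass0 expr0n/=; ring.
Qed.

Lemma cvg_mom1_gau : mom (@gau R) 1 @ +oo --> (1 / 2 : R).
Proof.
have c : (fun x : R => (1 - gau x) / 2) @ +oo --> ((1 - 0) / 2 : R).
  by apply: cvgMl; apply: cvgB; [exact: cvg_cst|exact: cvg_gau].
rewrite subr0 in c; apply: cvg_trans c; apply: near_eq_cvg; near=> x.
by rewrite mom1_gau//; near: x; apply: nbhs_pinfty_ge; exact: num_real.
Unshelve. all: by end_near. Qed.

Variables (f : 'rV[R]_3 -> R) (u u1 u2 : R -> R) (H0 Ca Cb : R).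
Hypothesis pf : profile f u u1.
Hypothesis du1 : forall x : R, is_derive x 1 u1 (u2 x).
Hypothesis Ba : forall x : R, 0 <= x -> pint 0 x (fun rho => rho * `|u rho|) <= Ca.
Hypothesis Ba1 : forall x : R, 0 <= x -> pint 0 x (fun rho => `|u1 rho|) <= Cb.
Hypothesis u_oo : u @ +oo --> (0 : R).
Hypothesis H0_oo : mom u 1 @ +oo --> H0.

Let du : forall x : R, is_derive x 1 u (u1 x). Proof. by case: pf. Qed.

Let S1 (r : R) : R := - (gau r * Zf u H0 r).
Let S2 (r : R) : R := gdiff r * gfun u u1 r.

Lemma Q_flux_maxwellian v (i : 'I_3) : v != 0 ->
  Q_flux f (@maxwellian R) i v =
  (fun r : R => 8 * disc_area * k * (S1 r * (r ^+ 2)^-1)) (enorm v) * (v 0 i / enorm v).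
Proof.
move=> v0; have r0 : 0 < enorm v by rewrite enorm_gt0.
rewrite (Q_fluxE pf profile_maxwellian (cont_u1 du1) Ba Ba1 u_oo H0_oo i v0); congr (_ * _).
move: (enorm v) r0 => r r0; rewrite /flux_coef /S1 /Zf; move: k => k'.
by field; rewrite gt_eqF.
Qed.

(** Since [tailH] of the Gaussian is [gau r / 2], it cancels the Gaussian term of
    [mom gau 4 r / r ^ 3], and both coefficients become multiples of [gmass r]. *)
Lemma maxwellian_Q_flux v (i : 'I_3) : v != 0 ->
  Q_flux (@maxwellian R) f i v =
  (fun r : R => 8 * disc_area * k * (S2 r * (r ^+ 2)^-1)) (enorm v) * (v 0 i / enorm v).
Proof.
move=> v0; have r0 : 0 < enorm v by rewrite enorm_gt0.
have cg (x : R) : {for x, continuous (fun x : R => - 2 * x * gau x)}.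
  by have ? := @cont_gau R x; cont.
have b1 (x : R) : 0 <= x -> pint 0 x (fun rho => rho * `|gau rho|) <= 1 / 2.
  move=> x0; rewrite (eq_pint (g := fun s => s * gau s)); last first.
    by move=> y _; rewrite gtr0_norm// gau_gt0.
  by rewrite pint_id_gau//; have := gau_gt0 x; lra.
have b2 (x : R) : 0 <= x -> pint 0 x (fun rho => `|- 2 * rho * gau rho|) <= 1.
  move=> x0; rewrite (eq_pint (g := fun s => 2 * (s * gau s))); last first.
    move=> y /andP[y0 _]; rewrite !normrM normrN (gtr0_norm (gau_gt0 _)) (ger0_norm y0).
    by rewrite ger0_norm// mulrA.
  rewrite pintZ; last by move=> y _; have ? := @cont_gau R y; cont.
  by rewrite pint_id_gau//; have := gau_gt0 x; lra.
rewrite (Q_fluxE profile_maxwellian pf cg b1 b2 cvg_gau cvg_mom1_gau i v0); congr (_ * _).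
move: (enorm v) r0 => r r0; rewrite /flux_coef /S2 /gdiff /gfun /tailH.
rewrite (mom4_gau (ltW r0)) (mom1_gau (ltW r0)) -[mom gau 2 r]/(gmass r); move: k => k'.
by field; rewrite gt_eqF.
Qed.

Lemma linearized_QE v : v != 0 ->
  linearized_Q f v = 8 * disc_area * k * (Sflux1 u u1 u2 H0 (enorm v) / enorm v ^+ 2).
Proof.
move=> v0; have r0 : 0 < enorm v by rewrite enorm_gt0.
have r2 : enorm v ^+ 2 != 0 by rewrite expf_neq0// gt_eqF.
have dZ := der_Zf H0 du r0; have dg := der_gau (enorm v).
have dG := der_gdiff r0; have d0 := du (enorm v); have d1 := du1 (enorm v).
pose D1 (r : R) : R := 2 * r * gau r * Zf u H0 r - gau r * (r ^+ 2 * Gam u H0 r).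
pose D2 (r : R) : R := gdiff1 r * gfun u u1 r + gdiff r * (u2 r + 2 * u r + 2 * r * u1 r).
set r := enorm v in r0 r2 dZ dg dG d0 d1 *.
set K := 8 * disc_area * k.
have e1 : is_derive r 1 (fun r : R => K * (S1 r * (r ^+ 2)^-1)) (K * (D1 r / r ^+ 2 - 2 * S1 r / r ^+ 3)).
  have dS : is_derive r 1 S1 (D1 r) by rewrite /S1 /D1; dere; rewrite /=; ring.
  by dere; [exact: r2|rewrite /=; field; rewrite gt_eqF].
have e2 : is_derive r 1 (fun r : R => K * (S2 r * (r ^+ 2)^-1)) (K * (D2 r / r ^+ 2 - 2 * S2 r / r ^+ 3)).
  have dS : is_derive r 1 S2 (D2 r) by rewrite /S2 /D2 /gfun; dere; rewrite /=; ring.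
  by dere; [exact: r2|rewrite /=; field; rewrite gt_eqF].
have q1 := @divergence_radial R (Q_flux f (@maxwellian R))
  (fun r : R => K * (S1 r * (r ^+ 2)^-1)) _ v v0 (fun i w w0 => Q_flux_maxwellian i w0) e1.
have q2 := @divergence_radial R (Q_flux (@maxwellian R) f)
  (fun r : R => K * (S2 r * (r ^+ 2)^-1)) _ v v0 (fun i w w0 => maxwellian_Q_flux i w0) e2.
rewrite [LHS](congr2 +%R q1 q2 : linearized_Q f v = _) -/r /Sflux1.
have -> : gdiff1 r * gfun u u1 r + gdiff r * (u2 r + 2 * u r + 2 * r * u1 r) = D2 r by [].
have -> : D2 r + 2 * r * gau r * Zf u H0 r - gau r * (r ^+ 2 * Gam u H0 r) = D2 r + D1 r.
  by rewrite /D1 addrA.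
by clearbody K; field; rewrite gt_eqF.
Qed.

End Linearized.

(** * Decay at infinity *)

Section MonotoneLimits.
Context {R : realType}.
Implicit Types (h s : R -> R).

Lemma pint_mono h : continuous h -> (forall x, 0 <= x -> 0 <= h x) ->
  forall x y, x <= y -> pint 0 x h <= pint 0 y h.
Proof.
move=> ch h0 x y xy; have [x0|x0] := leP 0 x.
  rewrite [leRHS](pint_split x0 xy); last by move=> z _; exact: ch.
  by rewrite lerDl pint_ge0// => z /andP[xz _]; exact: h0 (le_trans x0 xz).
by rewrite (pint_gt _ x0) pint_ge0// => z /andP[z0 _]; exact: h0.
Qed.

Lemma pint_is_cvg h (C : R) : continuous h -> (forall x, 0 <= x -> 0 <= h x) ->
  (forall x, 0 <= x -> pint 0 x h <= C) -> exists l : R, (fun x => pint 0 x h) @ +oo --> l.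
Proof.
move=> ch h0 hC; exists (sup (range (fun x => pint 0 x h))).
apply: nondecreasing_cvgr; first by move=> x y; exact: pint_mono.
exists C => _ [x _ <-]; have [x0|x0] := leP 0 x; first exact: hC.
by rewrite (pint_gt _ x0) (le_trans _ (hC 0 (lexx _)))// pint_id.
Qed.

(** [h] is the difference of [|h| + h] and [|h|], both nonnegative with bounded integrals. *)
Lemma pint_is_cvg_abs h (C : R) : continuous h ->
  (forall x, 0 <= x -> pint 0 x (fun y => `|h y|) <= C) ->
  exists l : R, (fun x => pint 0 x h) @ +oo --> l.
Proof.
move=> ch hC.
have c1 : continuous (fun y : R => `|h y|).
  by move=> y; have ? : {for y, continuous h} := @ch y; cont.
have c2 : continuous (fun y : R => `|h y| + h y).
  by move=> y; have ? : {for y, continuous h} := @ch y; cont.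
have [l1 h1] := pint_is_cvg c1 (fun x _ => normr_ge0 (h x)) hC.
have [||l2 h2] := @pint_is_cvg (fun y => `|h y| + h y) (C + C) c2.
- by move=> x _; have := ler_norm (- h x); rewrite normrN -subr_ge0 opprK.
- move=> x x0; rewrite pintD; [|by move=> y _; exact: c1|by move=> y _; exact: ch].
  apply: lerD; first exact: hC.
  apply: le_trans (hC _ x0); apply: le_trans (ler_norm _) _.
  by apply: pint_abs => y _; exact: ch.
exists (l2 - l1).
have -> : (fun x => pint 0 x h) = (fun x => pint 0 x (fun y => `|h y| + h y) - pint 0 x (fun y => `|h y|)).
  apply/funext => x; rewrite pintD; [ring|by move=> y _; exact: c1|by move=> y _; exact: ch].
exact: cvgB.
Qed.

Lemma pint_le_limit h (l : R) : continuous h -> (forall x, 0 <= x -> 0 <= h x) ->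
  (fun x => pint 0 x h) @ +oo --> l -> forall x, pint 0 x h <= l.
Proof.
move=> ch h0 hl x; apply: (cvgr_to_ge hl); near=> y.
by apply: pint_mono => //; near: y; apply: nbhs_pinfty_ge; exact: num_real.
Unshelve. all: by end_near. Qed.

End MonotoneLimits.

(** * Integrals of radial functions *)

Section RadialIntegral.
Context {R : realType}.
Notation mR := (measurableTypeR R).

Lemma radial_cvg (F : 'rV[R]_3 -> R) (s : R -> R) : integrable3 F -> continuous s ->
  (forall v, v != 0 -> 4 * enorm v ^+ 2 * F v = s (enorm v)) ->
  (fun x => pint 0 x s) @ +oo --> disc_area^-1 * int3 F.
Proof.
move=> iF cs Fs.
(* The sphere of radius [r] has area [4 * disc_area * r ^ 2]. The value at 0 is taken from [F],
   because [s] does not determine it. *)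
pose phi (r : R) : R := if 0 < r then s r * (4 * r ^+ 2)^-1 else F 0.
pose G (q : mR * mR) : R := phi (Num.sqrt q.1).
have mphi : measurable_fun setT (phi : mR -> mR).
  apply: measurable_fun_ifT; last exact: measurable_cst.
    apply: (@measurable_fun_ltr _ _ _ setT (cst (0:R)) id); [exact: measurable_cst|exact: measurable_id].
  apply: measurable_funM; first exact: continuous_measurable_fun.
  apply: (measurableT_comp (@measurable_inv R)).
  by apply: measurable_funM; [exact: measurable_cst|exact: measurable_funX].
have mG : measurable_fun setT G.
  exact: (measurableT_comp mphi (measurableT_comp (@measurable_sqrt R) measurable_fst)).
have FG : F \o @vec3 R = (fun p => G (sph p)).
  apply/funext => p; rewrite /G -enorm_vec3 /phi /= enorm_gt0.
  case: ifPn => [v0|]; last by rewrite negbK => /eqP ->.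
  by rewrite -Fs// mulrAC mulfV ?mul1r// mulf_neq0// expf_neq0// enorm_eq0.
have -> : int3 F = \int[leb3 R]_(p in setT) G (sph p).
  by rewrite /int3; apply: eq_Rintegral => p _; rewrite -[RHS]/((fun p => G (sph p)) p) -FG.
apply: (@shell_cvg _ G s 0).
- exact: mG.
- exact: cs.
- by move: iF; rewrite /integrable3 FG.
move=> t t0 _; set rho := Num.sqrt t; have p0 : 0 < rho by rewrite sqrtr_gt0.
have E : (\int[@lebesgue_measure R]_(z in `[(- rho)%R, rho]) (G (t, z))%:E =
   (pint (- rho) rho (fun=> phi rho))%:E)%E.
  by rewrite -eint_pint//; move=> z _; exact: cst_continuous.
rewrite E /shell_density t0 -/rho; congr EFin.
apply: (@pint_ftc_eq _ (fun z => phi rho * z)).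
- by move: p0; clear; lra.
- by move=> z _; exact: cst_continuous.
- by move=> z _; cont.
- by move=> z _; dere; rewrite /=; ring.
- by rewrite /phi p0; field; rewrite gt_eqF.
Qed.

End RadialIntegral.

(** * Decay of the profile *)

Section Decay.
Context {R : realType} (u u1 u2 : R -> R).
Context (du : forall x : R, is_derive x 1 u (u1 x))
  (du1 : forall x : R, is_derive x 1 u1 (u2 x)).
Context (b : R) (b64 : 64 <= b) (be : gau b * b ^+ 20 <= 1 / 100).
Context (X : R) (XP : forall rho, b <= rho -> pint b rho (vnorm u u1 b) <= X).

Let b0 : 0 < b. Proof. exact: lt_le_trans b64. Qed.

(** The hypothesis [be] makes [igau b] exceed [b ^ 5], hence [wt r >= r ^ 5]; this crude growth
    suffices for all the decay statements. *)
Lemma vt_ge r : b <= r -> r ^+ 4 <= vt b r.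
Proof.
move=> br; have r0 := lt_le_trans b0 br.
have b1 : 1 <= b by apply: le_trans b64; rewrite ler1n.
have rb : 1 <= r / b by rewrite ler_pdivlMr// mul1r.
have hb : b ^+ 5 <= igau b.
  have g0 := gau_gt0 b; have ig0 := igau_gt0 b.
  have h20 : b ^+ 20 <= igau b / 100.
    by rewrite -(ler_pM2l g0) (le_trans be)// gauE mulrA mulVf ?igau_neq0.
  apply: (@le_trans _ _ (b ^+ 20)); first exact: ler_weXn2l.
  by apply: (le_trans h20); rewrite ler_pdivrMr// ler_peMr ?ler1n// ltW.
have s1 : 1 <= Num.sqrt (r / b) by rewrite -[leLHS]sqrtr1 ler_wsqrtr.
rewrite /vt ler_pdivlMr// -exprSr /wt.
have -> : r ^+ 5 = b ^+ 5 * (r / b) ^+ 5 * 1 by rewrite mulr1 -exprMn mulrC divfK// gt_eqF.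
have rb0 : 0 <= r / b by rewrite (le_trans ler01).
apply: ler_pM => //; first by rewrite mulr_ge0// exprn_ge0// ltW.
apply: ler_pM => //; rewrite ?exprn_ge0 ?(ltW b0)//.
exact: ler_weXn2l.
Qed.

Let cu : continuous u := cont_u du.
Let cu1 : continuous u1 := cont_u1 du1.
Let cvn x : b <= x -> {for x, continuous (vnorm u u1 b)}.
Proof. by move=> bx; exact: (cont_vnorm du du1 b64 (lt_le_trans b0 bx)). Qed.

Lemma pint_inv_sqr x : b <= x -> pint b x (fun r => (r ^+ 2)^-1) <= 1.
Proof.
move=> bx; have x0 := lt_le_trans b0 bx.
have -> : pint b x (fun r => (r ^+ 2)^-1) = b^-1 - x^-1.
  apply: (@pint_ftc_eq _ (fun r => - r^-1)).
  - exact: bx.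
  - by move=> y /andP[by_ _]; have y0 := lt_le_trans b0 by_; cont; rewrite expf_neq0// gt_eqF.
  - by move=> y /andP[by_ _]; have y0 := lt_le_trans b0 by_; cont; rewrite gt_eqF.
  - move=> y /andP[by_ _]; have y0 := lt_trans b0 by_; dere; first by rewrite gt_eqF.
    by rewrite /=; field; rewrite gt_eqF.
  - ring.
have h1 : b^-1 <= 1 by rewrite invf_le1// (le_trans _ b64)// ler1n.
have h2 : 0 <= x^-1 by rewrite invr_ge0 ltW.
by rewrite lerBlDr (le_trans h1)// lerDl.
Qed.

Lemma pint_decay h : continuous h ->
  (forall r, b <= r -> h r <= r ^+ 4 * (u r ^+ 2 + u1 r ^+ 2) + (r ^+ 2)^-1) ->
  (forall r, 0 <= r -> 0 <= h r) ->
  forall x, 0 <= x -> pint 0 x h <= pint 0 b h + X + 1.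
Proof.
move=> ch hb h0 x x0; have [bx|xb] := leP b x; last first.
  apply: (le_trans (pint_mono ch h0 (ltW xb))).
  by rewrite -addrA lerDl addr_ge0// (X_ge0 XP).
rewrite (pint_split (ltW b0) bx); last by move=> y _; exact: ch.
rewrite -addrA lerD2l.
have ci : cont_on b x (fun r => (r ^+ 2)^-1).
  by move=> y /andP[by_ _]; have y0 := lt_le_trans b0 by_; cont; rewrite expf_neq0// gt_eqF.
have cv : cont_on b x (vnorm u u1 b) by move=> y /andP[by_ _]; exact: cvn.
apply: (@le_trans _ _ (pint b x (fun r => vnorm u u1 b r + (r ^+ 2)^-1))).
  apply: pint_le.
  - by move=> y _; exact: ch.
  - by move=> y hy; have ? := ci y hy; have ? := cv y hy; cont.
  move=> y /andP[by_ _]; apply: (le_trans (hb y by_)).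
  by rewrite lerD2r ler_wpM2r ?vt_ge// addr_ge0// sqr_ge0.
by rewrite pintD// lerD ?XP ?pint_inv_sqr.
Qed.

Lemma abs_le_sqr (r x : R) : 0 < r -> `|x| <= r ^+ 2 * x ^+ 2 + (r ^+ 2)^-1.
Proof.
move=> r0; have e : (r * `|x| - r^-1) ^+ 2 = r ^+ 2 * `|x| ^+ 2 + (r ^+ 2)^-1 - 2 * `|x|.
  by field; rewrite gt_eqF.
have := sqr_ge0 (r * `|x| - r^-1); rewrite e real_normK ?num_real//.
by have := normr_ge0 x; lra.
Qed.

Lemma pint_abs_u x : 0 <= x ->
  pint 0 x (fun r => r * `|u r|) <= pint 0 b (fun r => r * `|u r|) + X + 1.
Proof.
apply: pint_decay.
- by move=> y; have ? : {for y, continuous u} := @cu y; cont.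
- move=> r br; have r0 := lt_le_trans b0 br.
  have := abs_le_sqr (r * u r) r0; rewrite normrM gtr0_norm// => h.
  apply: (le_trans h); rewrite lerD2r exprMn mulrA -exprD.
  by apply: ler_wpM2l; [rewrite exprn_ge0// ltW|rewrite lerDl sqr_ge0].
- by move=> r r0; rewrite mulr_ge0.
Qed.

Lemma pint_abs_u1 x : 0 <= x ->
  pint 0 x (fun r => `|u1 r|) <= pint 0 b (fun r => `|u1 r|) + X + 1.
Proof.
apply: pint_decay => //.
- by move=> y; have ? : {for y, continuous u1} := @cu1 y; cont.
- move=> r br; have r0 := lt_le_trans b0 br.
  apply: (le_trans (abs_le_sqr (u1 r) r0)); rewrite lerD2r.
  have r1 : 1 <= r by apply: le_trans br; apply: le_trans b64; rewrite ler1n.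
  apply: (@le_trans _ _ (r ^+ 4 * u1 r ^+ 2)).
    by apply: ler_wpM2r; [exact: sqr_ge0|exact: ler_weXn2l].
  by apply: ler_wpM2l; [rewrite exprn_ge0// ltW|rewrite lerDr sqr_ge0].
Qed.

(** The derivative of [r * u ^ 2] is bounded by [2 * vnorm], whose integral is at most [2 * X]. *)
Lemma sqr_u_decay r : b <= r -> r * u r ^+ 2 <= b * u b ^+ 2 + 2 * X.
Proof.
move=> br.
have cg : continuous (fun r => u r ^+ 2 + 2 * r * (u r * u1 r)).
  move=> y; have ? : {for y, continuous u} := @cu y.
  by have ? : {for y, continuous u1} := @cu1 y; cont.
have E : pint b r (fun r => u r ^+ 2 + 2 * r * (u r * u1 r)) = r * u r ^+ 2 - b * u b ^+ 2.
  apply: (@pint_ftc_eq _ (fun r => r * u r ^+ 2)) => //.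
  - by move=> y _; exact: cg.
  - by move=> y _; have ? : {for y, continuous u} := @cu y; cont.
  - by move=> y _; have ? := du y; dere; rewrite /=; ring.
rewrite -lerBlDl -E.
have cv : cont_on b r (vnorm u u1 b) by move=> y /andP[by_ _]; exact: cvn.
apply: (@le_trans _ _ (pint b r (fun r => 2 * vnorm u u1 b r))).
  apply: pint_le.
  - by move=> y _; exact: cg.
  - by move=> y hy; have ? := cv y hy; cont.
  move=> y /andP[by_ _].
  have y1 : 1 <= y by apply: le_trans by_; apply: le_trans b64; rewrite ler1n.
  have y4 : y ^+ 2 <= vt b y by apply: le_trans (vt_ge by_); exact: ler_weXn2l.
  apply: (@le_trans _ _ (2 * (y ^+ 2 * (u y ^+ 2 + u1 y ^+ 2)))); last first.
    by rewrite ler_pM2l// ler_wpM2r// addr_ge0// sqr_ge0.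
  have y2 : 1 <= y ^+ 2 by rewrite -[leLHS](expr1n _ 2) ler_pXn2r ?nnegrE// (le_trans ler01).
  have := sqr_ge0 (y * u y - u1 y).
  move: (u y) (u1 y) => a c h.
  have k1 : a ^+ 2 <= y ^+ 2 * a ^+ 2 by rewrite ler_peMl// sqr_ge0.
  have k3 : 0 <= c ^+ 2 by exact: sqr_ge0.
  have k2 : c ^+ 2 <= y ^+ 2 * c ^+ 2 by rewrite ler_peMl// sqr_ge0.
  by lra.
by rewrite pintZ// ler_pM2l// XP.
Qed.

Lemma u_cvg0 : u @ +oo --> (0 : R).
Proof.
apply/cvgrPdist_lt => e e0; near=> r.
rewrite sub0r normrN.
have br : b <= r by near: r; apply: nbhs_pinfty_ge; exact: num_real.
have r0 := lt_le_trans b0 br.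
have hr : (b * u b ^+ 2 + 2 * X) / e ^+ 2 < r by near: r; apply: nbhs_pinfty_gt; exact: num_real.
rewrite ltr_pdivrMr ?exprn_gt0// in hr.
have := le_lt_trans (sqr_u_decay br) hr; rewrite ltr_pM2l// -[u r ^+ 2]real_normK ?num_real//.
by rewrite ltr_pXn2r ?nnegrE// ltW.
Unshelve. all: by end_near. Qed.

Lemma mom1_cvg : exists l : R, mom u 1 @ +oo --> l.
Proof.
have c1 : continuous (fun r : R => r ^+ 1 * u r) by exact: (cont_monom_u du).
apply: (pint_is_cvg_abs c1 (C := pint 0 b (fun r => r * `|u r|) + X + 1)) => x x0.
apply: le_trans (pint_abs_u x0); rewrite le_eqVlt; apply/orP; left; apply/eqP.
by apply: eq_pint => r /andP[r0 _]; rewrite expr1 normrM ger0_norm.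
Qed.

End Decay.

(** * The weight and the coercivity estimate *)

Section RadialWeight.
Context {R : realType} (b : R) (b64 : 64 <= b).
Notation mR := (measurableTypeR R).

Let b0 : 0 < b. Proof. exact: lt_le_trans b64. Qed.
Let b1 : 1 <= b. Proof. by apply: le_trans b64; rewrite ler1n. Qed.

(* [cap b r] is [min b r], so that [b + r - cap b r] is [max b r]. *)
Definition wrad (r : R) : R :=
  igau (cap b r) * ((b + r - cap b r) / b) ^+ 10 * Num.sqrt ((b + r - cap b r) / b).

Lemma wrad_in r : r <= b -> wrad r = igau r.
Proof.
move=> rb; rewrite /wrad (cap_lt rb) addrK divff ?gt_eqF//.
by rewrite expr1n sqrtr1 !mulr1.
Qed.

Lemma wrad_out r : b <= r -> wrad r = wt b r.
Proof.
by move=> br; rewrite /wrad (cap_gt br) addrAC subrr add0r.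
Qed.

Lemma cont_wrad : continuous wrad.
Proof.
move=> r; have c := @cont_cap _ b.
have ci : {for r, continuous (fun x : R => igau (cap b x))}.
  by apply: (@continuous_comp _ _ _ (cap b) igau); [exact: c|exact: cont_igau].
have ch : {for r, continuous (fun x : R => (b + x - cap b x) / b)} by cont.
exact: (contM (contM ci (contX (n := 10) ch)) (cont_sqrt ch)).
Qed.

Lemma igau_ge1 (x : R) : 1 <= igau x.
Proof. by rewrite /igau -expR0 ler_expR sqr_ge0. Qed.

Lemma igau_le (x y : R) : 0 <= x -> x <= y -> igau x <= igau y.
Proof. by move=> x0 xy; rewrite ler_expR ler_pXn2r// nnegrE (le_trans x0). Qed.

Lemma wrad_ge1 r : 0 <= r -> 1 <= wrad r.
Proof.
move=> r0; have h : 1 <= (b + r - cap b r) / b.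
  have [rb|rb] := leP r b; first by rewrite (cap_lt rb) addrK divff ?gt_eqF.
  by rewrite (cap_gt (ltW rb)) addrAC subrr add0r ler_pdivlMr// mul1r ltW.
have e1 : 1 <= igau (cap b r) := igau_ge1 _.
have e2 : 1 <= ((b + r - cap b r) / b) ^+ 10 by exact: exprn_ege1.
have e3 : 1 <= Num.sqrt ((b + r - cap b r) / b) by rewrite -[leLHS]sqrtr1 ler_wsqrtr.
by rewrite /wrad mulr_ege1// mulr_ege1.
Qed.

Lemma wrad_le r : 0 <= r -> wrad r <= igau b * Num.sqrt (1 + r ^+ 2) `^ (21 / 2).
Proof.
move=> r0; set q := Num.sqrt (1 + r ^+ 2).
have q1 : 1 <= q by rewrite -[leLHS]sqrtr1 ler_wsqrtr// lerDl sqr_ge0.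
have q0 : 0 < q by exact: lt_le_trans q1.
have rq : r <= q by rewrite -[leLHS]ger0_norm// -sqrtr_sqr ler_wsqrtr// lerDr.
have hq : 0 <= (b + r - cap b r) / b <= q.
  have [rb|rb] := leP r b.
    by rewrite (cap_lt rb) addrK divff ?gt_eqF// q1 ler01.
  rewrite (cap_gt (ltW rb)) addrAC subrr add0r divr_ge0 ?(ltW b0)//=.
  by rewrite ler_pdivrMr// (le_trans rq)// ler_peMr// ltW.
have /andP[h0 h1] := hq.
have -> : 21 / 2 = 10%:R + 2^-1 :> R by field.
rewrite powRD; last by apply/implyP => _; rewrite gt_eqF.
rewrite powR_mulrn ?(ltW q0)// powR12_sqrt ?(ltW q0)// mulrA /wrad.
have gc : 0 <= igau (cap b r) by exact/ltW/igau_gt0.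
have /andP[c0 cb] := cap_bound b0 r0.
apply: ler_pM; [by rewrite mulr_ge0 ?exprn_ge0|exact: sqrtr_ge0| |exact: ler_wsqrtr].
apply: ler_pM; [exact: gc|exact: exprn_ge0|exact: igau_le|].
by rewrite ler_pXn2r// nnegrE (ltW q0).
Qed.

Definition weight (v : 'rV[R]_3) : R := wrad (enorm v).

Lemma measurable_weight : measurable3 weight.
Proof.
apply: (measurableT_comp (f := (wrad : mR -> mR))); last exact: measurable_enorm_vec3.
by apply: continuous_measurable_fun; exact: cont_wrad.
Qed.

End RadialWeight.

(** * The choice of the radius [b] *)

Section Threshold.
Context {R : realType}.

(** A power of 2 reduces [threshold_gau] to comparing exponents: the exponential of [2 ^ 20] is at
    least [(2 ^ 15) ^ 32], against [100 * 2 ^ 200]. *)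
Definition threshold : R := 2 ^+ 10.

Lemma threshold_ge64 : 64 <= threshold.
Proof.
have -> : 64 = 2 ^+ 6 :> R by ring.
by apply: ler_weXn2l => //; rewrite ler1n.
Qed.

Lemma threshold_gau : gau threshold * threshold ^+ 20 <= 1 / 100.
Proof.
have e : igau threshold = expR (2 ^+ 15) ^+ 32.
  rewrite /igau -expRM_natl; congr expR; rewrite /threshold.
  have -> : 32%:R = 2 ^+ 5 :> R by ring.
  by rewrite -exprM -exprD.
have h : (2 ^+ 15) ^+ 32 <= igau threshold.
  rewrite e ler_pXn2r ?nnegrE ?exprn_ge0 ?expR_ge0//.
  by apply: le_trans (expR_ge1Dx _); rewrite lerDr.
have h2 : 100 * threshold ^+ 20 <= igau threshold.
  apply: le_trans h; rewrite /threshold -!exprM.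
  apply: (@le_trans _ _ (2 ^+ 7 * 2 ^+ (10 * 20))).
    by rewrite ler_pM2r ?exprn_gt0//; have -> : 2 ^+ 7 = 128 :> R by [ring]; rewrite ler_nat.
  by rewrite -exprD; apply: ler_weXn2l; rewrite ?ler1n.
rewrite gauE mulrC ler_pdivrMr ?igau_gt0//.
by move: h2; lra.
Qed.

End Threshold.

(** * The boundary term at infinity *)

Section Boundary.
Context {R : realType} (u u1 u2 : R -> R) (H0 : R).
Context (du : forall x : R, is_derive x 1 u (u1 x))
  (du1 : forall x : R, is_derive x 1 u1 (u2 x)).
Context (b : R) (b64 : 64 <= b) (be : gau b * b ^+ 20 <= 1 / 100).
Context (X : R) (XP : forall rho, b <= rho -> pint b rho (vnorm u u1 b) <= X).
Context (t : R) (Zt : forall r, b <= r -> `|Zf u H0 r| <= t).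

Let b0 : 0 < b. Proof. exact: lt_le_trans b64. Qed.

Definition bterm (r : R) : R := Sflux u u1 H0 r * (u r * wt b r).

(** In the local part [wt = r * vt] and [gmass <= 1 / 2]; in the nonlocal part the Gaussian absorbs
    the weight by [wt_gau_le1]. *)
Lemma bterm_le r : b <= r -> bterm r <= r * (vnorm u u1 b r + t * (r * `|u r|)).
Proof.
move=> br; have r0 := lt_le_trans b0 br.
have r1 : 1 <= r by apply: le_trans br; apply: le_trans b64; rewrite ler1n.
have v0 := vt_gt0 b64 r0.
have t0 : 0 <= t by exact: le_trans (Zt br).
have h1 : gdiff r * gfun u u1 r * (u r * wt b r) <= r * vnorm u u1 b r.
  have -> : gdiff r * gfun u u1 r * (u r * wt b r) =
      vt b r * (gmass r * (u r * u1 r / 2 + r * u r ^+ 2)).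
    by rewrite /gdiff /gfun (wtE b r0); field; rewrite gt_eqF.
  rewrite /vnorm [leRHS]mulrCA ler_pM2l//.
  have g0 := gmass_ge0 r; have gh := gmass_le_half (ltW r0).
  have k : u r * u1 r / 2 + r * u r ^+ 2 <= 2 * (r * (u r ^+ 2 + u1 r ^+ 2)).
    have := sqr_ge0 (u r - u1 r); have := sqr_ge0 (u1 r); have := sqr_ge0 (u r).
    move: (u r) (u1 r) => a c a2 c2 h.
    have k1 : a ^+ 2 <= r * a ^+ 2 by rewrite ler_peMl.
    have k2 : c ^+ 2 <= r * c ^+ 2 by rewrite ler_peMl.
    by move: a2 c2 h k1 k2; lra.
  have k0 : 0 <= r * (u r ^+ 2 + u1 r ^+ 2) by rewrite mulr_ge0 ?(ltW r0)// addr_ge0// sqr_ge0.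
  move: (r * (u r ^+ 2 + u1 r ^+ 2)) k k0 => Y k k0.
  apply: (le_trans (ler_wpM2l g0 k)).
  have -> : gmass r * (2 * Y) = (gmass r * 2) * Y by ring.
  by rewrite ler_piMl// -ler_pdivlMr.
have h2 : - (gau r * Zf u H0 r) * (u r * wt b r) <= t * `|u r|.
  apply: (le_trans (ler_norm _)).
  rewrite mulNr normrN normrM [`|gau r * _|]normrM [`|u r * _|]normrM (gtr0_norm (gau_gt0 r)) (gtr0_norm (wt_gt0 b64 r0)).
  have -> : gau r * `|Zf u H0 r| * (`|u r| * wt b r) = (wt b r * gau r) * (`|Zf u H0 r| * `|u r|) by ring.
  apply: (@le_trans _ _ (`|Zf u H0 r| * `|u r|)).
    by rewrite ler_piMl ?mulr_ge0// wt_gau_le1.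
  by rewrite ler_wpM2r// Zt.
have h3 : t * `|u r| <= r * (t * (r * `|u r|)).
  have n0 : 0 <= t * `|u r| by rewrite mulr_ge0.
  have -> : r * (t * (r * `|u r|)) = r * (r * (t * `|u r|)) by ring.
  by rewrite (@le_trans _ _ (r * (t * `|u r|)))// ?ler_peMl// mulr_ge0// ltW.
have -> : bterm r = gdiff r * gfun u u1 r * (u r * wt b r) + - (gau r * Zf u H0 r) * (u r * wt b r).
  by rewrite /bterm /Sflux; ring.
by rewrite [leRHS]mulrDr; exact: lerD h1 (le_trans h2 h3).
Qed.

(* [bterm r / r] is bounded by an integrable function, and [1 / r] is not integrable at infinity. *)
Lemma bterm_small (eta rho0 : R) : 0 < eta -> b <= rho0 ->
  exists2 r, rho0 <= r & bterm r <= eta.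
Proof.
move=> eta0 b_rho; apply: contrapT => H.
have p0 := lt_le_trans b0 b_rho.
have lb r : rho0 <= r -> eta < bterm r.
  by move=> hr; rewrite ltNge; apply/negP => h; apply: H; exists r.
have t0 : 0 <= t by exact: le_trans (Zt (lexx b)).
set M := X + t * (pint 0 b (fun r => r * `|u r|) + X + 1).
have M0 : 0 <= M.
  have X0 := X_ge0 XP.
  rewrite addr_ge0// mulr_ge0// addr_ge0// addr_ge0//.
  by apply: pint_ge0 => y /andP[y0 _]; rewrite mulr_ge0.
(* Chosen so that [eta / r] has integral [M + eta] over [[rho0, x]], more than the bound [M] for the
   majorant of [bterm r / r]. *)
pose x := rho0 * expR (M / eta + 1).
have px : rho0 <= x.
  have q0 : 0 <= M / eta by rewrite divr_ge0// ltW.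
  by rewrite ler_peMr ?(ltW p0)// -[leLHS]expR0 ler_expR addr_ge0.
have cu := cont_u du.
have cv : cont_on rho0 x (vnorm u u1 b).
  by move=> y /andP[hy _]; exact: (cont_vnorm du du1 b64 (lt_le_trans p0 hy)).
have cr (y : R) : {for y, continuous (fun r : R => r * `|u r|)}.
  by have ? : {for y, continuous u} := @cu y; cont.
have ctr (y : R) : {for y, continuous (fun r : R => t * (r * `|u r|))} by have ? := cr y; cont.
have ci : cont_on rho0 x (fun r : R => eta * r^-1).
  by move=> y /andP[hy _]; cont; rewrite gt_eqF// (lt_le_trans p0).
have E : pint rho0 x (fun r => eta * r^-1) = M + eta.
  apply: (@pint_ftc_eq _ (fun r => eta * ln r)).
  - exact: px.
  - exact: ci.
  - move=> y /andP[hy _]; have y0 := lt_le_trans p0 hy.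
    have d := is_derive1_ln y0; have ? := der_cont d; cont.
  - move=> y /andP[hy _]; have y0 := lt_trans p0 hy.
    by have d := is_derive1_ln y0; dere; rewrite /=; ring.
  - rewrite /x lnM ?posrE ?expR_gt0// expRK; field.
    by rewrite gt_eqF.
have L1 : pint rho0 x (fun r => eta * r^-1) <=
    pint rho0 x (fun r => vnorm u u1 b r + t * (r * `|u r|)).
  apply: pint_le => //.
  - by move=> y hy; have ? := cv y hy; have ? := ctr y; cont.
  move=> y /andP[hy _]; have y0 := lt_le_trans p0 hy.
  rewrite ler_pdivrMr// mulrC.
  by apply: le_trans (bterm_le (le_trans b_rho hy)); exact/ltW/lb.
have L2 : pint rho0 x (vnorm u u1 b) <= X.
  apply: le_trans (XP (le_trans b_rho px)).
  rewrite [leRHS](pint_split b_rho px); last first.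
    by move=> y /andP[hy _]; exact: (cont_vnorm du du1 b64 (lt_le_trans b0 hy)).
  rewrite lerDr; apply: pint_ge0 => y /andP[hy _].
  exact: (vnorm_ge0 _ _ b64 (lt_le_trans b0 hy)).
have L3 : pint rho0 x (fun r => r * `|u r|) <= pint 0 b (fun r => r * `|u r|) + X + 1.
  have x0 := le_trans (ltW p0) px.
  apply: le_trans (pint_abs_u du du1 b64 be XP x0).
  rewrite [leRHS](pint_split (ltW p0) px); last by move=> y _; exact: cr.
  by rewrite lerDr; apply: pint_ge0 => y /andP[y0 _]; rewrite mulr_ge0.
have : M + eta <= M.
  rewrite -{1}E; apply: (le_trans L1); rewrite (pintD cv (fun y _ => ctr y)).
  rewrite (pintZ t (fun y _ => cr y)); apply: lerD L2 _.
  exact: ler_wpM2l.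
by rewrite gerDl leNgt eta0.
Qed.

End Boundary.

Lemma cont_scale_axis (R : realType) (h : 'rV[R]_3 -> R) : continuous h ->
  continuous (fun t : R => h (t *: axis3)).
Proof.
move=> ch t.
apply: (@continuous_comp _ _ _ (fun t : R => t *: (axis3 : 'rV[R]_3)) h); last exact: ch.
exact: scalel_continuous.
Qed.

(** * The estimate for a single function *)

Section Coercivity.
Context {R : realType}.
Local Notation b := (@threshold R).
Local Notation k := ((8 * pi)^-1 : R).

Let b64 : 64 <= b := threshold_ge64.
Let be : gau b * b ^+ 20 <= 1 / 100 := threshold_gau.
Let b0 : 0 < b. Proof. exact: lt_le_trans b64. Qed.

Variable f : 'rV[R]_3 -> R.
Hypotheses (f2 : C2 f) (rf : radial f).

Let u (t : R) : R := f (t *: axis3).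
Let u1 (t : R) : R := partial ord_max f (t *: axis3).
Let u2 (t : R) : R := partial ord_max (partial ord_max f) (t *: axis3).

Let pf : profile f u u1.
Proof. by apply: radial_profile => //; case: f2. Qed.

Let du : forall x : R, is_derive x 1 u (u1 x). Proof. by case: pf. Qed.

Let du1 (x : R) : is_derive x 1 u1 (u2 x).
Proof.
have [_ /(_ ord_max) [_ /(_ ord_max) [d _]]] := f2.
have := @is_derive_along R ord_max (partial ord_max f) 0 x; rewrite addr0 => /(_ (d _)).
by congr (is_derive _ _ _ _); apply/funext => h; rewrite addr0.
Qed.

Let cu2 : continuous u2.
Proof.
have [_ /(_ ord_max) [_ /(_ ord_max) [_ c]]] := f2.
exact: cont_scale_axis.
Qed.

Let cu : continuous u := cont_u du.
Let cu1 : continuous u1 := cont_u1 du1.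

Let fE v : f v = u (enorm v). Proof. by case: pf. Qed.

Definition density (r : R) : R :=
  4 * r ^+ 2 * (Num.sqrt (1 + r ^+ 2) ^+ 3)^-1 * (u r ^+ 2 + u1 r ^+ 2) * wrad b r.

Let q1 (r : R) : 1 <= Num.sqrt (1 + r ^+ 2).
Proof. by rewrite -[leLHS]sqrtr1 ler_wsqrtr// lerDl sqr_ge0. Qed.

Let q0 (r : R) : 0 < Num.sqrt (1 + r ^+ 2).
Proof. exact: lt_le_trans (q1 r). Qed.

Lemma cont_density : continuous density.
Proof.
move=> r; have ? : {for r, continuous u} := @cu r.
have ? : {for r, continuous u1} := @cu1 r.
have ? : {for r, continuous (wrad b)} := @cont_wrad _ _ r.
by rewrite /density; cont; rewrite expf_neq0// gt_eqF// q0.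
Qed.

Lemma density_ge0 r : 0 <= r -> 0 <= density r.
Proof.
move=> r0; rewrite /density mulr_ge0//; last by rewrite (le_trans ler01)// wrad_ge1.
rewrite mulr_ge0 ?addr_ge0 ?sqr_ge0//.
by rewrite mulr_ge0 ?invr_ge0 ?exprn_ge0 ?sqrtr_ge0// mulr_ge0// sqr_ge0.
Qed.

Lemma density_in r : 0 <= r -> r <= b ->
  density r <= 4 * igau b * (r ^+ 2 * (u r ^+ 2 + u1 r ^+ 2)).
Proof.
move=> r0 rb; rewrite /density (wrad_in b64 rb).
have -> : 4 * r ^+ 2 * (Num.sqrt (1 + r ^+ 2) ^+ 3)^-1 * (u r ^+ 2 + u1 r ^+ 2) * igau r =
  4 * (r ^+ 2 * (u r ^+ 2 + u1 r ^+ 2)) * ((Num.sqrt (1 + r ^+ 2) ^+ 3)^-1 * igau r) by ring.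
have -> : 4 * igau b * (r ^+ 2 * (u r ^+ 2 + u1 r ^+ 2)) =
  4 * (r ^+ 2 * (u r ^+ 2 + u1 r ^+ 2)) * igau b by ring.
apply: ler_wpM2l; first by rewrite mulr_ge0// mulr_ge0 ?addr_ge0 ?sqr_ge0.
rewrite -[leRHS]mul1r; apply: ler_pM; [|exact/ltW/igau_gt0| |exact: igau_le].
  by rewrite invr_ge0 exprn_ge0// sqrtr_ge0.
by rewrite invf_le1 ?exprn_gt0// exprn_ege1.
Qed.

(* [r <= sqrt (1 + r^2) <= (3 / 2) r] for [r >= 1], and [(3 / 2)^3 <= 4]. *)
Lemma density_out r : b <= r -> vnorm u u1 b r <= density r <= 4 * vnorm u u1 b r.
Proof.
move=> br; have r0 := lt_le_trans b0 br.
have r1 : 1 <= r by apply: le_trans br; apply: le_trans b64; rewrite ler1n.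
set q := Num.sqrt (1 + r ^+ 2).
have rq : r <= q by rewrite -[leLHS]ger0_norm ?(ltW r0)// -sqrtr_sqr ler_wsqrtr// lerDr.
have qr : q <= 3 / 2 * r.
  rewrite -[leRHS]ger0_norm ?mulr_ge0 ?(ltW r0)// -sqrtr_sqr ler_wsqrtr//.
  have : 1 <= r ^+ 2 by rewrite exprn_ege1.
  by rewrite exprMn; move: (r ^+ 2) => x; lra.
have qq := q0 r; rewrite -/q in qq.
have E : density r = 4 * (r ^+ 3 / q ^+ 3) * vnorm u u1 b r.
  rewrite /density (wrad_out br) -/q (wtE b r0) /vnorm; move: (vt b r) => V.
  by field; rewrite gt_eqF.
have v0 := vnorm_ge0 u u1 b64 r0.
have p3 : 0 < q ^+ 3 by rewrite exprn_gt0.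
rewrite E; apply/andP; split.
  rewrite ler_peMl// mulrA ler_pdivlMr// mul1r.
  apply: (@le_trans _ _ ((3 / 2 * r) ^+ 3)).
    by rewrite ler_pXn2r// nnegrE ?mulr_ge0 ?ltW.
  rewrite exprMn ler_pM2r ?exprn_gt0//.
  have -> : (3 / 2) ^+ 3 = 27 / 8 :> R by field.
  by lra.
rewrite -mulrA ler_pM2l// ler_piMl// ler_pdivrMr// mul1r.
by rewrite ler_pXn2r// nnegrE ltW.
Qed.

Hypothesis mass0 : orthogonal3 f (fun _ => 1).
Hypothesis energy0 : orthogonal3 f (fun v => enorm v ^+ 2).
Hypothesis iQ : integrable3 (fun v => linearized_Q f v * f v * weight b v).
Hypothesis iD : integrable3 (fun v => bracket v ^- 3 * (f v ^+ 2 + grad_sqr f v) * weight b v).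

Let dD : R := disc_area^-1 * int3 (fun v => bracket v ^- 3 * (f v ^+ 2 + grad_sqr f v) * weight b v).

Let cvD : (fun x => pint 0 x density) @ +oo --> dD.
Proof.
apply: (radial_cvg iD cont_density) => v v0.
by rewrite fE (profile_grad_sqr v pf) /density /bracket /weight; ring.
Qed.

Let density_le x : pint 0 x density <= dD.
Proof. exact: (pint_le_limit cont_density density_ge0 cvD). Qed.

Let vn (rho : R) : R := pint b rho (vnorm u u1 b).

Let cvn y : b <= y -> {for y, continuous (vnorm u u1 b)}.
Proof. by move=> h; exact: (cont_vnorm du du1 b64 (lt_le_trans b0 h)). Qed.

Let vn_mono x y : b <= x -> x <= y -> vn x <= vn y.
Proof.
move=> bx xy; rewrite /vn [leRHS](pint_split bx xy); last by move=> z /andP[h _]; exact: cvn.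
rewrite lerDl; apply: pint_ge0 => z /andP[h _].
exact: (vnorm_ge0 _ _ b64 (lt_le_trans b0 (le_trans bx h))).
Qed.

Let vn_le rho : b <= rho -> vn rho <= dD.
Proof.
move=> br; apply: le_trans (density_le rho).
rewrite [leRHS](pint_split (ltW b0) br); last by move=> z _; exact: cont_density.
apply: (@le_trans _ _ (pint b rho density)).
  apply: pint_le => [z /andP[h _]|z _|z /andP[h _]]; [exact: cvn|exact: cont_density|].
  by have /andP[] := density_out h.
by rewrite lerDr; apply: pint_ge0 => z /andP[h _]; exact: density_ge0.
Qed.

Let S : set R := [set vn rho | rho in [set rho | b <= rho]].
(** Finite because [iD] bounds the outer norms by [dD]. Being a supremum, it is approached by
    [vn rho], which later absorbs the error [X / 100]. *)
Let X : R := sup S.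

Let supS : has_sup S.
Proof.
split; first by exists (vn b), b => //=; exact: lexx.
by exists dD => _ [rho /= br <-]; exact: vn_le.
Qed.

Let XP rho : b <= rho -> pint b rho (vnorm u u1 b) <= X.
Proof. by move=> br; apply: ub_le_sup; [case: supS|exists rho]. Qed.

Let X_near e : 0 < e -> \forall rho \near +oo, X - e <= vn rho.
Proof.
move=> e0; have [_ [rho0 /= br <-] h] := sup_adherent e0 supS.
near=> rho; apply: (le_trans (ltW h)); apply: (vn_mono br).
by near: rho; apply: nbhs_pinfty_ge; exact: num_real.
Unshelve. all: by end_near. Qed.

Let mom_cvg0 (n : nat) (h : 'rV[R]_3 -> R) : orthogonal3 f h ->
  (forall v, enorm v ^+ 2 * h v = enorm v ^+ n) -> mom u n @ +oo --> (0 : R).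
Proof.
move=> [ih h0] hE.
have c4 : continuous (fun r : R => 4 * (r ^+ n * u r)).
  by move=> r; have ? : {for r, continuous u} := @cu r; cont.
have c : (fun x => pint 0 x (fun r : R => 4 * (r ^+ n * u r))) @ +oo --> (0 : R).
  have := radial_cvg ih c4; rewrite h0 mulr0; apply=> v v0.
  by rewrite -hE -fE; ring.
have {}c : (fun x => 4^-1 * pint 0 x (fun r : R => 4 * (r ^+ n * u r))) @ +oo --> (4^-1 * 0 : R).
  exact: cvgMr.
rewrite mulr0 in c; apply: cvg_trans c; apply: near_eq_cvg; near=> x.
rewrite pintZ; last by move=> y _; exact: (cont_monom_u du).
by rewrite mulrA mulVf// mul1r.
Unshelve. all: by end_near. Qed.

Let m20 : mom u 2 @ +oo --> (0 : R).
Proof. by apply: (mom_cvg0 mass0) => v; rewrite mulr1. Qed.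

Let m40 : mom u 4 @ +oo --> (0 : R).
Proof. by apply: (mom_cvg0 energy0) => v; rewrite -exprD. Qed.

(** The division by [igau b] pays for [density_in] on [[0, b]]; [3 / 200] is [1 / 40 - 1 / 100],
    what the error [X / 100] leaves of the outer norm. *)
Let rate : R := Num.min (inner_rate b / igau b) (3 / 200).

Lemma coercivity : int3 (fun v => linearized_Q f v * f v * weight b v) <=
  - (8 * disc_area * k * rate) *
  int3 (fun v => bracket v ^- 3 * (f v ^+ 2 + grad_sqr f v) * weight b v).
Proof.
have [H0 H0_oo] := mom1_cvg du du1 b64 be XP.
have u_oo := u_cvg0 du du1 b64 be XP.
have tH0 : tailH u H0 @ +oo --> (0 : R).
  have : (fun x => H0 - mom u 1 x) @ +oo --> (H0 - H0 : R) by apply: cvgB => //; exact: cvg_cst.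
  by rewrite subrr.
have Zt := Zf_tail du du1 b64 XP m20 m40 tH0.
set K : R := 32 * disc_area * k.
have kd0 := @disc_area_gt0 R.
have k0 : 0 < k by rewrite invr_gt0 mulr_gt0// pi_gt0.
have K0 : 0 < K by rewrite mulr_gt0// mulr_gt0.
(* [radial_cvg] asks for continuity on the whole line, [cont_Sflux1] gives it on the half-line; the
   absolute value bridges the two. *)
pose sQ (r : R) : R := Sflux1 u u1 u2 H0 `|r| * (u r * wrad b r).
have cS (r : R) : {for r, continuous (fun r : R => Sflux1 u u1 u2 H0 `|r|)}.
  apply: (@continuous_comp _ _ _ (fun r : R => `|r|) (Sflux1 u u1 u2 H0)).
    exact: norm_continuous.
  exact: (cont_Sflux1 du du1 cu2 (normr_ge0 r)).
have csQ : continuous sQ.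
  move=> r; have ? : {for r, continuous u} := @cu r; have ? := cS r.
  by have ? : {for r, continuous (wrad b)} := @cont_wrad _ _ r; rewrite /sQ; cont.
have cKQ : continuous (fun r => K * sQ r) by move=> r; have ? : {for r, continuous sQ} := @csQ r; cont.
have cvQ : (fun x => pint 0 x (fun r => K * sQ r)) @ +oo -->
    disc_area^-1 * int3 (fun v => linearized_Q f v * f v * weight b v).
  apply: (radial_cvg iQ cKQ) => v v0.
  rewrite (linearized_QE pf du1 (pint_abs_u du du1 b64 be XP) (pint_abs_u1 du du1 b64 be XP) u_oo H0_oo v0).
  rewrite fE /sQ /weight ger0_norm ?enorm_ge0// /K.
  move: ((8 * pi)^-1) => k'; field.
  by rewrite enorm_eq0.
move: (int3 (fun v => linearized_Q f v * f v * weight b v)) cvQ => IQ cvQ.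
set P : R := pint 0 b (fun r => r ^+ 2 * (u r ^+ 2 + u1 r ^+ 2)).
have P0 : 0 <= P.
  by apply: pint_ge0 => r /andP[r0 _]; rewrite mulr_ge0 ?addr_ge0 ?sqr_ge0.
have X0 : 0 <= X := X_ge0 XP.
have upper : disc_area^-1 * IQ <= K * (- inner_rate b * P - 3 / 200 * X).
  apply/ler_addgt0Pr => e e0; pose d := e / (4 * K).
  have d0 : 0 < d by rewrite divr_gt0// mulr_gt0.
  have e2 : 0 < e / 2 by rewrite divr_gt0.
  have near1 : \forall rho \near +oo, disc_area^-1 * IQ - e / 2 <= pint 0 rho (fun r => K * sQ r).
    move/cvgrPdist_le : cvQ => /(_ _ e2); apply: filterS => rho.
    by rewrite ler_distlC => /andP[].
  (* These two properties hold for all large radii, the smallness of the boundary term only for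
     some; so [bterm_small] is applied last, beyond [M]. *)
  have [M [_ hM]] : \forall rho \near +oo,
      disc_area^-1 * IQ - e / 2 <= pint 0 rho (fun r => K * sQ r) /\ X - d <= vn rho.
    by near=> rho; split; near: rho => //; exact: X_near.
  have [rho hrho small] := bterm_small du du1 b64 be XP Zt d0 (le_trans (lexx b) (ler_wpDl (normr_ge0 M) (lexx b))).
  have br : b <= rho by apply: le_trans hrho; rewrite lerDr.
  have [h1 h2] : disc_area^-1 * IQ - e / 2 <= pint 0 rho (fun r => K * sQ r) /\ X - d <= vn rho.
    by apply: hM; apply: lt_le_trans hrho; rewrite (le_lt_trans (ler_norm M))// ltrDl.
  have fe := flux_energy du du1 cu2 b64 XP m20 m40 tH0 be br.
  have E : pint 0 rho (fun r => K * sQ r) =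
      K * (pint 0 b (fun r => Sflux1 u u1 u2 H0 r * hf u r) +
           pint b rho (fun r => Sflux1 u u1 u2 H0 r * (u r * wt b r))).
    rewrite pintZ; last by move=> y _; exact: csQ.
    rewrite (pint_split (ltW b0) br); last by move=> y _; exact: csQ.
    congr (_ * (_ + _)); apply: eq_pint => r /andP[r0 rb]; rewrite /sQ.
      by rewrite ger0_norm// (wrad_in b64 rb).
    by rewrite ger0_norm ?(le_trans (ltW b0))// (wrad_out r0).
  rewrite E in h1; rewrite -/(vn rho) -/P -/(bterm u u1 H0 b rho) in fe.
  have {fe} := le_trans fe (_ : _ <= - inner_rate b * P - 3 / 200 * X + 2 * d).
  have hb : bterm u u1 H0 b rho - inner_rate b * P - 1 / 40 * vn rho + X / 100 <=
      - inner_rate b * P - 3 / 200 * X + 2 * d.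
    by move: small h2 d0; rewrite mulNr; move: (bterm _ _ _ _ _) (inner_rate b * P) (vn rho) X => ? ? ? ?; lra.
  move=> /(_ hb) /(ler_wpM2l (ltW K0)) /(le_trans h1).
  have -> : K * (- inner_rate b * P - 3 / 200 * X + 2 * d) =
      K * (- inner_rate b * P - 3 / 200 * X) + e / 2.
    by rewrite /d; field; rewrite gt_eqF.
  by move: (_ * (_ - _)) (_ * IQ) => ? ?; lra.
have lower : dD <= 4 * (igau b * P + X).
  apply: (cvgr_to_le cvD); near=> rho.
  have br : b <= rho by near: rho; apply: nbhs_pinfty_ge; exact: num_real.
  rewrite (pint_split (ltW b0) br); last by move=> y _; exact: cont_density.
  rewrite mulrDr lerD//.
    have cP : continuous (fun r : R => r ^+ 2 * (u r ^+ 2 + u1 r ^+ 2)).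
      move=> r; have ? : {for r, continuous u} := @cu r.
      by have ? : {for r, continuous u1} := @cu1 r; cont.
    rewrite mulrA -pintZ; last by move=> y _; exact: cP.
    apply: pint_le => [y _|y _|y /andP[y0 yb]]; [exact: cont_density| |exact: density_in].
    by have ? : {for y, continuous (fun r : R => r ^+ 2 * (u r ^+ 2 + u1 r ^+ 2))} := @cP y; cont.
  apply: (@le_trans _ _ (4 * vn rho)); last by rewrite ler_pM2l// XP.
  rewrite /vn -pintZ; last by move=> y /andP[h _]; exact: cvn.
  apply: pint_le => [y _|y /andP[h _]|y /andP[h _]]; first exact: cont_density.
    by have ? := cvn h; cont.
  by have /andP[] := density_out h.
have ig0 := igau_gt0 b.
have r1 : rate <= inner_rate b / igau b by rewrite /rate ge_min lexx.
have r2 : rate <= 3 / 200 by rewrite /rate ge_min lexx orbT.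
have rate0 : 0 <= rate.
  by rewrite /rate le_min divr_ge0 ?(ltW ig0) ?(ltW (inner_rate_gt0 b64))//= divr_ge0.
have step : - inner_rate b * P - 3 / 200 * X <= - (rate / 4) * dD.
  have a1 : rate * (igau b * P) <= inner_rate b * P.
    by rewrite mulrA ler_wpM2r// -ler_pdivlMr.
  have a2 : rate * X <= 3 / 200 * X by rewrite ler_wpM2r.
  have a3 := ler_wpM2l rate0 lower.
  have -> : - (rate / 4) * dD = - (rate * dD / 4) by ring.
  have e3 : rate * (4 * (igau b * P + X)) = 4 * (rate * (igau b * P) + rate * X) by ring.
  rewrite e3 in a3; move: a1 a2 a3; rewrite mulNr.
  by move: (rate * (igau b * P)) (rate * X) (rate * dD) (inner_rate b * P) (3 / 200 * X) => ? ? ? ? ?; lra.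
have := le_trans upper (ler_wpM2l (ltW K0) step).
rewrite ler_pdivrMl// => /le_trans; apply.
rewrite /dD /K le_eqVlt; apply/orP; left; apply/eqP.
move: ((8 * pi)^-1) (int3 _) rate => k' I c; field.
by rewrite gt_eqF.
Unshelve. all: by end_near. Qed.

End Coercivity.

Theorem theorem1p2 (R : realType) :
  exists W : 'rV[R]_3 -> R,
    measurable3 W /\
    (exists a b : R, 0 < a /\ 0 < b /\
       forall v, a <= W v <= b * bracket v `^ (21 / 2)) /\
    exists c : R, 0 < c /\
      forall f : 'rV[R]_3 -> R,
        C2 f ->
        radial f ->
        orthogonal3 f (fun _ => 1) ->
        (forall i : 'I_3, orthogonal3 f (fun v => v 0 i)) ->
        orthogonal3 f (fun v => enorm v ^+ 2) ->
        integrable3 (fun v => linearized_Q f v * f v * W v) ->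
        integrable3 (fun v => bracket v ^- 3 * (f v ^+ 2 + grad_sqr f v) * W v) ->
        int3 (fun v => linearized_Q f v * f v * W v) <=
        - c * int3 (fun v => bracket v ^- 3 * (f v ^+ 2 + grad_sqr f v) * W v).
Proof.
have b64 := @threshold_ge64 R.
exists (weight threshold); split; first exact: measurable_weight.
split.
  exists 1, (igau threshold); split; first exact: ltr01.
  split=> [|v]; first exact: igau_gt0.
  by rewrite /weight wrad_ge1 ?enorm_ge0//= wrad_le ?enorm_ge0.
exists (8 * disc_area * (8 * pi)^-1 * Num.min (inner_rate threshold / igau threshold) (3 / 200)).
split.
  rewrite mulr_gt0//.
    by rewrite !mulr_gt0 ?disc_area_gt0// invr_gt0 mulr_gt0// pi_gt0.
  by rewrite lt_min !divr_gt0 ?igau_gt0 ?inner_rate_gt0.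
by move=> f f2 rf mass0 _ energy0; exact: coercivity.
Qed.
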